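(* Let $m,n\ge 1$, let $F_1,F_2\in\mathcal{G}H^\infty(\mathcal{L}(\mathbb{C}^m))$ and $\Phi=F_1^*F_2\in L^\infty(\mathbb{T},\mathcal{L}(\mathbb{C}^m,\mathbb{C}^m))$, and let $\{G_i\}_{i=1}^n$ and $\{H_i\}_{i=1}^n$ be orthonormal sets in $H^2_{\mathbb{C}^m}(\mathbb{D})$. Define $T_n:H^2_{\mathbb{C}^m}(\mathbb{D})\to H^2_{\mathbb{C}^m}(\mathbb{D})$ by $T_n(F)=T_\Phi(F)+\sum_{i=1}^n\langle F,G_i\rangle H_i$. Then the subspace $\operatorname{Ker}T_n$ is nearly $S^*$-invariant with defect at most $n$, and the defect space is $$\mathcal{F}=\bigvee_{i=1}^n\{F_2^{-1}T_{F_1^{*-1}}(S^*H_i)\}=\bigvee_{i=1}^n\{F_2^{-1}S^*(T_{F_1^{*-1}}H_i)\}.$$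
   Context: $\mathbb{D}$ is the open unit disc and $\mathbb{T}$ the unit circle. $H^2_{\mathbb{C}^m}(\mathbb{D})$ is the $\mathbb{C}^m$-valued Hardy space, identified via radial boundary values with a closed subspace of $L^2(\mathbb{T},\mathbb{C}^m)$; $P_m$ is the orthogonal projection of $L^2(\mathbb{T},\mathbb{C}^m)$ onto $H^2_{\mathbb{C}^m}(\mathbb{D})$. For $\Phi\in L^\infty(\mathbb{T},\mathcal{L}(\mathbb{C}^m,\mathbb{C}^m))$ the Toeplitz operator is $T_\Phi F=P_m(\Phi F)$, $F\in H^2_{\mathbb{C}^m}(\mathbb{D})$; $\Phi^*$ denotes the pointwise adjoint on $\mathbb{T}$. $\mathcal{G}H^\infty(\mathcal{L}(\mathbb{C}^m))$ is the set of invertible elements of the algebra $H^\infty(\mathbb{D},\mathcal{L}(\mathbb{C}^m,\mathbb{C}^m))$ of bounded analytic $\mathcal{L}(\mathbb{C}^m,\mathbb{C}^m)$-valued functions on $\mathbb{D}$, regarded as a subalgebra of $L^\infty(\mathbb{T},\mathcal{L}(\mathbb{C}^m,\mathbb{C}^m))$; $F_1^{*-1}$ denotes $(F_1^* )^{-1}$. $S$ is the forward shift $SF(z)=zF(z)$ on $H^2_{\mathbb{C}^m}(\mathbb{D})$ and $S^*$ is its adjoint, the backward shift $S^*F(z)=(F(z)-F(0))/z$. $\bigvee$ denotes the (closed) linear span. A closed subspace $\mathcal{M}\subset H^2_{\mathbb{C}^m}(\mathbb{D})$ is nearly $S^*$-invariant with defect $p$ if there is a $p$-dimensional subspace $\mathcal{F}\subset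 H^2_{\mathbb{C}^m}(\mathbb{D})$ (which may be taken to be orthogonal to $\mathcal{M}$) such that $F\in\mathcal{M}$ and $F(0)=0$ imply $S^*F\in\mathcal{M}+\mathcal{F}$; such an $\mathcal{F}$ is called the defect space. ''Defect at most $n$ with defect space $\mathcal{F}$'' means that $\dim\mathcal{F}\le n$ and this implication holds with $\mathcal{F}$. *)

(* Defs.v *)
From HB Require Import structures.
From mathcomp Require Import all_boot all_order all_algebra.
From mathcomp Require Import all_classical all_reals all_analysis.
From mathcomp Require Import complex.
Set Implicit Arguments.
Unset Strict Implicit.
Unset Printing Implicit Defensive.
Import Order.TTheory GRing.Theory Num.Theory.
Import numFieldNormedType.Exports.
Local Open Scope classical_set_scope.
Local Open Scope ring_scope.
Local Open Scope complex_scope.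

(* The complex field is [R[i]] for [R : realType]; its topology is carried by
   the alias [R[i]^o].  Functions on the disc are functions on the subtype
   [disc R], so that [=] between them is equality of functions on the disc.
   A function on the unit circle is represented by a function of the angle
   [t : R], of which only the values on [[0, 2 pi]] matter. *)

Definition disc (R : realType) := {z : R[i] | `|z| < 1}.

Fact disc0_subproof (R : realType) : `|0 : R[i]| < 1.
Proof. by rewrite normr0. Qed.

Definition disc0 (R : realType) : disc R :=
  exist (fun z : R[i] => `|z| < 1) 0 (disc0_subproof R).

(* The point [z] when [`|z| < 1], and the centre otherwise. *)
Definition to_disc (R : realType) (z : R[i]) : disc R := insubd (disc0 R) z.

Definition expi (R : realType) (t : R) : R[i] := cos t +i* sin t.

(* [sum_k z^k A_k = F z] for all [z] in the disc (matrix entries separately). *)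
Definition is_power_series (R : realType) (m p : nat)
    (A : nat -> 'M[R[i]]_(m, p)) (F : disc R -> 'M[R[i]]_(m, p)) : Prop :=
  forall (z : disc R) (i : 'I_m) (j : 'I_p),
    (fun N : nat => (\sum_(k < N) val z ^+ k * A k i j : R[i]^o)) @ \oo
      --> (F z i j : R[i]^o).

Definition analytic (R : realType) (m p : nat)
    (F : disc R -> 'M[R[i]]_(m, p)) : Prop :=
  exists A : nat -> 'M[R[i]]_(m, p), is_power_series A F.

(* Radial boundary values; [lim] has a default value at the angles where the
   limit fails to exist. *)
Definition bv (R : realType) (m p : nat) (F : disc R -> 'M[R[i]]_(m, p))
    (t : R) : 'M[R[i]]_(m, p) :=
  \matrix_(i, j)
    lim ((fun r : R => (F (to_disc (r%:C * expi t)) i j : R[i]^o)) @ 1^'-).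

Definition adjmx (R : realType) (m : nat) (A : 'M[R[i]]_m) : 'M[R[i]]_m :=
  map_mx Num.conj A^T.

(* Linear in the first argument. *)
Definition cdot (R : realType) (m : nat) (u v : 'cV[R[i]]_m) : R[i] :=
  \sum_(i < m) u i 0 * Num.conj (v i 0).

Definition cnorm (R : realType) (m : nat) (u : 'cV[R[i]]_m) : R :=
  Num.sqrt (complex.Re (cdot u u)).

(* Normalized arc length measure dt / (2 pi). *)
Definition circle_int (R : realType) (f : R -> R[i]) : R[i] :=
  ((2 * pi)^-1 * \int[lebesgue_measure]_(t in `[0, 2 * pi]) complex.Re (f t))
  +i*
  ((2 * pi)^-1 * \int[lebesgue_measure]_(t in `[0, 2 * pi]) complex.Im (f t)).

Definition L2dot (R : realType) (m : nat) (f g : R -> 'cV[R[i]]_m) : R[i] :=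
  circle_int (fun t => cdot (f t) (g t)).

Definition H2 (R : realType) (m : nat) : set (disc R -> 'cV[R[i]]_m) :=
  [set F | exists2 A : nat -> 'cV[R[i]]_m,
     is_power_series A F & cvgn (series (fun k => cnorm (A k) ^+ 2))].
Arguments H2 : clear implicits.

(* The structure H2 inherits from L2 of the circle. *)
Definition H2dot (R : realType) (m : nat) (F G : disc R -> 'cV[R[i]]_m) :
  R[i] := L2dot (bv F) (bv G).

Definition H2norm (R : realType) (m : nat) (F : disc R -> 'cV[R[i]]_m) : R :=
  Num.sqrt (complex.Re (H2dot F F)).

(* Orthogonal projection of L2 onto H2, meaningful for [g] in L2: the element
   of H2 whose difference with [g] is orthogonal to H2. *)
Definition H2proj (R : realType) (m : nat) (g : R -> 'cV[R[i]]_m) :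
    disc R -> 'cV[R[i]]_m :=
  xget 0 [set F | H2 R m F /\
    forall K, H2 R m K -> L2dot (fun t => g t - bv F t) (bv K) = 0].

Definition toeplitz (R : realType) (m : nat) (Phi : R -> 'M[R[i]]_m)
    (F : disc R -> 'cV[R[i]]_m) : disc R -> 'cV[R[i]]_m :=
  H2proj (fun t => Phi t *m bv F t).

Definition Hinf (R : realType) (m : nat) : set (disc R -> 'M[R[i]]_m) :=
  [set F | analytic F /\
     exists M : R, forall (z : disc R) (v : 'cV[R[i]]_m),
       cnorm (F z *m v) <= M * cnorm v].

Definition GHinf (R : realType) (m : nat) : set (disc R -> 'M[R[i]]_m) :=
  [set F | Hinf F /\ exists2 K, Hinf K &
     forall z : disc R, F z *m K z = 1%:M /\ K z *m F z = 1%:M].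

(* [(F z - F 0) / z], with its removable singularity at 0 removed. *)
Definition bshift (R : realType) (m : nat) (F : disc R -> 'cV[R[i]]_m) :
    disc R -> 'cV[R[i]]_m :=
  xget 0 [set K | H2 R m K /\
    forall z : disc R, val z *: K z = F z - F (disc0 R)].

Definition orthonormal_set (R : realType) (m n : nat)
    (G : 'I_n -> disc R -> 'cV[R[i]]_m) : Prop :=
  (forall i, H2 R m (G i)) /\
  (forall i j, H2dot (G i) (G j) = (i == j)%:R).

Definition H2subspace (R : realType) (m : nat)
    (V : set (disc R -> 'cV[R[i]]_m)) : Prop :=
  [/\ V `<=` H2 R m, V 0 &
      forall (a : R[i]) F G, V F -> V G -> V (a *: F + G)].

Definition H2closed_subspace (R : realType) (m : nat)
    (V : set (disc R -> 'cV[R[i]]_m)) : Prop :=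
  H2subspace V /\
  forall F, H2 R m F ->
    (forall e : R, 0 < e -> exists2 G, V G & H2norm (F - G) < e) -> V F.

Definition cspan (R : realType) (m n : nat)
    (v : 'I_n -> disc R -> 'cV[R[i]]_m) : set (disc R -> 'cV[R[i]]_m) :=
  smallest (@H2closed_subspace R m) (range v).

Definition has_dim (R : realType) (m d : nat)
    (V : set (disc R -> 'cV[R[i]]_m)) : Prop :=
  exists2 v : 'I_d -> disc R -> 'cV[R[i]]_m,
    (forall c : 'I_d -> R[i],
       \sum_(i < d) c i *: v i = 0 -> forall i, c i = 0) &
    V = [set F | exists c : 'I_d -> R[i], F = \sum_(i < d) c i *: v i].

Definition nearly_invariant_defect_le (R : realType) (m n : nat)
    (M D : set (disc R -> 'cV[R[i]]_m)) : Prop :=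
  [/\ H2closed_subspace M, H2subspace D,
      (exists2 d : nat, (d <= n)%N & has_dim d D) &
      forall F, M F -> F (disc0 R) = 0 ->
        exists K L, [/\ M K, D L & bshift F = K + L]].

Definition perturbed_toeplitz (R : realType) (m n : nat)
    (Phi : R -> 'M[R[i]]_m) (G H : 'I_n -> disc R -> 'cV[R[i]]_m)
    (F : disc R -> 'cV[R[i]]_m) : disc R -> 'cV[R[i]]_m :=
  toeplitz Phi F + \sum_(i < n) H2dot F (G i) *: H i.

Definition kernel_in_H2 (R : realType) (m : nat)
    (T : (disc R -> 'cV[R[i]]_m) -> disc R -> 'cV[R[i]]_m) :
    set (disc R -> 'cV[R[i]]_m) :=
  [set F | H2 R m F /\ T F = 0].

(* Main.v *)
(** Boundary values are radial limits, so the argument rests on Fatou's theorem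
    for power series with square-summable coefficients: the Hardy-Littlewood
    maximal inequality for the Fejer kernel makes the Cesaro means converge
    almost everywhere, and Cesaro summability implies Abel summability.  This
    identifies [H^2] with a closed subspace of [L^2] of the circle.

    Let [F] be in the kernel with [F(0) = 0], and put [z F_1^{-1} K] as test
    function against [T_n F = 0].  As multiplication by [z] is isometric,
    [<F_2 S^*F, K> = - sum_i <F, G_i> <S^*H_i, F_1^{-1} K>], that is,
    [F_2 S^*F = - sum_i <F, G_i> T_{F_1^{*-1}} (S^*H_i)].  So [S^*F] already lies
    in the defect space.  The two descriptions of that space agree because
    [T_{F_1^{*-1}}] is the adjoint of multiplication by [F_1^{-1}], which commutes
    with multiplication by [z].  The kernel is closed, being the orthogonal
    complement of the vectors [T_n^* K]. *)
Require Import Defs.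
From HB Require Import structures.
From mathcomp Require Import all_boot all_order all_algebra.
From mathcomp Require Import all_classical all_reals all_analysis.
From mathcomp Require Import complex.
From mathcomp Require Import measurable_realfun ring lra.
Set Implicit Arguments.
Unset Strict Implicit.
Unset Printing Implicit Defensive.
Import Order.TTheory GRing.Theory Num.Theory.
Import numFieldNormedType.Exports.
Local Open Scope classical_set_scope.
Local Open Scope ring_scope.
Local Open Scope complex_scope.

(** Because [bv] is a pointwise [lim] with a default value, no identity between boundary values, not
    even additivity, is available before radial limits are known to exist almost everywhere.
    Moreover such a [bv] is only almost everywhere equal to a measurable function, so integrals have
    to be compared without measurability of one side. The maximal inequality enters through tails:
    cutting a square-summable sequence far out leaves a polynomial, whose means converge everywhere,
    and a tail whose means are small off a small set. Fatou's lemma for integrals then shows that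
    the pointwise limit is also the mean-square limit of the partial sums, so the Fourier
    coefficients of [bv F] are the Taylor coefficients of [F]. Products with bounded functions are
    estimated on circles of radius [r < 1], where no boundary values occur. In the operator part
    every identity is tested against elements [K] of H^2. The test function [z F_1^{-1} K] is chosen
    because [F_1] maps it to [z K]: this removes the factor [F_1^*] of the symbol, and the remaining
    [z] meets [F = z S^*F]. *)

Section ComplexNumbers.
Context {R : realType}.
Implicit Types z w : R[i].

(** The norm of [R[i]] has values in [R[i]]; estimates are made on this real squared modulus
    instead. *)
Definition nsq z : R := complex.Re z ^+ 2 + complex.Im z ^+ 2.

Lemma nsq_ge0 z : 0 <= nsq z.
Proof. by rewrite addr_ge0 ?sqr_ge0. Qed.

Lemma nsqM z w : nsq (z * w) = nsq z * nsq w.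
Proof. by case: z => a b; case: w => c d; rewrite /nsq /=; ring. Qed.

Lemma nsq0 : nsq 0 = 0.
Proof. by rewrite /nsq /= expr0n addr0. Qed.

Lemma nsq1 : nsq 1 = 1.
Proof. by rewrite /nsq /= expr0n expr1n addr0. Qed.

Lemma nsqX z n : nsq (z ^+ n) = nsq z ^+ n.
Proof.
by elim: n => [|n IH]; rewrite ?expr0 ?nsq1// !exprS nsqM IH.
Qed.

Lemma nsq_real (x : R) : nsq x%:C = x ^+ 2.
Proof. by rewrite /nsq /= expr0n addr0. Qed.

Lemma nsqN z : nsq (- z) = nsq z.
Proof. by case: z => a b; rewrite /nsq /= !sqrrN. Qed.

Lemma nsq_eq0 z : nsq z = 0 -> z = 0.
Proof.
case: z => a b /eqP; rewrite /nsq /= paddr_eq0 ?sqr_ge0// !sqrf_eq0.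
by case/andP => /eqP-> /eqP->.
Qed.

Lemma nsqE z : (nsq z)%:C = z * Num.conj z.
Proof.
by case: z => a b; rewrite /nsq /=; congr Complex => /=; ring.
Qed.

Lemma normc_nsq z : `|z| = (Num.sqrt (nsq z))%:C.
Proof. by rewrite normc_def. Qed.

Lemma nsqD_le z w : nsq (z + w) <= 2 * nsq z + 2 * nsq w.
Proof.
case: z => a b; case: w => c d; rewrite /nsq /=.
have := sqr_ge0 (a - c); have := sqr_ge0 (b - d); lra.
Qed.

Lemma cReM z w : complex.Re (z * w) =
  complex.Re z * complex.Re w - complex.Im z * complex.Im w.
Proof. by case: z w => a b []. Qed.

Lemma cImM z w : complex.Im (z * w) =
  complex.Re z * complex.Im w + complex.Im z * complex.Re w.
Proof. by case: z w => a b []. Qed.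

Lemma cReD z w : complex.Re (z + w) = complex.Re z + complex.Re w.
Proof. by case: z w => a b []. Qed.
Lemma cImD z w : complex.Im (z + w) = complex.Im z + complex.Im w.
Proof. by case: z w => a b []. Qed.
Lemma cReN z : complex.Re (- z) = - complex.Re z.
Proof. by case: z => a b. Qed.
Lemma cImN z : complex.Im (- z) = - complex.Im z.
Proof. by case: z => a b. Qed.
Lemma cReJ z : complex.Re (Num.conj z) = complex.Re z.
Proof. by case: z => a b. Qed.
Lemma cImJ z : complex.Im (Num.conj z) = - complex.Im z.
Proof. by case: z => a b. Qed.

Lemma cRe_sum I (r : seq I) (P : pred I) (F : I -> R[i]) :
  complex.Re (\sum_(i <- r | P i) F i) = \sum_(i <- r | P i) complex.Re (F i).
Proof. by apply: (big_morph (@complex.Re R)) => // z w; rewrite cReD. Qed.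
Lemma cIm_sum I (r : seq I) (P : pred I) (F : I -> R[i]) :
  complex.Im (\sum_(i <- r | P i) F i) = \sum_(i <- r | P i) complex.Im (F i).
Proof. by apply: (big_morph (@complex.Im R)) => // z w; rewrite cImD. Qed.

Lemma complex_eq z w : complex.Re z = complex.Re w ->
  complex.Im z = complex.Im w -> z = w.
Proof. by case: z w => a b [c d] /= -> ->. Qed.

Lemma sqr_Re_le z : complex.Re z ^+ 2 <= nsq z.
Proof. by rewrite /nsq lerDl sqr_ge0. Qed.
Lemma sqr_Im_le z : complex.Im z ^+ 2 <= nsq z.
Proof. by rewrite /nsq lerDr sqr_ge0. Qed.

(** Norm balls of [R[i]^o] have radii in [R[i]]. Passing to coordinates brings every complex limit
    under the real theory; in the converse each coordinate gets half of the radius. *)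
Lemma cvg_complexP (T : Type) (F : set_system T) (FF : Filter F)
    (u : T -> R[i]) (l : R[i]) :
  ((fun x => (u x : R[i]^o)) @ F --> (l : R[i]^o)) <->
  ((fun x => complex.Re (u x)) @ F --> complex.Re l) /\
  ((fun x => complex.Im (u x)) @ F --> complex.Im l).
Proof.
split.
- move=> /cvgrPdist_lt ul; split; apply/cvgrPdist_lt => e e0.
  + have e0' : 0 < e%:C by rewrite ltcR.
    have := ul _ e0'; apply: filterS => x.
    rewrite normc_nsq ltcR; apply: le_lt_trans.
    rewrite -cReN -cReD -[leLHS]sqrtr_sqr.
    by rewrite ler_sqrt ?nsq_ge0// sqr_Re_le.
  + have e0' : 0 < e%:C by rewrite ltcR.
    have := ul _ e0'; apply: filterS => x.
    rewrite normc_nsq ltcR; apply: le_lt_trans.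
    rewrite -cImN -cImD -[leLHS]sqrtr_sqr.
    by rewrite ler_sqrt ?nsq_ge0// sqr_Im_le.
- move=> [/cvgrPdist_lt ur /cvgrPdist_lt ui]; apply/cvgrPdist_lt => -[e e'] /=.
  (* Positivity in [R[i]] forces the imaginary part to vanish, so the radius is real. *)
  rewrite ltcE /= => /andP[/eqP -> e0].
  have e20 : 0 < e / 2 by rewrite divr_gt0.
  move: (ur _ e20) (ui _ e20); apply: filterS2 => x.
  rewrite -cReN -cReD -cImN -cImD; set z := _ - _ => hr hi.
  rewrite normc_nsq ltcR -(ger0_norm (ltW e0)) -sqrtr_sqr ltr_sqrt ?exprn_gt0//.
  rewrite /nsq -(real_normK (num_real (complex.Re z))).
  rewrite -(real_normK (num_real (complex.Im z))).
  move: hr hi; have := normr_ge0 (complex.Re z); have := normr_ge0 (complex.Im z).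
  move: `|_| `|_| => x1 x2 x10 x20 h1 h2.
  rewrite !expr2; nra.
Qed.

End ComplexNumbers.

Section Expi.
Context {R : realType}.

Lemma expiD (s t : R) : expi (s + t) = expi s * expi t.
Proof.
rewrite /expi cosD sinD; congr Complex; rewrite addrC mulrC [X in _ + X]mulrC.
by rewrite addrC.
Qed.

Lemma expi0 : expi (0 : R) = 1.
Proof. by rewrite /expi cos0 sin0. Qed.

Lemma expiX (t : R) k : expi t ^+ k = expi (k%:R * t).
Proof.
elim: k => [|k IH]; first by rewrite expr0 mul0r expi0.
by rewrite exprS IH -expiD -natr1 mulrDl mul1r addrC.
Qed.

Lemma nsq_expi (t : R) : nsq (expi t) = 1.
Proof. by rewrite /nsq /= cos2Dsin2. Qed.

Lemma expiJ (t : R) : Num.conj (expi t) = expi (- t).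
Proof. by rewrite /expi cosN sinN. Qed.

End Expi.

(** * Inner products and Gram-Schmidt *)

Section InnerProduct.
Context {R : realType} {V : lmodType R[i]}.
Variables (P : set V) (phi : V -> V -> R[i]).

(** Relative to a set [P] in a larger vector space, because H^2 and the square-integrable functions
    are sets of functions. Definiteness is kept apart: it fails on the circle, where functions
    matter only almost everywhere, and holds on H^2. *)
Definition semi_inner_product : Prop :=
  [/\ P 0,
      (forall a x y, P x -> P y -> P (a *: x + y)),
      (forall a x y z, P x -> P y -> P z ->
         phi (a *: x + y) z = a * phi x z + phi y z),
      (forall x y, P x -> P y -> phi y x = Num.conj (phi x y)) &
      (forall x, P x -> 0 <= complex.Re (phi x x))].

Definition linear_span n (v : 'I_n -> V) : set V :=
  [set x | exists c : 'I_n -> R[i], x = \sum_(i < n) c i *: v i].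

Hypothesis phiP : semi_inner_product.

Lemma sip0 : P 0. Proof. by case: phiP. Qed.

Lemma sipPD a x y : P x -> P y -> P (a *: x + y).
Proof. by case: phiP => _ + _ _ _; exact. Qed.

Lemma sipP_add x y : P x -> P y -> P (x + y).
Proof. by move=> Px Py; rewrite -[x]scale1r; exact: sipPD. Qed.

Lemma sipP_scale a x : P x -> P (a *: x).
Proof. by move=> Px; rewrite -[_ *: _]addr0; apply: sipPD => //; exact: sip0. Qed.

Lemma sipP_sub x y : P x -> P y -> P (x - y).
Proof. by move=> Px Py; rewrite addrC -scaleN1r; exact: sipPD. Qed.

Lemma sipP_sum n (c : 'I_n -> R[i]) (v : 'I_n -> V) :
  (forall i, P (v i)) -> P (\sum_(i < n) c i *: v i).
Proof.
move=> Pv; apply: (big_ind P) => //; first exact: sip0.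
  exact: sipP_add.
by move=> i _; exact: sipP_scale.
Qed.

Lemma sip_linear a x y z : P x -> P y -> P z ->
  phi (a *: x + y) z = a * phi x z + phi y z.
Proof. by case: phiP => _ _ + _ _; exact. Qed.

Lemma sipC x y : P x -> P y -> phi y x = Num.conj (phi x y).
Proof. by case: phiP => _ _ _ + _; exact. Qed.

Lemma sip_ge0 x : P x -> 0 <= complex.Re (phi x x).
Proof. by case: phiP => _ _ _ _; exact. Qed.

Lemma sip_real x : P x -> phi x x = (complex.Re (phi x x))%:C.
Proof.
move=> Px; have := sipC Px Px; case: (phi x x) => a b /= [] b0.
by congr Complex; lra.
Qed.

Lemma sipDl x y z : P x -> P y -> P z -> phi (x + y) z = phi x z + phi y z.
Proof. by move=> Px Py Pz; rewrite -{1}[x]scale1r sip_linear// mul1r. Qed.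

Lemma sip0l z : P z -> phi 0 z = 0.
Proof.
move=> Pz; have := sip_linear 1 sip0 sip0 Pz.
rewrite scaler0 addr0 mul1r => /eqP.
by rewrite -subr_eq0 opprD addrA subrr sub0r oppr_eq0 => /eqP.
Qed.

Lemma sipZl a x z : P x -> P z -> phi (a *: x) z = a * phi x z.
Proof.
by move=> Px Pz; rewrite -[_ *: _]addr0 sip_linear ?sip0l ?addr0//; exact: sip0.
Qed.

Lemma sipBl x y z : P x -> P y -> P z -> phi (x - y) z = phi x z - phi y z.
Proof.
by move=> Px Py Pz; rewrite addrC -scaleN1r sip_linear// mulN1r addrC.
Qed.

Lemma sipDr x y z : P x -> P y -> P z -> phi x (y + z) = phi x y + phi x z.
Proof.
move=> Px Py Pz; have Pyz := sipP_add Py Pz.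
by rewrite sipC// sipDl// rmorphD/= -!sipC.
Qed.

Lemma sipZr a x y : P x -> P y -> phi x (a *: y) = Num.conj a * phi x y.
Proof.
move=> Px Py; rewrite sipC ?sipZl//; last exact: sipP_scale.
by rewrite rmorphM/= -sipC.
Qed.

Lemma sipBr x y z : P x -> P y -> P z -> phi x (y - z) = phi x y - phi x z.
Proof.
move=> Px Py Pz; have Pyz := sipP_sub Py Pz.
by rewrite sipC// sipBl// rmorphB/= -!sipC.
Qed.

Lemma sip_suml n (c : 'I_n -> R[i]) (v : 'I_n -> V) z :
  (forall i, P (v i)) -> P z ->
  phi (\sum_(i < n) c i *: v i) z = \sum_(i < n) c i * phi (v i) z.
Proof.
elim: n c v => [|n IH] c v Pv Pz; first by rewrite !big_ord0 sip0l.
by rewrite !big_ord_recl sip_linear// ?IH//; exact: sipP_sum.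
Qed.

Lemma sip_sumr n (c : 'I_n -> R[i]) (v : 'I_n -> V) z :
  (forall i, P (v i)) -> P z ->
  phi z (\sum_(i < n) c i *: v i) = \sum_(i < n) Num.conj (c i) * phi z (v i).
Proof.
move=> Pv Pz; rewrite sipC//; last exact: sipP_sum.
rewrite sip_suml// rmorph_sum; apply: eq_bigr => i _.
by rewrite rmorphM/= -sipC.
Qed.

(** Positivity at [x - s c z] with [c = phi x z] and [s] real gives [0 <= A - 2 s N + s^2 N B]; a
    suitable [s] finishes. *)
Lemma sip_cauchy_schwarz x z : P x -> P z ->
  nsq (phi x z) <= complex.Re (phi x x) * complex.Re (phi z z).
Proof.
move=> Px Pz; set c := phi x z; set N := nsq c.
set A := complex.Re _; set B := complex.Re _.
have quad (s : R) : 0 <= A - 2 * s * N + s ^+ 2 * N * B.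
  have Py : P ((- (s%:C * c)) *: z + x) by apply: sipPD.
  have := sip_ge0 Py.
  rewrite sip_linear// !sipDr//; try exact: sipP_scale.
  rewrite !sipZr//.
  rewrite (sip_real Px) (sip_real Pz) (sipC Px Pz) -/A -/B -/c.
  rewrite rmorphN rmorphM /=.
  suff -> : complex.Re (- (s%:C * c) *
      (- (Num.conj s%:C * Num.conj c) * B%:C + Num.conj c) +
      (- (Num.conj s%:C * Num.conj c) * c + A%:C)) =
      A - 2 * s * N + s ^+ 2 * N * B by [].
  by rewrite /N /nsq; case: (c) => a b /=; ring.
have N0 : 0 <= N := nsq_ge0 _.
(* If [B = 0] the quadratic is affine and [s = (A + 1) / (2 N)] makes it [-1]; if [B > 0], its value
   at [s = 1 / B] is [(A B - N) / B]. *)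
have := sip_ge0 Pz; rewrite -/B le_eqVlt => /orP[/eqP B0|B0].
  rewrite -B0 mulr0 leNgt; apply/negP => N1.
  have := quad ((A + 1) / (2 * N)); rewrite -B0 mulr0 addr0.
  suff -> : A - 2 * ((A + 1) / (2 * N)) * N = -1 by rewrite ler0N1.
  by field; rewrite gt_eqF.
have := quad B^-1.
have -> : A - 2 * B^-1 * N + B^-1 ^+ 2 * N * B = (A * B - N) / B.
  by field; rewrite gt_eqF.
by rewrite pmulr_lge0 ?invr_gt0// subr_ge0.
Qed.

Lemma linear_span_closed n (v : 'I_n -> V) a x y :
  linear_span v x -> linear_span v y -> linear_span v (a *: x + y).
Proof.
move=> [c ->] [d ->]; exists (fun i => a * c i + d i).
rewrite scaler_sumr -big_split /=; apply: eq_bigr => i _.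
by rewrite scalerDl scalerA.
Qed.

Lemma linear_span0 n (v : 'I_n -> V) : linear_span v 0.
Proof. by exists (fun=> 0); rewrite big1// => i _; rewrite scale0r. Qed.

Lemma linear_span_gen n (v : 'I_n -> V) i : linear_span v (v i).
Proof.
exists (fun j => (j == i)%:R); rewrite (bigD1 i)//= eqxx scale1r big1 ?addr0//.
by move=> j /negPf ->; rewrite scale0r.
Qed.

Lemma linear_span_sum n (v : 'I_n -> V) m (c : 'I_m -> R[i]) (w : 'I_m -> V) :
  (forall i, linear_span v (w i)) -> linear_span v (\sum_(i < m) c i *: w i).
Proof.
move=> vw; apply: (big_ind (linear_span v)); first exact: linear_span0.
  by move=> x y vx vy; rewrite -[x]scale1r; exact: linear_span_closed.
by move=> i _; rewrite -[_ *: _]addr0; apply: linear_span_closed;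
  [exact: vw|exact: linear_span0].
Qed.

Definition orthonormal_family d (u : 'I_d -> V) :=
  (forall i, P (u i)) /\ forall i j, phi (u i) (u j) = (i == j)%:R.

Lemma orthonormal_residue d (u : 'I_d -> V) x j : orthonormal_family u ->
  P x -> phi (x - \sum_(i < d) phi x (u i) *: u i) (u j) = 0.
Proof.
move=> [Pu ou] Px; have Ps := sipP_sum (fun i => phi x (u i)) Pu.
rewrite sipBl// sip_suml// (bigD1 j)//= ou eqxx mulr1 big1 ?addr0 ?subrr//.
by move=> i /negPf ij; rewrite ou ij mulr0.
Qed.

Lemma orthonormal_family_free d (u : 'I_d -> V) (c : 'I_d -> R[i]) :
  orthonormal_family u -> \sum_(i < d) c i *: u i = 0 -> forall i, c i = 0.
Proof.
move=> [Pu ou] cu j; have : phi (\sum_(i < d) c i *: u i) (u j) = 0.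
  by rewrite cu sip0l.
rewrite sip_suml// (bigD1 j)//= ou eqxx mulr1 big1 ?addr0//.
by move=> i /negPf ij; rewrite ou ij mulr0.
Qed.

Hypothesis phi_definite : forall x, P x -> phi x x = 0 -> x = 0.

(** A vector whose residue against the family already built is zero is dropped, which is why [d] may
    be smaller than [n]. A possibly dependent spanning family thus yields a basis of size at most
    [n]. *)
Lemma gram_schmidt n (v : 'I_n -> V) : (forall i, P (v i)) ->
  exists d (u : 'I_d -> V),
    [/\ (d <= n)%N, orthonormal_family u & linear_span u = linear_span v].
Proof.
elim: n v => [|n IH] v Pv; first by exists 0%N, v; split=> //; split=> // -[].
have [d [u [dn [Pu ou] uv]]] := IH (fun i => v (lift ord0 i)) (fun i => Pv _).
have Eu i : linear_span v (u i).
  have [c ->] : linear_span (fun i => v (lift ord0 i)) (u i).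
    by rewrite -uv; exact: linear_span_gen.
  by apply: linear_span_sum => j; exact: linear_span_gen.
have uE i : linear_span u (v (lift ord0 i)).
  by rewrite uv; exact: (linear_span_gen (fun i => v (lift ord0 i))).
set w := v ord0 - \sum_(i < d) phi (v ord0) (u i) *: u i.
have Pw : P w by apply: sipP_sub => //; exact: sipP_sum.
have [w0|wN0] := pselect (w = 0).
  exists d, u; split=> //; first by rewrite (leq_trans dn).
  apply/seteqP; split => x [c ->].
    exact: linear_span_sum.
  apply: linear_span_sum => i; case: (unliftP ord0 i) => [j ->//|->].
  by exists (fun i => phi (v ord0) (u i)); apply/eqP; rewrite -subr_eq0 -/w w0.
have nw : 0 < complex.Re (phi w w).
  rewrite lt_neqAle sip_ge0// andbT; apply/eqP => w0; apply: wN0.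
  by apply: phi_definite => //; rewrite sip_real// -w0.
set s := (Num.sqrt (complex.Re (phi w w)))^-1.
have sN0 : s%:C != 0 :> R[i].
  by rewrite eq_complex /= eqxx andbT invr_eq0 gt_eqF// sqrtr_gt0.
have Psw : P (s%:C *: w) by exact: sipP_scale.
have wu j : phi (s%:C *: w) (u j) = 0.
  by rewrite sipZl// orthonormal_residue ?mulr0.
(* The new unit vector takes index [ord0]; [unlift] sends the other indices to the old family. *)
exists d.+1, (fun i => oapp u (s%:C *: w) (unlift ord0 i)); split => //.
  split=> [i|i j].
    by rewrite /=; case: unliftP => [j _|_] /=.
  case: (unliftP ord0 i) => [i' ->|->]; case: (unliftP ord0 j) => [j' ->|->];
    rewrite ?liftK ?unlift_none /= ?(inj_eq lift_inj) ?ou//.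
  - by rewrite sipC// wu conjC0.
  - rewrite sipZl// sipZr// sip_real//.
    apply/eqP; rewrite eq_complex /=; apply/andP; split; apply/eqP; last by ring.
    rewrite !mul0r oppr0 !mulr0 !addr0 !subr0 mulrA -expr2 /s exprVn sqr_sqrtr ?ltW//.
    by rewrite mulVf// gt_eqF.
set u' := fun i => _.
have u'0 : u' ord0 = s%:C *: w by rewrite /u' unlift_none.
have u'l i : u' (lift ord0 i) = u i by rewrite /u' liftK.
apply/seteqP; split=> x [c ->]; apply: linear_span_sum => i;
  case: (unliftP ord0 i) => [j ->|->].
- by rewrite u'l; exact: Eu.
- rewrite u'0 -[_ *: _]addr0; apply: linear_span_closed; last exact: linear_span0.
  rewrite /w addrC -scaleN1r; apply: linear_span_closed; last exact: linear_span_gen.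
  exact: linear_span_sum.
- have [c' ->] := uE j; apply: linear_span_sum => k; rewrite -u'l.
  exact: linear_span_gen.
- have -> : v ord0 = (s%:C)^-1 *: u' ord0 +
      \sum_(i < d) phi (v ord0) (u i) *: u' (lift ord0 i).
    rewrite u'0 scalerA mulVf// scale1r.
    by rewrite (eq_bigr _ (fun i _ => congr1 _ (u'l i))) subrK.
  apply: linear_span_closed; first exact: linear_span_gen.
  by apply: linear_span_sum => k; exact: linear_span_gen.
Qed.

(** The residue [x - p] is orthogonal to the span, so by Pythagoras its norm is at most the distance
    from [x] to any [y] in the span, which is arbitrarily small. *)
Lemma linear_span_complete d (u : 'I_d -> V) x : orthonormal_family u -> P x ->
  (forall e : R, 0 < e -> exists2 y, linear_span u y &
     Num.sqrt (complex.Re (phi (x - y) (x - y))) < e) ->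
  linear_span u x.
Proof.
move=> ou Px near_x; have [Pu _] := ou.
set p := \sum_(i < d) phi x (u i) *: u i.
have Pp : P p by exact: sipP_sum.
have Pw : P (x - p) by exact: sipP_sub.
suff w0 : x - p = 0.
  by exists (fun i => phi x (u i)); apply/eqP; rewrite -subr_eq0 -/p w0.
apply: phi_definite => //; rewrite sip_real//; congr (_%:C).
apply/eqP; rewrite eq_le sip_ge0// andbT; apply/ler_addgt0Pl => e e0.
rewrite addr0.
have e0' : 0 < Num.sqrt e by rewrite sqrtr_gt0.
have [y [c ->]] := near_x _ e0'.
rewrite ltr_sqrt// => /ltW; apply: le_trans.
set y' := \sum_(i < d) c i *: u i.
have Py' : P y' by exact: sipP_sum.
have Pq : P (p - y') by exact: sipP_sub.
have -> : x - y' = (x - p) + (p - y') by rewrite addrA subrK.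
have wq : phi (x - p) (p - y') = 0.
  have -> : p - y' = \sum_(i < d) (phi x (u i) - c i) *: u i.
    by rewrite /p /y' -sumrB; apply: eq_bigr => i _; rewrite scalerBl.
  by rewrite sip_sumr// big1// => i _; rewrite orthonormal_residue ?mulr0.
have qw : phi (p - y') (x - p) = 0 by rewrite sipC// wq conjC0.
have Pwq : P ((x - p) + (p - y')) by exact: sipP_add.
rewrite (sipDl Pw Pq Pwq) (sipDr Pw Pw Pq) (sipDr Pq Pw Pq) wq qw addr0 add0r.
by rewrite cReD lerDl sip_ge0.
Qed.

End InnerProduct.

(** * Square-integrable functions on the circle *)

Section IntegralAE.
Local Open Scope ereal_scope.
Context d (T : measurableType d) (R : realType).
Variables (mu : {measure set T -> \bar R}) (D : set T).
Hypothesis mD : measurable D.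

(** The integral of a nonnegative function is a supremum over the simple functions below it, and
    enlarging the function only enlarges that set. *)
Lemma ge0_integral_mono (f g : T -> \bar R) :
  (forall x, D x -> 0 <= f x) -> (forall x, D x -> f x <= g x) ->
  \int[mu]_(x in D) f x <= \int[mu]_(x in D) g x.
Proof.
move=> f0 fg; rewrite !ge0_integralE//; last first.
  by move=> x Dx; exact: le_trans (f0 _ Dx) (fg _ Dx).
apply: le_ereal_sup => _ [h hf <-]; exists h => // x.
apply: le_trans (hf x) _; rewrite !patchE; case: ifPn => // /set_mem Dx.
exact: fg.
Qed.

(* Unlike the library's [ge0_ae_eq_integral], [f] need not be measurable. *)
Lemma ge0_integral_ae (f g : T -> \bar R) :
  measurable_fun D g ->
  (forall x, D x -> 0 <= f x) -> (forall x, D x -> 0 <= g x) ->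
  {ae mu, forall x, D x -> f x = g x} -> \int[mu]_(x in D) f x = \int[mu]_(x in D) g x.
Proof.
move=> mg f0 g0 [N [mN N0 subN]].
have fgN x : D x -> ~ N x -> f x = g x.
  move=> Dx Nx; apply: contrapT => fg; apply: Nx; apply: subN => /=.
  by move/(_ Dx).
(* Two measurable comparison functions: both equal [g] off [N], and on [N] one is [+oo] and the
   other [0], so that they enclose [f]. *)
have g1E : {ae mu, forall x, D x -> (g \_ (~` N) \+ (cst +oo) \_ N) x = g x}.
  exists N; split => // x /= H; apply: contrapT => Nx; apply: H => _.
  by rewrite /= !patchE (mem_set (Nx : (~` N) x)) (memNset Nx) adde0.
have g2E : {ae mu, forall x, D x -> (g \_ (~` N)) x = g x}.
  exists N; split => // x /= H; apply: contrapT => Nx; apply: H => _.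
  by rewrite patchE (mem_set (Nx : (~` N) x)).
have mg2 : measurable_fun D (g \_ (~` N)).
  apply/measurable_restrict => //; first exact: measurableC.
  exact: measurable_funS mg.
have g20 x : D x -> 0 <= (g \_ (~` N)) x.
  by move=> Dx; rewrite patchE; case: ifPn => // _; exact: g0.
apply/eqP; rewrite eq_le; apply/andP; split.
- rewrite -(ge0_ae_eq_integral mD _ mg _ _ g1E)//; last 2 first.
  + apply: emeasurable_funD => //; apply/measurable_restrict => //.
  + move=> x Dx; apply: adde_ge0; first exact: g20.
    by rewrite patchE; case: ifPn => //= _; rewrite leey.
  apply: ge0_integral_mono => // x Dx; rewrite !patchE.
  have [Nx|Nx] := pselect (N x).
    by rewrite (mem_set Nx) memNset ?add0e ?leey//; exact: contrapT.
  by rewrite (mem_set (Nx : (~` N) x)) (memNset Nx) adde0 fgN.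
- rewrite -(ge0_ae_eq_integral mD mg2 mg g20 _ g2E)//.
  apply: ge0_integral_mono => // x Dx; rewrite patchE.
  case: ifPn => [/set_mem Nx|_]; last exact: f0.
  by rewrite fgN.
Qed.

Lemma Rintegral_ae (f g : T -> R) :
  measurable_fun D g -> {ae mu, forall x, D x -> f x = g x} ->
  (\int[mu]_(x in D) f x = \int[mu]_(x in D) g x)%R.
Proof.
move=> mg fg; rewrite /Rintegral; congr fine.
have mg' : measurable_fun D (EFin \o g) by exact/measurable_EFinP.
rewrite integralE [RHS]integralE; congr (_ - _).
- apply: ge0_integral_ae => //; first exact: measurable_funepos.
  move: fg; apply: filterS => x /= fg Dx.
  by rewrite !funeposE fg.
- apply: ge0_integral_ae => //; first exact: measurable_funeneg.
  move: fg; apply: filterS => x /= fg Dx.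
  by rewrite !funenegE fg.
Qed.

End IntegralAE.

Section CircleL2.
Context {R : realType}.
Local Notation mu := (@lebesgue_measure R).
Implicit Types (u v w : R -> R[i]) (f g : R -> R).

Definition circle : set (measurableTypeR R) := `[0, 2 * pi]%classic.

Lemma measurable_circle : measurable circle.
Proof. exact: measurable_itv. Qed.

Lemma two_pi_gt0 : 0 < 2 * pi :> R.
Proof. by rewrite mulr_gt0// pi_gt0. Qed.

Definition square_integrable f : Prop :=
  measurable_fun (circle : set (measurableTypeR R)) f /\
  mu.-integrable circle (EFin \o (fun t => f t ^+ 2)).

Lemma square_integrableM f g : square_integrable f -> square_integrable g ->
  mu.-integrable circle (EFin \o (fun t => f t * g t)).
Proof.
move=> [mf f2] [mg g2]; have mC := measurable_circle.
have := integrableD mC f2 g2.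
apply: le_integrable => //.
  by apply/measurable_EFinP; exact: measurable_funM.
move=> t _ /=; rewrite lee_fin normrM.
rewrite [leRHS]ger0_norm ?addr_ge0 ?sqr_ge0//.
rewrite -[f t ^+ 2]real_normK ?num_real// -[g t ^+ 2]real_normK ?num_real//.
have := sqr_ge0 (`|f t| - `|g t|); have := sqr_ge0 (`|f t| + `|g t|).
rewrite !expr2; lra.
Qed.

Lemma square_integrableD a f g : square_integrable f -> square_integrable g ->
  square_integrable (fun t => a * f t + g t).
Proof.
move=> fi gi; have [mf f2] := fi; have [mg g2] := gi.
have mC := measurable_circle.
split; first by apply: measurable_funD => //; exact: measurable_funM.
have fg := square_integrableM fi gi.
have := integrableD mC (integrableZl mC (a ^+ 2) f2)
  (integrableD mC (integrableZl mC (2 * a) fg) g2).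
apply: eq_integrable => // t _ /=.
by rewrite -!EFinM -!EFinD; congr EFin; ring.
Qed.

Lemma square_integrableN f : square_integrable f ->
  square_integrable (fun t => - f t).
Proof.
move=> [mf f2]; split; first exact: measurableT_comp.
by apply: eq_integrable f2 => //; [exact: measurable_circle|move=> t _ /=; rewrite sqrrN].
Qed.

Lemma continuous_square_integrable f : continuous f -> square_integrable f.
Proof.
move=> cf; have mC := measurable_circle; split.
  by apply: measurable_funTS; exact: continuous_measurable_fun.
apply: continuous_compact_integrable; first exact: segment_compact.
apply: continuous_subspaceT => t.
exact: (@continuous_comp _ _ _ f (fun x : R => x ^+ 2) t (cf t)
  (@exprn_continuous R 2 (f t))).
Qed.

(* Circle functions are only ever known almost everywhere to be equal to
   measurable ones, whence the representatives [v] below. *)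
Definition L1rep v := mu.-integrable circle (EFin \o (fun t => complex.Re (v t)))
  /\ mu.-integrable circle (EFin \o (fun t => complex.Im (v t))).

Definition L2rep v := square_integrable (fun t => complex.Re (v t)) /\
  square_integrable (fun t => complex.Im (v t)).

Definition ae_circle u v := {ae mu, forall t, circle t -> u t = v t}.

Definition L1circle u := exists2 v, L1rep v & ae_circle u v.
Definition L2circle u := exists2 v, L2rep v & ae_circle u v.

Lemma ae_circle_refl u : ae_circle u u.
Proof. exact: aeW. Qed.

Lemma ae_circle_sym u v : ae_circle u v -> ae_circle v u.
Proof. by apply: filterS => t h /h. Qed.

Lemma ae_circle_trans u v w : ae_circle u v -> ae_circle v w -> ae_circle u w.
Proof. by apply: filterS2 => t h1 h2 It; rewrite h1// h2. Qed.

Lemma L2circle_ae u v : ae_circle u v -> L2circle v -> L2circle u.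
Proof. by move=> uv [w vw]; exists w => //; exact: ae_circle_trans uv _. Qed.

Lemma circle_int_ae u v : L1rep v -> ae_circle u v ->
  circle_int u = circle_int v.
Proof.
move=> [rv iv] uv; rewrite /circle_int; congr (_ * _ +i* (_ * _)).
- apply: Rintegral_ae; first exact: measurable_circle.
    by case/integrableP : rv => /measurable_EFinP.
  by move: uv; apply: filterS => t h It; rewrite h.
- apply: Rintegral_ae; first exact: measurable_circle.
    by case/integrableP : iv => /measurable_EFinP.
  by move: uv; apply: filterS => t h It; rewrite h.
Qed.

Lemma circle_int_ae_eq u v : L1circle v -> ae_circle u v ->
  circle_int u = circle_int v.
Proof.
move=> [w Lw vw] uv; rewrite (circle_int_ae Lw vw); apply: circle_int_ae => //.
exact: ae_circle_trans vw.
Qed.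

Lemma L1rep_linear (a : R[i]) u v : L1rep u -> L1rep v ->
  L1rep (fun t => a * u t + v t).
Proof.
have mC := measurable_circle.
move=> [ru iu] [rv iv]; split.
- have := integrableD mC (integrableD mC (integrableZl mC (complex.Re a) ru)
    (integrableZl mC (- complex.Im a) iu)) rv.
  apply: eq_integrable => // t _ /=.
  by rewrite -!EFinM -!EFinD cReD cReM; congr EFin; ring.
- have := integrableD mC (integrableD mC (integrableZl mC (complex.Re a) iu)
    (integrableZl mC (complex.Im a) ru)) iv.
  apply: eq_integrable => // t _ /=.
  by rewrite -!EFinM -!EFinD cImD cImM; congr EFin; ring.
Qed.

Lemma L1circle_linear (a : R[i]) u v : L1circle u -> L1circle v ->
  L1circle (fun t => a * u t + v t).
Proof.
move=> [u' Lu uu'] [v' Lv vv']; exists (fun t => a * u' t + v' t).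
  exact: L1rep_linear.
by move: uu' vv'; apply: filterS2 => t h1 h2 It; rewrite h1// h2.
Qed.

Lemma circle_int_linear (a : R[i]) u v : L1circle u -> L1circle v ->
  circle_int (fun t => a * u t + v t) = a * circle_int u + circle_int v.
Proof.
have mC := measurable_circle.
move=> [u' Lu uu'] [v' Lv vv'].
rewrite (circle_int_ae Lu uu') (circle_int_ae Lv vv').
rewrite (@circle_int_ae _ (fun t => a * u' t + v' t)); first last.
- by move: uu' vv'; apply: filterS2 => t h1 h2 It; rewrite h1// h2.
- exact: L1rep_linear.
case: Lu Lv => [ru iu] [rv iv]; rewrite /circle_int -/circle.
set c := (2 * pi)^-1; apply: complex_eq.
- rewrite cReD cReM /=.
  have -> : \int[mu]_(t in circle) complex.Re (a * u' t + v' t) =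
      \int[mu]_(t in circle) ((complex.Re a * complex.Re (u' t)
      + - complex.Im a * complex.Im (u' t)) + complex.Re (v' t)).
    by apply: eq_Rintegral; move=> t _; rewrite cReD cReM; ring.
  rewrite RintegralD//; last first.
    have := integrableD mC (integrableZl mC (complex.Re a) ru)
      (integrableZl mC (- complex.Im a) iu).
    by apply: eq_integrable => // t _ /=; rewrite -!EFinM -!EFinD.
  rewrite RintegralD//; [|exact: (integrableZl mC (complex.Re a) ru)
    |exact: (integrableZl mC (- complex.Im a) iu)].
  by rewrite !RintegralZl//; ring.
- rewrite cImD cImM /=.
  have -> : \int[mu]_(t in circle) complex.Im (a * u' t + v' t) =
      \int[mu]_(t in circle) ((complex.Re a * complex.Im (u' t)
      + complex.Im a * complex.Re (u' t)) + complex.Im (v' t)).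
    by apply: eq_Rintegral; move=> t _; rewrite cImD cImM; ring.
  rewrite RintegralD//; last first.
    have := integrableD mC (integrableZl mC (complex.Re a) iu)
      (integrableZl mC (complex.Im a) ru).
    by apply: eq_integrable => // t _ /=; rewrite -!EFinM -!EFinD.
  rewrite RintegralD//; [|exact: (integrableZl mC (complex.Re a) iu)
    |exact: (integrableZl mC (complex.Im a) ru)].
  by rewrite !RintegralZl//; ring.
Qed.

Lemma circle_int_conj u : L1circle u ->
  circle_int (fun t => Num.conj (u t)) = Num.conj (circle_int u).
Proof.
have mC := measurable_circle.
move=> [v Lv uv]; rewrite (circle_int_ae Lv uv).
have [rv iv] := Lv.
rewrite (@circle_int_ae _ (fun t => Num.conj (v t))); first last.
- by move: uv; apply: filterS => t h It; rewrite h.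
- split.
    by apply: eq_integrable rv => // t _ /=; rewrite cReJ.
  by have := integrableN iv; apply: eq_integrable => // t _ /=; rewrite cImJ.
apply: complex_eq; rewrite /circle_int -/circle /=.
- by congr (_ * _); apply: eq_Rintegral => t _; rewrite cReJ.
- rewrite -mulrN; congr (_ * _).
  transitivity (\int[mu]_(t in circle) (-1 * complex.Im (v t))).
    by apply: eq_Rintegral => t _; rewrite cImJ mulN1r.
  by rewrite RintegralZl// mulN1r.
Qed.

Lemma L2rep_linear (a : R[i]) u v : L2rep u -> L2rep v ->
  L2rep (fun t => a * u t + v t).
Proof.
move=> [ru iu] [rv iv]; split.
- have := square_integrableD (complex.Re a) ru
    (square_integrableD (- complex.Im a) iu rv).
  by congr square_integrable; apply/funext => t; rewrite cReD cReM; ring.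
- have := square_integrableD (complex.Re a) iu
    (square_integrableD (complex.Im a) ru iv).
  by congr square_integrable; apply/funext => t; rewrite cImD cImM; ring.
Qed.

Lemma L2circle_linear (a : R[i]) u v : L2circle u -> L2circle v ->
  L2circle (fun t => a * u t + v t).
Proof.
move=> [u' Lu uu'] [v' Lv vv']; exists (fun t => a * u' t + v' t).
  exact: L2rep_linear.
by move: uu' vv'; apply: filterS2 => t h1 h2 It; rewrite h1// h2.
Qed.

Lemma L2rep0 : L2rep (fun=> 0).
Proof. by split; apply: continuous_square_integrable => t; exact: cvg_cst. Qed.

Lemma L2rep_conj u : L2rep u -> L2rep (fun t => Num.conj (u t)).
Proof.
move=> [ru iu]; split.
- by move: ru; congr square_integrable; apply/funext => t; rewrite cReJ.
- have := square_integrableN iu.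
  by congr square_integrable; apply/funext => t; rewrite cImJ.
Qed.

Lemma L2repM u v : L2rep u -> L2rep v -> L1rep (fun t => u t * v t).
Proof.
have mC := measurable_circle.
move=> [ru iu] [rv iv]; split.
- have := integrableB mC (square_integrableM ru rv) (square_integrableM iu iv).
  by apply: eq_integrable => // t _ /=; rewrite -EFinB cReM.
- have := integrableD mC (square_integrableM ru iv) (square_integrableM iu rv).
  by apply: eq_integrable => // t _ /=; rewrite -EFinD cImM.
Qed.

Lemma L2circleMJ u v : L2circle u -> L2circle v ->
  L1circle (fun t => u t * Num.conj (v t)).
Proof.
move=> [u' Lu uu'] [v' Lv vv']; exists (fun t => u' t * Num.conj (v' t)).
  by apply: L2repM => //; exact: L2rep_conj.
by move: uu' vv'; apply: filterS2 => t h1 h2 It; rewrite h1// h2.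
Qed.

Definition sdot u v : R[i] := circle_int (fun t => u t * Num.conj (v t)).

Lemma sdot_ae u u' v v' : L2circle u' -> L2circle v' ->
  ae_circle u u' -> ae_circle v v' -> sdot u v = sdot u' v'.
Proof.
move=> Lu Lv uu' vv'; apply: circle_int_ae_eq; first exact: L2circleMJ.
by move: uu' vv'; apply: filterS2 => t h1 h2 It; rewrite h1// h2.
Qed.

Lemma sdot_sip : semi_inner_product
  (L2circle : set (R -> R[i]^o)) (sdot : (R -> R[i]^o) -> (R -> R[i]^o) -> R[i]).
Proof.
split.
- by exists (fun=> 0); [exact: L2rep0|exact: ae_circle_refl].
- by move=> a u v Lu Lv; exact: L2circle_linear.
- move=> a u v w Lu Lv Lw; rewrite /sdot -circle_int_linear; first last.
  + exact: L2circleMJ.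
  + exact: L2circleMJ.
  by congr circle_int; apply/funext => t; rewrite mulrDl mulrA.
- move=> u v Lu Lv; rewrite /sdot -circle_int_conj; last exact: L2circleMJ.
  congr circle_int; apply/funext => t.
  by rewrite rmorphM/= conjCK mulrC.
- move=> u Lu /=; apply: mulr_ge0; first by rewrite invr_ge0 ltW// two_pi_gt0.
  by apply: Rintegral_ge0 => t _; rewrite -nsqE /= nsq_ge0.
Qed.

End CircleL2.

(** * Trigonometric polynomials, orthogonality and Parseval *)

Section TrigonometricPolynomials.
Context {R : realType}.
Local Notation mu := (@lebesgue_measure R).
Implicit Types (u v : R -> R[i]).

Definition ccontinuous u :=
  continuous (fun t => complex.Re (u t)) /\ continuous (fun t => complex.Im (u t)).

Lemma ccontinuous_cst (c : R[i]) : ccontinuous (fun=> c).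
Proof. by split => t; exact: cvg_cst. Qed.

Lemma ccontinuousD u v : ccontinuous u -> ccontinuous v ->
  ccontinuous (fun t => u t + v t).
Proof.
move=> [ru iu] [rv iv]; split => t.
- by under eq_fun do rewrite cReD; apply: cvgD; [exact: ru|exact: rv].
- by under eq_fun do rewrite cImD; apply: cvgD; [exact: iu|exact: iv].
Qed.

Lemma ccontinuousM u v : ccontinuous u -> ccontinuous v ->
  ccontinuous (fun t => u t * v t).
Proof.
move=> [ru iu] [rv iv]; split => t.
- under eq_fun do rewrite cReM.
  by apply: cvgB; apply: cvgM; [exact: ru|exact: rv|exact: iu|exact: iv].
- under eq_fun do rewrite cImM.
  by apply: cvgD; apply: cvgM; [exact: ru|exact: iv|exact: iu|exact: rv].
Qed.

Lemma ccontinuousJ u : ccontinuous u -> ccontinuous (fun t => Num.conj (u t)).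
Proof.
move=> [ru iu]; split => t.
- by under eq_fun do rewrite cReJ; exact: ru.
- by under eq_fun do rewrite cImJ; apply: cvgN; exact: iu.
Qed.

Lemma ccontinuous_expi : ccontinuous (@expi R).
Proof. by split; [exact: continuous_cos|exact: continuous_sin]. Qed.

Lemma ccontinuousX u n : ccontinuous u -> ccontinuous (fun t => u t ^+ n).
Proof.
move=> cu; elim: n => [|n IH].
  by under eq_fun do rewrite expr0; exact: ccontinuous_cst.
by under eq_fun do rewrite exprS; exact: ccontinuousM.
Qed.

Lemma ccontinuous_sum I (r : seq I) (P : pred I) (u : I -> R -> R[i]) :
  (forall i, ccontinuous (u i)) -> ccontinuous (fun t => \sum_(i <- r | P i) u i t).
Proof.
move=> cu; elim: r => [|i r IH].
  by under eq_fun do rewrite big_nil; exact: ccontinuous_cst.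
under eq_fun do rewrite big_cons; case: (P i) => //.
exact: ccontinuousD.
Qed.

Lemma ccontinuous_integrable u (x y : R) : ccontinuous u ->
  mu.-integrable `[x, y] (EFin \o (fun t => complex.Re (u t))).
Proof.
move=> [ru _]; apply: continuous_compact_integrable; first exact: segment_compact.
exact: continuous_subspaceT.
Qed.

Lemma ccontinuous_L2rep u : ccontinuous u -> L2rep u.
Proof. by move=> [ru iu]; split; exact: continuous_square_integrable. Qed.

Lemma ccontinuous_L2circle u : ccontinuous u -> L2circle u.
Proof.
by move=> cu; exists u; [exact: ccontinuous_L2rep|exact: ae_circle_refl].
Qed.

Definition tmon (k : nat) (t : R) : R[i] := expi t ^+ k.

Lemma ccontinuous_tmon k : ccontinuous (tmon k).
Proof. exact/ccontinuousX/ccontinuous_expi. Qed.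

Definition tpoly (a : nat -> R[i]) (n : nat) (t : R) : R[i] :=
  \sum_(k < n) a k * tmon k t.

Lemma ccontinuous_tpoly a n : ccontinuous (tpoly a n).
Proof.
apply: ccontinuous_sum => k; apply: ccontinuousM; first exact: ccontinuous_cst.
exact: ccontinuous_tmon.
Qed.

(** The primitive [F] is the real part of [c exp(i w s) / (i w)], with equal values at the two ends.
    The free factor [c] lets real and imaginary parts share one statement. *)
Lemma integral_expi_eq0 (c : R[i]) (w x y : R) : x < y -> w != 0 ->
  expi (w * x) = expi (w * y) ->
  \int[mu]_(s in `[x, y]) complex.Re (c * expi (w * s)) = 0.
Proof.
move=> xy w0 [cxy sxy].
pose f := fun s => complex.Re c * cos (w * s) - complex.Im c * sin (w * s).
pose F := fun s => w^-1 * (complex.Re c * sin (w * s) + complex.Im c * cos (w * s)).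
have dF (s : R) : is_derive s (1 : R) F (f s).
  rewrite /F /f; apply: is_derive_eq.
  rewrite /GRing.scale /=.
  by field.
have cf : continuous f.
  move=> s; apply: differentiable_continuous; apply/derivable1_diffP.
  by rewrite /f; apply: ex_derive.
rewrite /Rintegral.
under eq_integral do rewrite cReM /=.
rewrite (@continuous_FTC2 _ f F)//.
- by rewrite /F cxy sxy -EFinB subrr.
- exact: continuous_subspaceT.
- have Fc : continuous F.
    by move=> s; apply: differentiable_continuous; apply/derivable1_diffP.
  split.
  + by move=> s _; exact: ex_derive.
  + by apply: cvg_at_right_filter; exact: Fc.
  + by apply: cvg_at_left_filter; exact: Fc.
- by move=> s _; rewrite derive1E; exact: derive_val.
Qed.

Lemma expi_2piX n : expi ((2 * pi) *+ n) = 1 :> R[i].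
Proof.
elim: n => [|n IH]; first by rewrite mulr0n expi0.
rewrite mulrS expiD IH mulr1 /expi; congr Complex.
- by rewrite mulr_natl cos2pi.
- by rewrite mulr_natl sin2pi.
Qed.

(** Any starting point and any number [q] of periods are allowed: the Fejer integral uses one period
    centred at [t], the weak-type bound two periods. *)
Lemma integral_tmon (c : R[i]) (k j q : nat) (x : R) : (0 < q)%N ->
  \int[mu]_(s in `[x, x + (2 * pi) *+ q])
    complex.Re (c * (tmon k s * Num.conj (tmon j s))) =
  (2 * pi) *+ q * (complex.Re c * (k == j)%:R).
Proof.
move=> q0; have q2 : 0 < (2 * pi) *+ q :> R by rewrite pmulrn_rgt0 ?two_pi_gt0.
have E s : tmon k s * Num.conj (tmon j s) = expi ((k%:R - j%:R) * s).
  by rewrite /tmon rmorphXn /= expiJ !expiX mulrBl expiD mulrN.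
have per k' : expi (k'%:R * (x + (2 * pi) *+ q)) = expi (k'%:R * x).
  by rewrite -!expiX expiD expi_2piX mulr1.
under eq_Rintegral do rewrite E.
have [->|kj] := eqVneq k j.
  under eq_Rintegral do rewrite subrr mul0r expi0 mulr1.
  have mq : mu `[x, x + (2 * pi) *+ q]%classic = ((2 * pi) *+ q)%:E.
    by rewrite lebesgue_measure_itv /= lte_fin ltrDl q2 -EFinB addrAC subrr add0r.
  rewrite Rintegral_cst//; transitivity (complex.Re c * fine ((2 * pi) *+ q)%:E).
    by rewrite -mq.
  by rewrite mulr1 mulrC.
rewrite !mulr0 integral_expi_eq0//.
- by rewrite ltrDl.
- by rewrite subr_eq0 eqr_nat.
- have sym z : expi ((k%:R - j%:R) * z) =
      expi (k%:R * z) * Num.conj (expi (j%:R * z)).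
    by rewrite mulrBl expiD expiJ.
  by rewrite !sym !per.
Qed.

Lemma Rintegral_Re_sum I (r : seq I) (P : pred I) (u : I -> R -> R[i]) (x y : R) :
  (forall i, ccontinuous (u i)) ->
  \int[mu]_(s in `[x, y]) complex.Re (\sum_(i <- r | P i) u i s) =
  \sum_(i <- r | P i) \int[mu]_(s in `[x, y]) complex.Re (u i s).
Proof.
move=> cu; elim: r => [|i r IH].
  rewrite big_nil; under eq_Rintegral do rewrite big_nil.
  by rewrite Rintegral_cst// mul0r.
rewrite big_cons; under eq_Rintegral do rewrite big_cons; case: (P i) => //.
under eq_Rintegral do rewrite cReD.
rewrite RintegralD ?IH//; apply: ccontinuous_integrable => //.
exact: ccontinuous_sum.
Qed.

Lemma integral_nsq_tpoly (a : nat -> R[i]) n (x : R) q : (0 < q)%N ->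
  \int[mu]_(s in `[x, x + (2 * pi) *+ q]) nsq (tpoly a n s) =
  (2 * pi) *+ q * \sum_(k < n) nsq (a k).
Proof.
move=> q0.
transitivity (\int[mu]_(s in `[x, x + (2 * pi) *+ q]) complex.Re
   (\sum_(k < n) \sum_(j < n)
     a k * Num.conj (a j) * (tmon k s * Num.conj (tmon j s)))).
  apply: eq_Rintegral => s _.
  transitivity (complex.Re (nsq (tpoly a n s))%:C) => //.
  rewrite nsqE /tpoly rmorph_sum mulr_suml; congr complex.Re.
  apply: eq_bigr => k _; rewrite mulr_sumr; apply: eq_bigr => j _.
  by rewrite rmorphM /= mulrACA.
have cc k j : ccontinuous (fun s : R =>
    a k * Num.conj (a j) * (tmon k s * Num.conj (tmon j s))).
  apply: ccontinuousM; first exact: ccontinuous_cst.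
  by apply: ccontinuousM; [|apply: ccontinuousJ]; exact: ccontinuous_tmon.
rewrite Rintegral_Re_sum; last by move=> k; apply: ccontinuous_sum => j.
rewrite mulr_sumr; apply: eq_bigr => k _.
rewrite Rintegral_Re_sum//.
under eq_bigr do rewrite integral_tmon//.
rewrite -mulr_sumr (bigD1 k)//= eqxx mulr1 big1 ?addr0; last first.
  by move=> j /negPf jk; rewrite eq_sym -val_eqE /= in jk; rewrite jk mulr0.
by congr (_ * _); rewrite -nsqE.
Qed.

Lemma sdot_tmon k j : sdot (tmon k) (tmon j) = (k == j)%:R :> R[i].
Proof.
have two : `[0, 2 * pi] = `[0, 0 + (2 * pi) *+ 1] :> interval R.
  by rewrite add0r mulr1n.
have twoN0 : 2 * pi != 0 :> R by rewrite gt_eqF// two_pi_gt0.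
rewrite /sdot /circle_int two; apply: complex_eq => /=.
- under eq_Rintegral do rewrite -[X in complex.Re X]mul1r.
  rewrite integral_tmon// mulr1n mulKf// mul1r.
  by case: (k == j).
(* The imaginary part of [w] is the real part of [-i w]. *)
- transitivity ((2 * pi)^-1 * \int[mu]_(s in `[0, 0 + (2 * pi) *+ 1])
     complex.Re ((0 -i* 1) * (tmon k s * Num.conj (tmon j s)))).
    by congr (_ * _); apply: eq_Rintegral => s _; rewrite cReM /=; ring.
  by rewrite integral_tmon//= mul0r !mulr0; case: (k == j).
Qed.

End TrigonometricPolynomials.

(** * Fejer means and their maximal function *)

Section FejerKernel.
Context {R : realType}.
Local Notation mu := (@lebesgue_measure R).
Implicit Types (a : nat -> R[i]).

(** With [u = y / 2], the mean value theorem gives [sin u >= u cos u], so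
    [sin y = 2 sin u cos u >= 2 u cos^2 u], and [2 cos^2 u >= 1] because [cos y >= 0]. *)
Lemma sin_ge_half (y : R) : 0 <= y <= pi / 2 -> y / 2 <= sin y.
Proof.
move=> /andP[]; rewrite le_eqVlt => /predU1P[<- _|y0 ypi].
  by rewrite sin0 mul0r.
have p0 := @pi_gt0 R.
set u := y / 2; have u0 : 0 < u by rewrite divr_gt0.
have uy : y = u *+ 2 by rewrite /u mulr2n -splitr.
have [c] := MVT u0 (fun x _ => is_derive_sin x)
  (continuous_subspaceT (@continuous_sin R)).
rewrite in_itv /= sin0 !subr0 => /andP[c0 cu] sinu.
have ul : u <= pi by lra.
have cosuc : cos u <= cos c.
  by rewrite leNgt ltr_cos ?in_itv/= -?leNgt ?(ltW cu)// ?(ltW u0) ?(ltW c0)//=; lra.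
have cosu : 0 <= cos u by apply: cos_ge0_pihalf; lra.
have cosy : 0 <= cos y by apply: cos_ge0_pihalf; lra.
rewrite uy sin_mulr2n sinu; move: cosy; rewrite uy cos_mulr2n => cosy.
have h1 : u * cos u ^+ 2 <= cos u * (cos c * u).
  have cc : 0 <= cos c - cos u by rewrite subr_ge0.
  by have := mulr_ge0 (mulr_ge0 cosu (ltW u0)) cc; rewrite expr2; lra.
have h2 : u <= (u * cos u ^+ 2) *+ 2.
  have : u * 1 <= u * (cos u ^+ 2 *+ 2) by rewrite ler_wpM2l ?(ltW u0)//; lra.
  by rewrite mulr1 mulrnAr.
by rewrite (le_trans h2)// ler_wMn2r.
Qed.

(** [|1 - exp(i x)|^2 = 4 sin^2 (x / 2)], and [sin_ge_half] applies to [|x| / 2]. *)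
Lemma nsq_1Bexpi_ge (x : R) : `|x| <= pi -> x ^+ 2 / 4 <= nsq (1 - expi x).
Proof.
move=> xpi; rewrite /nsq /=.
have -> : (1 - cos x) ^+ 2 + (0 - sin x) ^+ 2 = 2 - 2 * cos x.
  have := cos2Dsin2 x; rewrite sub0r sqrrN => h.
  have -> : sin x ^+ 2 = 1 - cos x ^+ 2 by rewrite -h addrC addKr.
  by ring.
set y := `|x| / 2.
have y1 : y / 2 <= sin y by apply: sin_ge_half; rewrite divr_ge0//= ler_pM2r.
have y0 : 0 <= y / 2 by rewrite !divr_ge0.
have -> : cos x = 1 - (sin y ^+ 2) *+ 2.
  have -> : cos x = cos (y *+ 2).
    rewrite mulr2n -splitr; case: (ger0P x) => // _; by rewrite cosN.
  by rewrite cos_mulr2n sin2cos2; ring.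
have -> : x ^+ 2 = (y * 2) ^+ 2 by rewrite /y divfK// real_normK ?num_real.
have : (y / 2) ^+ 2 <= sin y ^+ 2 by rewrite ler_sqr ?nnegrE ?(le_trans y0).
rewrite !expr2; lra.
Qed.

(** A one-sided Dirichlet kernel: its squared modulus is [n] times the Fejer kernel at [t - s], so
    negative frequencies enter only through conjugation. *)
Definition dirichlet_kernel (n : nat) (t s : R) : R[i] :=
  \sum_(j < n) tmon j t * Num.conj (tmon j s).

Lemma dirichlet_kernelE n t s :
  dirichlet_kernel n t s = \sum_(j < n) expi (t - s) ^+ j.
Proof.
apply: eq_bigr => j _; rewrite /tmon rmorphXn /= expiJ -exprMn.
by rewrite -expiD.
Qed.

Lemma nsq_sum_le n (w : 'I_n -> R[i]) : (forall i, nsq (w i) = 1) ->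
  nsq (\sum_(i < n) w i) <= n%:R ^+ 2.
Proof.
move=> w1; rewrite -lecR nsqE -sqr_normc.
have -> : (n%:R ^+ 2)%:C = (n%:R : R[i]) ^+ 2 by rewrite rmorphXn /= rmorph_nat.
rewrite ler_sqr ?nnegrE ?normr_ge0 ?ler0n//.
rewrite (le_trans (ler_norm_sum _ _ _))//.
rewrite (eq_bigr (fun=> 1)) ?sumr_const ?card_ord//.
by move=> i _; rewrite normc_nsq w1 sqrtr1.
Qed.

Lemma dirichlet_kernel_le n t s : nsq (dirichlet_kernel n t s) <= n%:R ^+ 2.
Proof.
rewrite dirichlet_kernelE; apply: nsq_sum_le => i.
by rewrite nsqX nsq_expi expr1n.
Qed.

(** The geometric sum times [1 - exp(i (t - s))] is [1 - exp(i n (t - s))], of squared modulus at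
    most 4; dividing by the lower bound [(t - s)^2 / 4] gives 16. *)
Lemma dirichlet_kernel_decay n t s : `|t - s| <= pi ->
  nsq (dirichlet_kernel n t s) * (t - s) ^+ 2 <= 16.
Proof.
move=> ts; have h := nsq_1Bexpi_ge ts.
have : nsq (dirichlet_kernel n t s) * nsq (1 - expi (t - s)) <= 4.
  rewrite -nsqM dirichlet_kernelE mulrC -opprB mulNr -subrX1 nsqN.
  apply: (le_trans (nsqD_le _ _)).
  by rewrite nsqN nsq1 nsqX nsq_expi expr1n; lra.
have := nsq_ge0 (dirichlet_kernel n t s); nra.
Qed.

(* n times the n-th Cesaro mean of [sum_k a_k exp(i k t)]. *)
Definition cesaro_sum a n t : R[i] := \sum_(j < n) tpoly a j.+1 t.

(** When the squared kernel is expanded into frequencies [j] and [l], the integral against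
    [a_k exp(i k s)] survives only for [l + k = j]. Each pair [k <= j < n] thus occurs exactly once,
    as in the Cesaro sum. *)
Lemma fejer_reproduction a n N t : (n <= N)%N ->
  \int[mu]_(s in `[t - pi, t - pi + (2 * pi) *+ 1])
    complex.Re ((nsq (dirichlet_kernel n t s))%:C * tpoly a N s) =
  2 * pi * complex.Re (cesaro_sum a n t).
Proof.
move=> nN.
transitivity (\int[mu]_(s in `[t - pi, t - pi + (2 * pi) *+ 1]) complex.Re
  (\sum_(j < n) \sum_(l < n) \sum_(k < N)
    (tmon j t * Num.conj (tmon l t) * a k) *
      (tmon (l + k) s * Num.conj (tmon j s)))).
  apply: eq_Rintegral => s _; rewrite nsqE {1}/dirichlet_kernel.
  rewrite -mulrA mulr_suml; congr complex.Re; apply: eq_bigr => j _.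
  rewrite /dirichlet_kernel rmorph_sum mulr_suml mulr_sumr.
  apply: eq_bigr => l _; rewrite /tpoly !mulr_sumr; apply: eq_bigr => k _.
  by rewrite rmorphM /= conjCK /tmon exprD; ring.
have cc j l k : ccontinuous (fun s : R =>
    (tmon j t * Num.conj (tmon l t) * a k) *
      (tmon (l + k) s * Num.conj (tmon j s))).
  apply: ccontinuousM; first exact: ccontinuous_cst.
  by apply: ccontinuousM; [|apply: ccontinuousJ]; exact: ccontinuous_tmon.
rewrite Rintegral_Re_sum; last first.
  by move=> j; do 2!apply: ccontinuous_sum => ?; exact: cc.
rewrite /cesaro_sum cRe_sum mulr_sumr; apply: eq_bigr => j _.
rewrite Rintegral_Re_sum; last by move=> l; apply: ccontinuous_sum => k; exact: cc.
transitivity (\sum_(l < n) \sum_(k < N)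
   2 * pi * (complex.Re (a k * tmon k t) * ((l + k)%N == j)%:R)).
  apply: eq_bigr => l _; rewrite Rintegral_Re_sum//.
  apply: eq_bigr => k _; rewrite integral_tmon// mulr1n.
  have [<-|_] := eqVneq (l + k)%N (j : nat); last by rewrite !mulr0.
  rewrite !mulr1; congr (_ * complex.Re _).
  have : (nsq (tmon l t))%:C = 1 :> R[i].
    by rewrite /tmon nsqX nsq_expi expr1n.
  rewrite nsqE => h.
  have -> : tmon (l + k) t = tmon l t * tmon k t by rewrite /tmon exprD.
  transitivity (tmon l t * Num.conj (tmon l t) * (a k * tmon k t)); first by ring.
  by rewrite h mul1r.
rewrite exchange_big /= /tpoly cRe_sum mulr_sumr.
have jN : (j.+1 <= N)%N by rewrite (leq_trans _ nN).
rewrite (big_ord_widen _ (fun k => 2 * pi * complex.Re (a k * tmon k t)) jN).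
rewrite [RHS]big_mkcond /=; apply: eq_bigr => k _.
rewrite ltnS; case: ifPn => [kj|]; last first.
  rewrite -ltnNge => jk; rewrite big1// => l _.
  by rewrite gtn_eqF ?mulr0// (leq_trans jk)// leq_addl.
have lt : (j - k < n)%N by rewrite (leq_ltn_trans (leq_subr _ _)).
rewrite (bigD1 (Ordinal lt))//= subnK// eqxx mulr1 big1 ?addr0// => l ll.
rewrite (_ : ((l + k)%N == j) = false) ?mulr0//; apply/eqP => lkj.
by move/eqP: ll; apply; apply: val_inj; rewrite /= -lkj addnK.
Qed.

End FejerKernel.

Section FejerMaximal.
Context {R : realType}.
Local Notation mu := (@lebesgue_measure R).
Implicit Types (a : nat -> R[i]).

(** A dyadic majorant of the Fejer kernel: [j] is the least index with [|t - s| < 2^j / n]. For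
    [j = 0] the trivial bound [n^2] is enough; otherwise [|t - s| >= 2^(j-1) / n], and the decay
    constant 16 becomes [64 n^2 / 4^j]. *)
Lemma fejer_layers n (t s : R) : (0 < n)%N -> `|t - s| <= pi ->
  exists2 j : 'I_n.+3, `|t - s| < 2 ^+ j / n%:R &
    nsq (dirichlet_kernel n t s) <= 64 * n%:R ^+ 2 / 4 ^+ j.
Proof.
move=> n0 ts; set x := `|t - s|; set K := nsq _.
have n0' : 0 < n%:R :> R by rewrite ltr0n.
have n0'' : n%:R != 0 :> R by rewrite gt_eqF.
(* The index [n + 2] is always admissible, since [|t - s| <= pi < 4] and [n < 2^n]; hence [n + 3]
   layers. *)
have xn : x < 2 ^+ n.+2 / n%:R.
  rewrite ltr_pdivlMr//.
  have p4 : x < 4.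
    rewrite (le_lt_trans ts)//; have /andP[_] := @pihalf_02 R.
    by rewrite ltr_pdivrMr//; lra.
  have n2 : n%:R < 2 ^+ n :> R by rewrite -natrX ltr_nat ltn_expl.
  rewrite !exprS mulrA; apply: (@lt_le_trans _ _ (4 * n%:R)).
    by rewrite ltr_pM2r.
  by move: n2; lra.
have ex : exists j, x < 2 ^+ j / n%:R by exists n.+2.
case: (ex_minnP ex) => j xj jmin.
have jn : (j < n.+3)%N by rewrite ltnS; exact: jmin.
exists (Ordinal jn) => //=.
have Kn : K <= n%:R ^+ 2 := dirichlet_kernel_le n t s.
case: j xj jmin jn => [|j] xj jmin jn.
  rewrite expr0 divr1; have := sqr_ge0 (n%:R : R); lra.
have xj' : 2 ^+ j / n%:R <= x.
  by rewrite leNgt; apply/negP => /jmin; rewrite ltnn.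
have := dirichlet_kernel_decay n ts; rewrite -/K => Kx.
have y0 : 0 < 2 ^+ j / n%:R :> R by rewrite divr_gt0// exprn_gt0.
have K0 : 0 <= K := nsq_ge0 _.
have yx : (2 ^+ j / n%:R) ^+ 2 <= (t - s) ^+ 2.
  by rewrite -[leRHS]real_normK ?num_real// ler_sqr ?nnegrE ?(ltW y0).
have Ky : K * (2 ^+ j / n%:R) ^+ 2 <= 16.
  by rewrite (le_trans _ Kx)// ler_wpM2l.
have e4 : 4 ^+ j.+1 = 4 * (2 ^+ j) ^+ 2 :> R.
  by rewrite exprS -exprM mulnC exprM; congr (_ * _ ^+ _); rewrite expr2; lra.
rewrite ler_pdivlMr ?exprn_gt0// e4.
have -> : K * (4 * (2 ^+ j) ^+ 2) =
    4 * n%:R ^+ 2 * (K * (2 ^+ j / n%:R) ^+ 2).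
  by field.
have -> : 64 * n%:R ^+ 2 = 4 * n%:R ^+ 2 * 16 :> R by ring.
by rewrite ler_wpM2l// mulr_ge0// sqr_ge0.
Qed.

(** The interval [[-pi, 3 pi]] contains [[t - pi, t + pi]] for all [t] in the circle, so cutting off
    outside it makes a polynomial integrable without changing the Fejer integral. *)
Definition long_arc : set (measurableTypeR R) :=
  `[- pi, - pi + (2 * pi) *+ 2]%classic.

Lemma integral_ball_HL (g : R -> R) (t h l : R) : 0 < h ->
  (HL_maximal g t <= l%:E)%E ->
  (\int[mu]_(y in ball t h) `| (g y)%:E | <= (h *+ 2 * l)%:E)%E.
Proof.
move=> h0 Hl.
have : (iavg g (ball t h) <= l%:E)%E.
  apply: le_trans Hl; apply: ereal_sup_ubound; exists h => //=.
  by rewrite in_itv /= h0.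
rewrite /iavg (lebesgue_measure_ball _ (ltW h0)) inver mulrn_eq0/= gt_eqF//.
have h2 : 0 < h *+ 2 by rewrite pmulrn_lgt0.
move=> H; rewrite EFinM -lee_pdivrMl//.
Qed.

(** Layer [j] of the kernel contributes at most [c j * 2 h j * l = 128 n l / 2^j]. The geometric sum
    at most doubles this, to [256 n l], and the factor [2 pi >= 4] on the left leaves 64. *)
Lemma fejer_maximal a n N (t l : R) : (0 < n)%N -> (n <= N)%N -> circle t ->
  0 <= l ->
  (HL_maximal ((fun s => complex.Re (tpoly a N s)) \_ long_arc) t <= l%:E)%E ->
  `|complex.Re (cesaro_sum a n t)| <= 64 * n%:R * l.
Proof.
move=> n0 nN It l0 Hl; set g := _ \_ _ in Hl.
have n0' : 0 < n%:R :> R by rewrite ltr0n.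
have n0'' : n%:R != 0 :> R by rewrite gt_eqF.
pose B : set (measurableTypeR R) := `[t - pi, t - pi + (2 * pi) *+ 1]%classic.
have mB : measurable B by exact: measurable_itv.
have p0 := @pi_gt0 R.
move: It; rewrite /circle /= in_itv /= => /andP[t0 t2].
have gB s : B s -> g s = complex.Re (tpoly a N s).
  rewrite /B /= in_itv /= mulr1n => /andP[s1 s2]; rewrite /g patchE mem_set//.
  by rewrite /long_arc /= in_itv /= mulr2n; apply/andP; split; lra.
pose f s := complex.Re ((nsq (dirichlet_kernel n t s))%:C * tpoly a N s).
have fE s : f s = nsq (dirichlet_kernel n t s) * complex.Re (tpoly a N s).
  by rewrite /f cReM /= mul0r subr0.
have cf : ccontinuous (fun s => (nsq (dirichlet_kernel n t s))%:C * tpoly a N s).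
  apply: ccontinuousM; last exact: ccontinuous_tpoly.
  under eq_fun do rewrite nsqE.
  have cD : ccontinuous (dirichlet_kernel n t).
    apply: ccontinuous_sum => j; apply: ccontinuousM; first exact: ccontinuous_cst.
    by apply: ccontinuousJ; exact: ccontinuous_tmon.
  by apply: ccontinuousM => //; exact: ccontinuousJ.
have intf : mu.-integrable B (EFin \o f) by exact: ccontinuous_integrable.
have mg : measurable_fun (setT : set (measurableTypeR R)) g.
  apply/(measurable_restrictT _ _).1; first exact: measurable_itv.
  apply: measurable_funTS; apply: continuous_measurable_fun.
  by have [] := ccontinuous_tpoly a N.
pose c (j : nat) : R := 64 * n%:R ^+ 2 / 4 ^+ j.
have c0 j : 0 <= c j by rewrite divr_ge0 ?mulr_ge0 ?exprn_ge0.
pose h (j : nat) : R := 2 ^+ j / n%:R.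
have h0 j : 0 < h j by rewrite divr_gt0// exprn_gt0.
pose G j : R -> \bar R := (fun s => `|(g s)%:E|%E) \_ (ball t (h j)).
have G0 j s : (0 <= G j s)%E by rewrite /G patchE; case: ifPn.
have mG j : measurable_fun (setT : set (measurableTypeR R)) (G j).
  apply/(measurable_restrictT _ _).1; first exact: measurable_ball.
  by apply: measurable_funTS; do 2 apply: measurableT_comp => //.
have key : (`|2 * pi * complex.Re (cesaro_sum a n t)|%:E <=
    \sum_(j < n.+3) (c j)%:E * (h j *+ 2 * l)%:E)%E.
  rewrite -(fejer_reproduction a t nN) EFin_normr_Rintegral//.
  apply: (le_trans (le_abse_integral _ mB _)).
    by case/integrableP : intf.
  apply: (@le_trans _ _ (\int[mu]_(s in B) \sum_(j < n.+3) (c j)%:E * G j s)%E).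
    apply: ge0_integral_mono => // s Bs.
    have ts : `|t - s| <= pi.
      move: Bs; rewrite /B /= in_itv /= mulr1n => /andP[s1 s2].
      by rewrite ler_norml; apply/andP; split; lra.
    have [j tsj Kj] := fejer_layers n0 ts.
    rewrite (bigD1 j)//=.
    apply: (@le_trans _ _ ((c j)%:E * G j s)%E); last first.
      rewrite leeDl// sume_ge0// => i _.
      by apply: mule_ge0; rewrite ?lee_fin.
    rewrite -/(f s) fE /G patchE mem_set// gB// normrM EFinM.
    rewrite ger0_norm ?nsq_ge0//.
    by apply: lee_wpmul2r => //; rewrite lee_fin.
  rewrite ge0_integral_sum//; last 2 first.
  - by move=> j; apply: measurable_funeM; exact: measurable_funTS.
  - by move=> j s _; apply: mule_ge0; rewrite ?lee_fin.
  apply: lee_sum => j _.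
  rewrite ge0_integralZl//; [|exact: measurable_funTS|by rewrite lee_fin].
  apply: lee_wpmul2l; first by rewrite lee_fin.
  apply: le_trans (integral_ball_HL (h0 j) Hl).
  rewrite [leRHS]integral_mkcond.
  by apply: ge0_subset_integral => //.
move: key; under eq_bigr do rewrite -EFinM.
rewrite sumEFin lee_fin.
have -> : \sum_(j < n.+3) c j * (h j *+ 2 * l) =
    128 * n%:R * l * \sum_(j < n.+3) 2^-1 ^+ j.
  rewrite mulr_sumr; apply: eq_bigr => j _; rewrite /c /h.
  have -> : 4 ^+ j = 2 ^+ j * 2 ^+ j :> R.
    by rewrite -exprMn; congr (_ ^+ _); lra.
  have e2 : (2 : R) ^+ j != 0 by rewrite expf_neq0.
  by rewrite exprVn mulr2n; field; rewrite e2.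
have geo m : \sum_(j < m) (2^-1 : R) ^+ j <= 2.
  have -> : \sum_(j < m) (2^-1 : R) ^+ j = 2 - 2 * 2^-1 ^+ m.
    elim: m => [|m IH]; first by rewrite big_ord0 expr0; lra.
    by rewrite big_ord_recr /= IH exprS; field.
  by rewrite lerBlDr lerDl mulr_ge0// exprn_ge0// invr_ge0.
rewrite normrM (ger0_norm (ltW (two_pi_gt0))) => key.
have X0 : 0 <= 128 * n%:R * l by rewrite !mulr_ge0.
have key2 : 2 * pi * `|complex.Re (cesaro_sum a n t)| <= 128 * n%:R * l * 2.
  by rewrite (le_trans key)// ler_wpM2l.
have key3 : 4 * `|complex.Re (cesaro_sum a n t)| <=
    2 * pi * `|complex.Re (cesaro_sum a n t)|.
  by apply: ler_wpM2r => //; have := @pi_ge2 R; lra.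
lra.
Qed.

(** The threshold is the bound of [fejer_maximal]: for [n > 0], the maximal function exceeds [l] at
    a bad point. *)
Definition cesaro_bad a (l : R) (n : nat) : set (measurableTypeR R) :=
  circle `&` [set t | 64 * n%:R * l < `|complex.Re (cesaro_sum a n t)|].

Lemma ccontinuous_cesaro_sum a n : ccontinuous (cesaro_sum a n).
Proof. by apply: ccontinuous_sum => j; exact: ccontinuous_tpoly. Qed.

Lemma measurable_cesaro_bad a l n : measurable (cesaro_bad a l n).
Proof.
have mf : measurable_fun circle (fun t => `|complex.Re (cesaro_sum a n t)|%:E).
  apply/measurable_EFinP; apply: measurableT_comp => //; apply: measurable_funTS.
  apply: continuous_measurable_fun.
  by have [] := ccontinuous_cesaro_sum a n.
have := emeasurable_fun_o_infty measurable_circle mf (64 * n%:R * l)%:E.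
by under [X in _ `&` X]eq_set do rewrite lte_fin.
Qed.

(** The Hardy-Littlewood inequality costs [3 / l] times the L^1 norm over two periods. There
    [|p| <= d / 2 + |p|^2 / (2 d)] and Parseval bound that norm by [2 pi d + 2 pi d]. A single
    polynomial of length [N] serves all [n <= N], so the whole union lies in one level set of one
    maximal function. *)
Lemma cesaro_weak_type a N (l d : R) : 0 < l -> 0 < d ->
  \sum_(k < N) nsq (a k) <= d ^+ 2 ->
  (mu (\bigcup_(n in [set n | (0 < n <= N)%N]) cesaro_bad a l n) <=
   (12 * pi * d / l)%:E)%E.
Proof.
move=> l0 d0 ad.
have p0 := @pi_gt0 R.
pose p s := complex.Re (tpoly a N s).
have [cp _] := ccontinuous_tpoly a N.
have mJ : measurable long_arc by exact: measurable_itv.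
have ip : mu.-integrable long_arc (EFin \o p).
  exact: ccontinuous_integrable (ccontinuous_tpoly a N).
have lg : locally_integrable [set: R] (p \_ long_arc).
  exact: integrable_locally_restrict.
apply: (@le_trans _ _ (mu [set t | HL_maximal (p \_ long_arc) t > l%:E]%E)).
  apply: le_measure; rewrite ?inE.
  - by apply: bigcup_measurable => n _; exact: measurable_cesaro_bad.
  - rewrite -[X in measurable X]setTI; apply: emeasurable_fun_o_infty => //.
    exact: measurable_HL_maximal.
  - move=> t [n /andP[n0 nN] [It /= W]]; rewrite ltNge; apply/negP => Hl.
    have := fejer_maximal n0 nN It (ltW l0) Hl.
    by rewrite leNgt W.
apply: (le_trans (maximal_inequality lg l0)).
have -> : (\int[mu]_(y in setT) `|((p \_ long_arc) y)%:E| =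
    \int[mu]_(y in long_arc) `|p y|%:E)%E.
  rewrite [RHS]integral_mkcond; apply: eq_integral => y _.
  by rewrite /= !patchE; case: ifPn => //= _; rewrite normr0.
have -> : (12 * pi * d / l)%:E = ((3 / l)%:E * (4 * pi * d)%:E)%E.
  by rewrite -EFinM; congr EFin; field; rewrite gt_eqF.
apply: lee_wpmul2l; first by rewrite lee_fin divr_ge0// ltW.
have cq : ccontinuous (fun s => (nsq (tpoly a N s))%:C).
  under eq_fun do rewrite nsqE.
  have cD := ccontinuous_tpoly a N.
  by apply: ccontinuousM => //; exact: ccontinuousJ.
have iq : mu.-integrable long_arc (EFin \o (fun s => nsq (tpoly a N s))).
  exact: (ccontinuous_integrable _ _ cq).
pose r s := d / 2 + (2 * d)^-1 * nsq (tpoly a N s).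
have icst : mu.-integrable long_arc (EFin \o (fun=> d / 2)).
  exact: (ccontinuous_integrable _ _ (ccontinuous_cst (d / 2)%:C)).
have ir2 := integrableZl mJ (2 * d)^-1 iq.
have ir : mu.-integrable long_arc (EFin \o r).
  by have := integrableD mJ icst ir2; apply: eq_integrable.
apply: (@le_trans _ _ (\int[mu]_(y in long_arc) (r y)%:E)%E).
  apply: ge0_integral_mono => // y _; rewrite lee_fin /r.
  have h := sqr_Re_le (tpoly a N y); rewrite -/(p y) in h.
  have {}h : `|p y| ^+ 2 <= nsq (tpoly a N y) by rewrite real_normK ?num_real.
  have -> : d / 2 + (2 * d)^-1 * nsq (tpoly a N y) =
     (2 * d)^-1 * (d ^+ 2 + nsq (tpoly a N y)) by field; rewrite gt_eqF.
  rewrite mulrC ler_pdivlMr ?mulr_gt0//.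
  by have := sqr_ge0 (`|p y| - d); rewrite expr2 in h; rewrite !expr2; lra.
have -> : (\int[mu]_(y in long_arc) (r y)%:E =
    (\int[mu]_(y in long_arc) r y)%R%:E)%E.
  rewrite fineK//; exact: integrable_fin_num.
have -> : (\int[mu]_(y in long_arc) r y = \int[mu]_(y in long_arc) (d / 2)
    + \int[mu]_(y in long_arc) ((2 * d)^-1 * nsq (tpoly a N y)))%R.
  by apply: RintegralD => //; apply: eq_integrable ir2.
rewrite lee_fin.
have -> : (\int[mu]_(y in long_arc) ((2 * d)^-1 * nsq (tpoly a N y)) =
    (2 * d)^-1 * ((2 * pi) *+ 2 * \sum_(k < N) nsq (a k)))%R.
  by rewrite RintegralZl//; congr (_ * _); exact: integral_nsq_tpoly.
have mq : mu long_arc = ((2 * pi) *+ 2)%:E.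
  rewrite /long_arc lebesgue_measure_itv /= lte_fin ltrDl.
  by rewrite pmulrn_lgt0 ?two_pi_gt0// -EFinB addrAC subrr add0r.
rewrite Rintegral_cst// -/mu.
have -> : fine (mu long_arc) = (2 * pi) *+ 2 by rewrite mq.
have : (2 * d)^-1 * ((2 * pi) *+ 2 * \sum_(k < N) nsq (a k)) <=
   (2 * d)^-1 * ((2 * pi) *+ 2 * d ^+ 2).
  rewrite ler_wpM2l ?invr_ge0 ?mulr_ge0 ?(ltW d0)// ler_wpM2l//.
  by rewrite pmulrn_lge0 ?(ltW two_pi_gt0).
have -> : (2 * d)^-1 * ((2 * pi) *+ 2 * d ^+ 2) = 2 * pi * d.
  by rewrite mulr2n; field; rewrite gt_eqF.
set X := (2 * d)^-1 * _ => XX.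
have -> : 4 * pi * d = d / 2 * (2 * pi *+ 2) + 2 * pi * d.
  by rewrite [(2 * pi) *+ 2]mulr2n; field.
by rewrite lerD2l.
Qed.

(** The previous bound does not depend on [N], so continuity of the measure along increasing unions
    applies. *)
Lemma cesaro_weak_type_all a (l d : R) : 0 < l -> 0 < d ->
  (forall N, \sum_(k < N) nsq (a k) <= d ^+ 2) ->
  (mu (\bigcup_n cesaro_bad a l n.+1) <= (12 * pi * d / l)%:E)%E.
Proof.
move=> l0 d0 ad.
pose F N := \bigcup_(n in [set n | (0 < n <= N)%N]) cesaro_bad a l n.
have mF N : measurable (F N).
  by apply: bigcup_measurable => n _; exact: measurable_cesaro_bad.
have -> : \bigcup_n cesaro_bad a l n.+1 = \bigcup_N F N.
  apply/seteqP; split => t.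
  - by move=> [n _ h]; exists n.+1 => //; exists n.+1 => //=; rewrite leqnn.
  - by move=> [N _ [n /andP[n0 nN] h]]; exists n.-1 => //; rewrite prednK.
have ndF : nondecreasing_seq F.
  move=> m n mn; apply/subsetPset => t [k /andP[k0 km] h].
  by exists k => //=; rewrite k0 (leq_trans km).
have cF := nondecreasing_cvg_mu (mu := mu) mF
  (bigcup_measurable (fun N _ => mF N)) ndF.
rewrite -(cvg_lim (@ereal_hausdorff R) cF).
apply: lime_le; first exact: cvgP cF.
by apply: nearW => N; exact: cesaro_weak_type.
Qed.

End FejerMaximal.

(** * Abel summation and Fatou's theorem *)

Section AbelSummation.
Context {R : realType}.
Implicit Types (x : nat -> R) (r : R).

(** The closed form behind two facts: the series of [(k + 1) r^k] is bounded by [(1 - r)^(-2)], and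
    the weights [(1 - r)^2 (k + 1) r^k] have total mass at most 1. *)
Lemma sum_arith_geometric r N :
  (1 - r) ^+ 2 * \sum_(k < N) (k.+1)%:R * r ^+ k = 1 - r ^+ N * (1 + N%:R * (1 - r)).
Proof.
elim: N => [|N IH]; first by rewrite big_ord0 mulr0 expr0 mul0r addr0 mul1r subrr.
rewrite big_ord_recr /= mulrDr IH [r ^+ N.+1]exprS -[N.+1%:R]natr1; ring.
Qed.

Lemma cvg_natr_expr r : 0 <= r < 1 -> (fun N : nat => N%:R * r ^+ N) @ \oo --> (0 : R).
Proof.
move=> /andP[r0 r1].
have [->|rN0] := eqVneq r 0.
  rewrite (_ : (fun _ => _) = fun=> 0); first exact: cvg_cst.
  by apply/funext => -[|N]; rewrite ?mul0r// expr0n mulr0.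
have h : (fun N : nat => N.+1%:R * r ^+ N) @ \oo --> (0 : R).
  apply: cvg_series_cvg_0; apply: nondecreasing_is_cvgn.
    by apply: nondecreasing_series => k _ _; rewrite mulr_ge0 ?exprn_ge0.
  exists ((1 - r) ^- 2) => _ [N _ <-].
  rewrite /series /= big_mkord -[leRHS]mulr1 ler_pdivlMl ?exprn_gt0 ?subr_gt0//.
  rewrite sum_arith_geometric lerBlDr lerDl mulr_ge0 ?exprn_ge0//.
  by rewrite addr_ge0// mulr_ge0// subr_ge0 ltW.
apply: (@squeeze_cvgr _ _ _ _ (fun=> 0) (fun N : nat => N.+1%:R * r ^+ N)).
- by apply: nearW => N; rewrite mulr_ge0 ?exprn_ge0//= ler_wpM2r ?exprn_ge0// ler_nat.
- exact: cvg_cst.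
- exact: h.
Qed.

Lemma sum_by_parts (x : nat -> R) r N :
  \sum_(k < N) x k * r ^+ k =
  (1 - r) * \sum_(k < N) (\sum_(j < k.+1) x j) * r ^+ k + (\sum_(j < N) x j) * r ^+ N.
Proof.
elim: N => [|N IH]; first by rewrite !big_ord0 mulr0 mul0r addr0.
rewrite [LHS]big_ord_recr /= IH [X in _ = _ * X + _]big_ord_recr /=.
rewrite !(@big_ord_recr _ _ _ N (fun i : 'I_N.+1 => x i)) /= exprS; ring.
Qed.

(** Frobenius's theorem. Two summations by parts write the Abel sum, up to boundary terms that
    vanish, as an average of the Cesaro means with weights [(1 - r)^2 (k + 1) r^k]. As [r] tends to
    1 these weights leave every finite range of [k]. *)
Lemma abel_of_cesaro x (l : R) (g : R -> R) :
  (fun n : nat => n.+1%:R^-1 * \sum_(j < n.+1) \sum_(k < j.+1) x k) @ \oo --> l ->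
  (forall r, 0 < r < 1 -> (fun N : nat => \sum_(k < N) x k * r ^+ k) @ \oo --> g r) ->
  g @ 1^'- --> l.
Proof.
pose S x N : R := \sum_(k < N) x k.
pose W x N : R := \sum_(j < N) S x j.+1.
(* Subtracting [l] from [x 0] lowers every nonempty partial sum by [l]. *)
wlog -> : x l g / l = 0.
  move=> wl cl gl.
  pose x' k := if k == 0%N then x 0%N - l else x k.
  have x'S k : S x' k.+1 = S x k.+1 - l.
    by rewrite /S !big_ord_recl /= addrAC.
  suff : (fun r => g r - l) @ 1^'- --> 0.
    move=> H; rewrite (_ : g = fun r => l + (g r - l)).
      by rewrite -[X in _ --> X]addr0; apply: cvgD => //; exact: cvg_cst.
    by apply/funext => r; rewrite addrC subrK.
  apply: (wl x' 0) => //.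
  - rewrite (_ : (fun _ => _) = fun n : nat => n.+1%:R^-1 * W x n.+1 - l).
      by rewrite -(subrr l); apply: cvgB => //; exact: cvg_cst.
    apply/funext => n; rewrite -/(W x' n.+1) /W.
    under eq_bigr do rewrite x'S.
    rewrite sumrB sumr_const card_ord mulrBr -[l *+ _]mulr_natr mulrCA mulVf ?mulr1//.
  - move=> r r01; rewrite -cvg_shiftS /=.
    rewrite (_ : (fun _ => _) = fun N : nat => \sum_(k < N.+1) x k * r ^+ k - l).
      apply: cvgB; last exact: cvg_cst.
      by rewrite (cvg_shiftS (fun N : nat => \sum_(k < N) x k * r ^+ k)); exact: gl.
    apply/funext => N; rewrite !big_ord_recl /= expr0 !mulr1 addrAC.
    by congr (_ + _).
move=> cl gl.
pose w n := n.+1%:R^-1 * W x n.+1.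
have Ww n : W x n.+1 = n.+1%:R * w n by rewrite /w mulVKf ?pnatr_eq0.
have /cvg_seq_bounded[C [_ /(_ (C + 1))]] : cvgn w by exact: cvgP cl.
rewrite ltrDl ltr01 => /(_ isT) wC.
have {}wC n : `|w n| <= C + 1 by exact: wC.
have C0 : 0 <= C + 1 := le_trans (normr_ge0 _) (wC 0%N).
have WC N : `|W x N| <= (C + 1) * N%:R.
  case: N => [|N]; first by rewrite /W big_ord0 normr0 mulr0.
  by rewrite Ww normrM ger0_norm// mulrC ler_wpM2r.
have SC N : `|S x N| <= 2 * (C + 1) * N%:R.
  case: N => [|N]; first by rewrite /S big_ord0 normr0 mulr0.
  have -> : S x N.+1 = W x N.+1 - W x N by rewrite /W big_ord_recr /= addrAC subrr add0r.
  rewrite (le_trans (ler_normB _ _))//.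
  have := WC N.+1; have := WC N.
  have : (C + 1) * N%:R <= (C + 1) * N.+1%:R by rewrite ler_wpM2l// ler_nat.
  lra.
apply/cvgrPdist_le => e e0.
have e2 : 0 < e / 2 by rewrite divr_gt0.
have /cvgrPdist_le/(_ _ e2)[n0 _ wn0] := cl.
(* The finitely many terms before [n0], where the means need not be small; the factor [(1 - r)^2]
   will absorb them. *)
pose c := \sum_(k < n0) `|W x k.+1|.
have c0 : 0 <= c by apply: sumr_ge0.
have bound r : 0 < r < 1 -> `|g r| <= (1 - r) ^+ 2 * c + e / 2.
  move=> /andP[r0 r1]; have r1' : 0 <= 1 - r by rewrite subr_ge0 ltW.
  have rk k : 0 <= r ^+ k by rewrite exprn_ge0// ltW.
  (* Room for both boundary terms at [N]: [C + 1] for the one with [W], [2 (C + 1)] for the one with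
     [S]. *)
  pose b N := 3 * (C + 1) * (N%:R * r ^+ N).
  have b0 : b @ \oo --> 0.
    rewrite -[X in _ --> X](mulr0 (3 * (C + 1))); apply: cvgM; first exact: cvg_cst.
    by apply: cvg_natr_expr; rewrite ltW//= r1.
  have gr : (fun N : nat => `|\sum_(k < N) x k * r ^+ k|) @ \oo --> `|g r|.
    by apply: cvg_norm; apply: gl; rewrite r0.
  have cb : (fun N => (1 - r) ^+ 2 * c + e / 2 + b N) @ \oo -->
      ((1 - r) ^+ 2 * c + e / 2).
    by rewrite -[X in _ --> X]addr0; apply: cvgD => //; exact: cvg_cst.
  apply: (ler_cvg_to gr cb); apply: nearW => N.
  rewrite sum_by_parts -/(S x N).
  have -> : \sum_(k < N) (\sum_(j < k.+1) x j) * r ^+ k =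
      (1 - r) * \sum_(k < N) W x k.+1 * r ^+ k + W x N * r ^+ N.
    exact: (sum_by_parts (fun k => S x k.+1)).
  have H1 : (1 - r) ^+ 2 * `|\sum_(k < N) W x k.+1 * r ^+ k| <=
      (1 - r) ^+ 2 * c + e / 2.
    apply: (@le_trans _ _ ((1 - r) ^+ 2 *
        (c + e / 2 * \sum_(k < N) k.+1%:R * r ^+ k))).
      apply: ler_wpM2l; first exact: sqr_ge0.
      apply: (le_trans (ler_norm_sum _ _ _)).
      apply: (@le_trans _ _ (\sum_(k < N)
         ((if (k < n0)%N then `|W x k.+1| else 0) + e / 2 * (k.+1%:R * r ^+ k)))).
        apply: ler_sum => k _; rewrite normrM (ger0_norm (rk k)); case: ifPn => kn0.
          rewrite -[leLHS]addr0 lerD//.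
            by rewrite ler_piMr// exprn_ile1// ltW.
          by rewrite mulr_ge0 ?(ltW e2)// mulr_ge0.
        rewrite add0r mulrA ler_wpM2r// Ww normrM ger0_norm// mulrC ler_wpM2r//.
        by have := wn0 k; rewrite sub0r normrN; apply; rewrite /= leqNgt.
      rewrite big_split /= -mulr_sumr lerD2r.
      rewrite -big_mkcond /=.
      rewrite (big_ord_widen_cond (N + n0)%N (fun k => (k < n0)%N)
        (fun k => `|W x k.+1|) (leq_addr _ _)).
      rewrite /c (big_ord_widen (N + n0)%N (fun k => `|W x k.+1|) (leq_addl _ _)).
      rewrite big_mkcond [leRHS]big_mkcond; apply: ler_sum => k _ /=.
      by case: (k < n0)%N => //=; case: ifP.
    rewrite mulrDr lerD2l mulrCA sum_arith_geometric ler_piMr ?(ltW e2)//.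
    by rewrite lerBlDr lerDl mulr_ge0// addr_ge0// mulr_ge0.
  have H2 : `|(1 - r) * (W x N * r ^+ N)| <= (C + 1) * (N%:R * r ^+ N).
    rewrite !normrM (ger0_norm r1') (ger0_norm (rk N)) mulrA mulrA.
    rewrite ler_wpM2r// (le_trans _ (WC N))// ler_piMl//; lra.
  have H3 : `|S x N * r ^+ N| <= 2 * (C + 1) * (N%:R * r ^+ N).
    by rewrite normrM (ger0_norm (rk N)) mulrA ler_wpM2r.
  rewrite mulrDr mulrA -expr2 (le_trans (ler_normD _ _))//.
  have H4 := ler_normD ((1 - r) ^+ 2 * \sum_(k < N) W x k.+1 * r ^+ k)
     ((1 - r) * (W x N * r ^+ N)).
  have H5 : `|(1 - r) ^+ 2 * \sum_(k < N) W x k.+1 * r ^+ k| =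
     (1 - r) ^+ 2 * `|\sum_(k < N) W x k.+1 * r ^+ k|.
    by rewrite normrM ger0_norm// sqr_ge0.
  rewrite /b; move: H1 H2 H3 H4; rewrite H5; lra.
near=> r; rewrite sub0r normrN.
have r01 : 0 < r < 1.
  by apply/andP; split; near: r; [exact: nbhs_left_gt|exact: nbhs_left_lt].
rewrite (le_trans (bound r r01))//.
suff : (1 - r) * c <= e / 2.
  move=> h; have : (1 - r) ^+ 2 * c <= (1 - r) * c.
    by case/andP: r01 => r0 r1; rewrite ler_wpM2r// expr2 ler_piMr//; lra.
  lra.
have : 1 - r <= e / 2 / (c + 1).
  rewrite lerBlDr -lerBlDl ltW//.
  near: r; apply: nbhs_left_gt.
  by rewrite ltrBlDr ltrDl divr_gt0// ltr_wpDl.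
rewrite ler_pdivlMr ?ltr_wpDl// mulrDr mulr1.
by case/andP: r01 => r0 r1; lra.
Unshelve. all: by end_near. Qed.

End AbelSummation.

(** * Almost everywhere Cesaro convergence for square-summable coefficients *)

Section CesaroConvergence.
Context {R : realType}.
Local Notation mu := (@lebesgue_measure R).
Implicit Types (a : nat -> R[i]).

Definition ell2 a := exists M : R, forall N, \sum_(k < N) nsq (a k) <= M.

Definition head_seq K a (k : nat) : R[i] := if (k < K)%N then a k else 0.
Definition tail_seq K a (k : nat) : R[i] := if (k < K)%N then 0 else a k.

Lemma sum_nsq_tail a K N : \sum_(k < N) nsq (tail_seq K a k) <=
  \sum_(k < K + N) nsq (a k) - \sum_(k < K) nsq (a k).
Proof.
rewrite big_split_ord /= addrAC subrr add0r.
apply: (@le_trans _ _ (\sum_(k < K + N) nsq (tail_seq K a k))).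
  rewrite (big_ord_widen (K + N)%N (fun k => nsq (tail_seq K a k)) (leq_addl _ _)).
  by rewrite big_mkcond; apply: ler_sum => k _; case: ifP => // _; exact: nsq_ge0.
rewrite big_split_ord /= big1 ?add0r => [|k _].
  by apply: ler_sum => k _; rewrite /tail_seq ltnNge leq_addr.
by rewrite /tail_seq ltn_ord nsq0.
Qed.

(** Uniform in [K'], because a cut may also have to lie beyond a prescribed index. *)
Lemma ell2_tail a : ell2 a -> forall e : R, 0 < e ->
  exists K, forall K' N, (K <= K')%N -> \sum_(k < N) nsq (tail_seq K' a k) <= e.
Proof.
move=> [M aM] e e0.
pose s N : R := \sum_(k < N) nsq (a k).
have nds : nondecreasing_seq s.
  apply/nondecreasing_seqP => N; rewrite /s big_ord_recr /= lerDl; exact: nsq_ge0.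
have cs : cvgn s.
  by apply: nondecreasing_is_cvgn => //; exists M => _ [N _ <-]; exact: aM.
have /cvgrPdist_lt/(_ _ e0)[K _ sK] := cs.
exists K => K' N KK'; apply: (le_trans (sum_nsq_tail _ _ _)).
rewrite -/(s _) -/(s _).
have h1 : s (K' + N)%N <= limn s by exact: nondecreasing_cvgn_le.
have := sK K' KK'; rewrite /= ltr_norml => /andP[_]; lra.
Qed.

Lemma tpolyD a b n (t : R) : tpoly (fun k => a k + b k) n t = tpoly a n t + tpoly b n t.
Proof. by rewrite /tpoly -big_split /=; apply: eq_bigr => k _; rewrite mulrDl. Qed.

Lemma tpolyZ (c : R[i]) a n (t : R) : tpoly (fun k => c * a k) n t = c * tpoly a n t.
Proof. by rewrite /tpoly mulr_sumr; apply: eq_bigr => k _; rewrite mulrA. Qed.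

Lemma cesaro_sumD a b n (t : R) :
  cesaro_sum (fun k => a k + b k) n t = cesaro_sum a n t + cesaro_sum b n t.
Proof. by rewrite /cesaro_sum -big_split /=; apply: eq_bigr => j _; rewrite tpolyD. Qed.

Lemma cesaro_sumZ (c : R[i]) a n (t : R) :
  cesaro_sum (fun k => c * a k) n t = c * cesaro_sum a n t.
Proof. by rewrite /cesaro_sum mulr_sumr; apply: eq_bigr => j _; rewrite tpolyZ. Qed.

Lemma head_tailE K a : a = (fun k => head_seq K a k + tail_seq K a k).
Proof.
by apply/funext => k; rewrite /head_seq /tail_seq; case: ifP; rewrite ?addr0 ?add0r.
Qed.

Definition cesaro_mean a n (t : R) : R[i] := (n.+1%:R^-1)%:C * cesaro_sum a n.+1 t.

Lemma Re_cesaro_mean a n t : complex.Re (cesaro_mean a n t) =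
  n.+1%:R^-1 * complex.Re (cesaro_sum a n.+1 t).
Proof. by rewrite /cesaro_mean cReM /= mul0r subr0. Qed.

Lemma cesaro_mean_head K a t :
  (fun n => complex.Re (cesaro_mean (head_seq K a) n t)) @ \oo -->
  complex.Re (tpoly a K t).
Proof.
have u : (fun j => complex.Re (tpoly (head_seq K a) j.+1 t)) @ \oo -->
    complex.Re (tpoly a K t).
  apply: cvg_near_cst; exists K => // j /= Kj; congr complex.Re.
  rewrite [RHS]/tpoly (big_ord_widen j.+1 (fun k => a k * tmon k t) (leqW Kj)).
  rewrite big_mkcond; apply: eq_bigr => k _; rewrite /head_seq.
  by case: ifP; rewrite ?mul0r.
have := cesaro u; apply: cvg_trans; apply: near_eq_cvg; apply: nearW => n.
by rewrite Re_cesaro_mean /arithmetic_mean /series /= big_mkord /cesaro_sum cRe_sum.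
Qed.

(** At scale [q] the sequence is cut so far out that the means of its tail exceed [64 * 2^-q] only
    on a set of measure at most [2^-(q+1)]. These measures are summable, so by Borel-Cantelli almost
    every [t] avoids all late bad sets. There the means are a convergent head plus a tail of size at
    most [64 * 2^-q], hence Cauchy. *)
Lemma Re_cesaro_mean_cvg_ae a : ell2 a ->
  {ae mu, forall t, circle t -> cvgn (fun n => complex.Re (cesaro_mean a n t))}.
Proof.
move=> la; have p0 := @pi_gt0 R.
pose l q : R := 2^-1 ^+ q.
have l0 q : 0 < l q by rewrite exprn_gt0// invr_gt0.
(* Chosen so that the weak-type bound [12 pi d / l] equals [2^-(q+1)]. *)
pose d q : R := l q / (2 ^ q.+1)%:R / (12 * pi).
have d0 q : 0 < d q.
  by rewrite !divr_gt0 ?mulr_gt0// ltr0n expn_gt0.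
have /choice[K Kd] : forall q, exists K, forall N,
    \sum_(k < N) nsq (tail_seq K a k) <= d q ^+ 2.
  move=> q; have [K KP] := ell2_tail la (exprn_gt0 2 (d0 q)).
  by exists K => N; exact: KP.
pose B q := \bigcup_n cesaro_bad (tail_seq (K q) a) (l q) n.+1.
have mB q : measurable (B q).
  by apply: bigcup_measurable => n _; exact: measurable_cesaro_bad.
have muB q : (mu (B q) <= (1 / (2 ^ q.+1)%:R)%:E)%E.
  rewrite (le_trans (cesaro_weak_type_all (l0 q) (d0 q) (Kd q)))// lee_fin.
  have E (p x y : R) : 0 < p -> 0 < x -> 0 < y ->
      12 * p * (x / y / (12 * p)) / x = 1 / y.
    by move=> p0' x0 y0; field; rewrite !gt_eqF.
  by rewrite E// ltr0n expn_gt0.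
have B0 : mu (lim_sup_set B) = 0%E.
  apply: lim_sup_set_cvg0 => //.
  apply: (@le_lt_trans _ _ (\sum_(q <oo) (1 / (2 ^ q.+1)%:R)%:E)%E).
    by apply: lee_nneseries => [q _ _|q _]; [exact: measure_ge0|exact: muB].
  by apply: (le_lt_trans (epsilon_trick0 xpredT ler01)); rewrite ltry.
exists (lim_sup_set B); split => //.
  by apply: bigcap_measurable => // n _; apply: bigcup_measurable.
move=> t /= /not_implyP[It ncv]; apply: contrapT => tB; apply: ncv.
have [q0 q0P] : exists q0, forall q, (q0 <= q)%N -> ~ B q t.
  apply: contrapT => H; apply: tB => q0 _.
  apply: contrapT => H'; apply: H; exists q0 => q qq Bq; apply: H'.
  by exists q.
apply: cauchy_cvg; apply: cauchy_exP => e e0.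
have e2 : 0 < e / 2 by rewrite divr_gt0.
have [q qq lq] : exists2 q, (q0 <= q)%N & 64 * l q <= e / 2.
  have l_0 : l @ \oo --> (0 : R).
    have := @cvg_geometric R 1 2^-1; rewrite ger0_norm ?invr_ge0// invf_lt1// ltr1n.
    by move=> /(_ isT); rewrite /geometric /=; under eq_fun do rewrite mul1r.
  have e64 : 0 < e / 2 / 64 by rewrite divr_gt0.
  have /cvgrPdist_le/(_ _ e64)[n0 _ ln] := l_0.
  exists (maxn q0 n0); first exact: leq_maxl.
  have := ln (maxn q0 n0) (leq_maxr _ _).
  by rewrite sub0r normrN gtr0_norm//; lra.
(* The centre of the Cauchy ball is the limit of the head means; head and tail each take half of
   [e]. *)
exists (complex.Re (tpoly a (K q) t)).
have /cvgrPdist_lt/(_ _ e2)[n0 _ hn] := @cesaro_mean_head (K q) a t.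
exists n0 => // n nn; rewrite /ball /=.
have bad : ~ cesaro_bad (tail_seq (K q) a) (l q) n.+1 t.
  by move=> h; apply: (q0P q qq); exists n.
have {}bad : `|complex.Re (cesaro_sum (tail_seq (K q) a) n.+1 t)| <=
    64 * n.+1%:R * l q.
  by rewrite leNgt; apply/negP => h; apply: bad; split.
have -> : complex.Re (cesaro_mean a n t) =
    complex.Re (cesaro_mean (head_seq (K q) a) n t) +
    n.+1%:R^-1 * complex.Re (cesaro_sum (tail_seq (K q) a) n.+1 t).
  by rewrite {1}(head_tailE (K q) a) !Re_cesaro_mean cesaro_sumD cReD mulrDr.
have h1 := hn n nn; rewrite /= in h1.
have n0' : 0 < n.+1%:R :> R by rewrite ltr0n.
have h2 : `|n.+1%:R^-1 * complex.Re (cesaro_sum (tail_seq (K q) a) n.+1 t)| <= e / 2.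
  rewrite normrM ger0_norm ?invr_ge0// ler_pdivrMl// (le_trans bad)//.
  by rewrite mulrAC mulrC ler_wpM2l.
rewrite opprD addrA (le_lt_trans (ler_normB _ _))// [e]splitr.
exact: ltr_leD.
Qed.

Definition cesaro_cvg a t (l : R[i]) :=
  (fun n => complex.Re (cesaro_mean a n t)) @ \oo --> complex.Re l /\
  (fun n => complex.Im (cesaro_mean a n t)) @ \oo --> complex.Im l.

Lemma ell2Z (c : R[i]) a : ell2 a -> ell2 (fun k => c * a k).
Proof.
move=> [M aM]; exists (nsq c * M) => N.
under eq_bigr do rewrite nsqM; rewrite -mulr_sumr.
by apply: ler_wpM2l => //; exact: nsq_ge0.
Qed.

Lemma ell2D a b : ell2 a -> ell2 b -> ell2 (fun k => a k + b k).
Proof.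
move=> [M aM] [M' bM]; exists (2 * M + 2 * M') => N.
apply: (@le_trans _ _ (\sum_(k < N) (2 * nsq (a k) + 2 * nsq (b k)))).
  by apply: ler_sum => k _; exact: nsqD_le.
rewrite big_split /= -!mulr_sumr; have := aM N; have := bM N; lra.
Qed.

(** The imaginary part is the real part for the sequence [-i a_k]. *)
Lemma cesaro_cvg_ae a : ell2 a ->
  {ae mu, forall t, circle t -> exists l, cesaro_cvg a t l}.
Proof.
move=> la; have h1 := Re_cesaro_mean_cvg_ae la.
have h2 := Re_cesaro_mean_cvg_ae (ell2Z (0 -i* 1) la).
move: h1 h2; apply: filterS2 => t h1 h2 It.
have {}h1 := h1 It; have {}h2 := h2 It.
exists (limn (fun n => complex.Re (cesaro_mean a n t)) +i*
  limn (fun n => complex.Re (cesaro_mean (fun k => (0 -i* 1) * a k) n t))).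
split => //=.
suff -> : (fun n => complex.Im (cesaro_mean a n t)) =
  (fun n => complex.Re (cesaro_mean (fun k => (0 -i* 1) * a k) n t)) by [].
apply/funext => n; rewrite /cesaro_mean cesaro_sumZ.
by rewrite mulrCA [RHS]cReM /=; ring.
Qed.

End CesaroConvergence.

(** * Pointwise limits of weighted trigonometric sums as mean-square limits *)

Section L2Limit.
Context {R : realType}.
Local Notation mu := (@lebesgue_measure R).
Implicit Types (a : nat -> R[i]).

Lemma limn_einf_le (u : (\bar R)^nat) (b : \bar R) :
  (\forall n \near \oo, (u n <= b)%E) -> (limn_einf u <= b)%E.
Proof.
move=> [n0 _ ub]; rewrite limn_einf_lim.
apply: lime_le; first exact: is_cvg_einfs.
apply: nearW => n; apply: le_trans (ub (maxn n0 n) (leq_maxl _ _)).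
by apply: ereal_inf_lbound; exists (maxn n0 n) => //=; exact: leq_maxr.
Qed.

Lemma cvg_sqr (T : Type) (F : set_system T) (FF : Filter F) (f : T -> R) (l : R) :
  f @ F --> l -> (fun x => f x ^+ 2) @ F --> l ^+ 2.
Proof. by move=> fl; under eq_fun do rewrite expr2; rewrite expr2; exact: cvgM. Qed.

Lemma cvg_sum_ord (T : Type) (F : set_system T) (FF : Filter F) n
    (f : 'I_n -> T -> R) (l : 'I_n -> R) :
  (forall k, f k @ F --> l k) ->
  (fun x => \sum_(k < n) f k x) @ F --> \sum_(k < n) l k.
Proof.
elim: n f l => [|n IH] f l fl.
  by rewrite big_ord0; under eq_fun do rewrite big_ord0; exact: cvg_cst.
rewrite big_ord_recl; under eq_fun do rewrite big_ord_recl.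
by apply: cvgD => //; apply: IH => k; exact: fl.
Qed.

(** Restricting to the complement of [N] turns convergence off [N] into convergence everywhere, with
    value 0 on [N]. *)
Lemma measurable_limit_off (N : set (measurableTypeR R)) (g : nat -> R -> R)
    (f : R -> R) : measurable N ->
  (forall n, measurable_fun (circle : set (measurableTypeR R)) (g n)) ->
  (forall t, circle t -> ~ N t -> (fun n => g n t) @ \oo --> f t) ->
  measurable_fun (circle : set (measurableTypeR R)) (f \_ (~` N)).
Proof.
move=> mN mg gf.
apply: (@measurable_fun_cvg _ _ _ _ (fun n => g n \_ (~` N))).
  move=> n; apply/measurable_restrict; first exact: measurableC.
    exact: measurable_circle.
  apply: measurable_funS (mg n); first exact: measurable_circle.
  exact: subIsetl.
move=> t It; rewrite patchE; case: ifPn => [/set_mem Nt|Nt].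
  rewrite (_ : (fun n => _) = fun n => g n t); first exact: gf.
  by apply/funext => n; rewrite patchE mem_set.
rewrite (_ : (fun n => _) = fun=> 0); first exact: cvg_cst.
by apply/funext => n; rewrite patchE (negPf Nt).
Qed.

(** General summation weights let one argument cover Cesaro means, used for boundary values, and
    plain partial sums with all weights 1, used on circles of radius [r < 1]. *)
Definition weighted (c : nat -> nat -> R) a n : nat -> R[i] :=
  fun k => (c n k)%:C * a k.

Section Fixed.
Variables (a : nat -> R[i]) (c : nat -> nat -> R) (u : R -> R[i]).
Hypothesis c01 : forall n k, (k <= n)%N -> 0 <= c n k <= 1.
Hypothesis c1 : forall k, (fun n => c n k) @ \oo --> (1 : R).
Hypothesis a_ell2 : ell2 a.
Let T n := tpoly (weighted c a n) n.+1.
Hypothesis Tu : {ae mu, forall t, circle t ->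
  (fun n => complex.Re (T n t)) @ \oo --> complex.Re (u t) /\
  (fun n => complex.Im (T n t)) @ \oo --> complex.Im (u t)}.

Lemma integral_nsq_weighted M n : (M <= n.+1)%N ->
  (\int[mu]_(t in circle) (nsq (T n t - tpoly a M t))%:E =
   (2 * pi * \sum_(k < n.+1) nsq (((c n k)%:C - (k < M)%N%:R) * a k))%:E)%E.
Proof.
move=> Mn.
have TE t : T n t - tpoly a M t =
    tpoly (fun k => ((c n k)%:C - (k < M)%N%:R) * a k) n.+1 t.
  rewrite /T /tpoly (big_ord_widen n.+1 (fun k => a k * tmon k t) Mn).
  rewrite [X in _ - X]big_mkcond /= -sumrB; apply: eq_bigr => k _.
  rewrite /weighted !mulrBl; congr (_ - _).
  by case: (k < M)%N; rewrite ?mul1r ?mul0r.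
under eq_integral do rewrite TE.
set q := tpoly _ _; have cq : ccontinuous q by exact: ccontinuous_tpoly.
have cq2 : ccontinuous (fun s => (nsq (q s))%:C).
  by under eq_fun do rewrite nsqE; apply: ccontinuousM => //; exact: ccontinuousJ.
have iq : mu.-integrable circle (EFin \o (fun s => nsq (q s))).
  exact: (ccontinuous_integrable _ _ cq2).
have -> : (\int[mu]_(t in circle) (nsq (q t))%:E =
    (\int[mu]_(t in circle) nsq (q t))%R%:E)%E.
  by rewrite fineK//; apply: integrable_fin_num => //; exact: measurable_circle.
congr EFin; rewrite /circle.
have -> : `[0, 2 * pi] = `[0, 0 + (2 * pi) *+ 1] :> interval R.
  by rewrite add0r mulr1n.
by rewrite integral_nsq_tpoly// mulr1n.
Qed.

Lemma L2_limit_rep : exists2 v, measurable_fun (circle : set (measurableTypeR R))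
    (fun t => complex.Re (v t)) /\
  measurable_fun (circle : set (measurableTypeR R)) (fun t => complex.Im (v t)) &
  ae_circle u v.
Proof.
have [N [mN N0 subN]] := Tu.
have TN t : circle t -> ~ N t ->
  (fun n => complex.Re (T n t)) @ \oo --> complex.Re (u t) /\
  (fun n => complex.Im (T n t)) @ \oo --> complex.Im (u t).
  move=> It Nt; apply: contrapT => h; apply: Nt; apply: subN => /= h'.
  by apply: h; exact: h'.
have mT n : measurable_fun (circle : set (measurableTypeR R))
      (fun t => complex.Re (T n t)) /\
    measurable_fun (circle : set (measurableTypeR R)) (fun t => complex.Im (T n t)).
  by split; apply: measurable_funTS; apply: continuous_measurable_fun;
    have [] := ccontinuous_tpoly (weighted c a n) n.+1.
exists (fun t => ((fun s => complex.Re (u s)) \_ (~` N)) t +i*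
   ((fun s => complex.Im (u s)) \_ (~` N)) t).
  by split => /=; [apply: (measurable_limit_off mN (fun n => (mT n).1))|
    apply: (measurable_limit_off mN (fun n => (mT n).2))] => t It Nt;
    have [] := TN t It Nt.
exists N; split => // t /= /not_implyP[It uN]; apply: contrapT => Nt; apply: uN.
by rewrite !patchE (mem_set (Nt : (~` N) t)); case: (u t).
Qed.

(** Fatou's lemma for the squares [|T_n - S_M|^2]. By Parseval their integrals are [2 pi] times the
    sum of [(1 - c n k)^2 |a_k|^2] over [k < M], which tends to 0, plus a sum over [k >= M] that is
    at most [B] because the weights lie in [[0, 1]]. *)
Lemma integral_nsq_L2_limit M (B : R) v :
  (forall N, \sum_(k < N) nsq (tail_seq M a k) <= B) ->
  measurable_fun (circle : set (measurableTypeR R)) (fun t => complex.Re (v t)) ->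
  measurable_fun (circle : set (measurableTypeR R)) (fun t => complex.Im (v t)) ->
  ae_circle u v ->
  (\int[mu]_(t in circle) (nsq (v t - tpoly a M t))%:E <= (2 * pi * B)%:E)%E.
Proof.
move=> aB mr mi uv.
have mC := @measurable_circle R.
have mf (w : R -> R[i]) :
    measurable_fun (circle : set (measurableTypeR R)) (fun t => complex.Re (w t)) ->
    measurable_fun (circle : set (measurableTypeR R)) (fun t => complex.Im (w t)) ->
    measurable_fun (circle : set (measurableTypeR R))
      (fun t => (nsq (w t - tpoly a M t))%:E).
  move=> mrw miw; apply/measurable_EFinP.
  have [cr ci] := ccontinuous_tpoly a M.
  apply: measurable_funD; apply: measurable_funX.
    under eq_fun do rewrite cReD cReN; apply: measurable_funB => //.
    by apply: measurable_funTS; exact: continuous_measurable_fun.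
  under eq_fun do rewrite cImD cImN; apply: measurable_funB => //.
  by apply: measurable_funTS; exact: continuous_measurable_fun.
have mT n : measurable_fun (circle : set (measurableTypeR R))
    (fun t => (nsq (T n t - tpoly a M t))%:E).
  by apply: mf; apply: measurable_funTS; apply: continuous_measurable_fun;
    have [] := ccontinuous_tpoly (weighted c a n) n.+1.
have lim_ae : {ae mu, forall t, circle t ->
    limn_einf (fun n => (nsq (T n t - tpoly a M t))%:E) =
    (nsq (v t - tpoly a M t))%:E}.
  move: Tu uv; apply: filterS2 => t h1 h2 It.
  have [hr hi] := h1 It; rewrite -(h2 It).
  apply: (cvg_limn_einf_sup _).1; apply: cvg_EFin; first exact: nearW.
  have -> : fine \o (fun n => (nsq (T n t - tpoly a M t))%:E) =
    fun n => (complex.Re (T n t) - complex.Re (tpoly a M t)) ^+ 2 +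
             (complex.Im (T n t) - complex.Im (tpoly a M t)) ^+ 2.
    by apply/funext => n /=; rewrite /nsq cReD cImD cReN cImN.
  rewrite /nsq cReD cImD cReN cImN.
  by apply: cvgD; apply: cvg_sqr; apply: cvgB => //; exact: cvg_cst.
rewrite -(ge0_integral_ae mC (mf v mr mi) _ _ lim_ae); first last.
- by move=> t _; rewrite lee_fin nsq_ge0.
- move=> t _; rewrite limn_einf_lim; apply: lime_ge; first exact: is_cvg_einfs.
  apply: nearW => n; apply: le_ereal_inf_tmp => _ [m _ <-].
  by rewrite lee_fin nsq_ge0.
have f0 n (t : R) : circle t -> (0 <= (nsq (T n t - tpoly a M t))%:E)%E.
  by move=> _; rewrite lee_fin nsq_ge0.
apply: (le_trans (fatou mu mC mT f0)).
apply/lee_addgt0Pr => e e0; rewrite -EFinD; apply: limn_einf_le.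
have B1 : (fun n => 2 * pi * (\sum_(k < M) (1 - c n k) ^+ 2 * nsq (a k) + B))
    @ \oo --> 2 * pi * B.
  have h : (fun n => \sum_(k < M) (1 - c n k) ^+ 2 * nsq (a k)) @ \oo -->
      \sum_(k < M) (1 - 1) ^+ 2 * nsq (a k).
    apply: (@cvg_sum_ord _ _ _ _
      (fun (k : 'I_M) n => (1 - c n k) ^+ 2 * nsq (a k))) => k.
    apply: cvgM; last exact: cvg_cst.
    by apply: cvg_sqr; apply: cvgB; [exact: cvg_cst|exact: c1].
  rewrite big1 in h; last by move=> k _; rewrite subrr expr0n mul0r.
  rewrite -[X in _ --> 2 * pi * X]add0r; apply: cvgM; first exact: cvg_cst.
  by apply: cvgD => //; exact: cvg_cst.
have /cvgrPdist_le/(_ _ e0)[n0 _ Bn] := B1.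
exists (maxn n0 M) => // n /=; rewrite geq_max => /andP[n0n Mn].
rewrite integral_nsq_weighted ?(leq_trans Mn)// lee_fin.
have := Bn n n0n; rewrite /= ler_norml => /andP[+ _].
rewrite lerBrDr addrC lerBlDr; apply: le_trans.
rewrite ler_pM2l ?two_pi_gt0//.
apply: (@le_trans _ _ (\sum_(k < n.+1) ((if (k < M)%N then
    (1 - c n k) ^+ 2 * nsq (a k) else 0) + nsq (tail_seq M a k)))).
  apply: ler_sum => k _; rewrite nsqM /tail_seq; case: (k < M)%N.
    rewrite nsq0 addr0 -nsqN opprB.
    by rewrite -[1%:R]/(1%:C) -rmorphB /= nsq_real.
  rewrite subr0 nsq_real add0r ler_piMl ?nsq_ge0//.
  have /andP[ck0 ck1] := c01 (leq_ord k).
  by rewrite expr_le1.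
rewrite big_split /= lerD ?aB//.
rewrite (big_ord_widen n.+1 (fun k => (1 - c n k) ^+ 2 * nsq (a k)) (leqW Mn)).
by rewrite [leRHS]big_mkcond.
Qed.

Lemma L2_limit : L2circle u.
Proof.
have [v [mr mi] uv] := L2_limit_rep.
exists v => //.
have mC := @measurable_circle R.
have [B aB] := a_ell2.
have h : (\int[mu]_(t in circle) (nsq (v t))%:E <= (2 * pi * B)%:E)%E.
  have := @integral_nsq_L2_limit 0%N B v aB mr mi uv.
  by under eq_integral do rewrite /tpoly big_ord0 subr0.
split; split => //.
- apply/integrableP; split.
    by apply/measurable_EFinP; exact: measurable_funX.
  apply: le_lt_trans (ltry (2 * pi * B)); apply: le_trans h.
  apply: ge0_integral_mono => // t _ /=.
  by rewrite lee_fin ger0_norm ?sqr_ge0// sqr_Re_le.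
- apply/integrableP; split.
    by apply/measurable_EFinP; exact: measurable_funX.
  apply: le_lt_trans (ltry (2 * pi * B)); apply: le_trans h.
  apply: ge0_integral_mono => // t _ /=.
  by rewrite lee_fin ger0_norm ?sqr_ge0// sqr_Im_le.
Qed.

Lemma sdot_L2_limit M (B : R) :
  (forall N, \sum_(k < N) nsq (tail_seq M a k) <= B) ->
  complex.Re (sdot (fun t => u t - tpoly a M t) (fun t => u t - tpoly a M t)) <= B.
Proof.
move=> aB; have [v [mr mi] uv] := L2_limit_rep.
have mC := @measurable_circle R.
have := integral_nsq_L2_limit aB mr mi uv.
rewrite /sdot /circle_int -/circle /= => h.
rewrite ler_pdivrMl ?two_pi_gt0//.
have -> : \int[mu]_(t in circle) complex.Re
    ((u t - tpoly a M t) * Num.conj (u t - tpoly a M t)) =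
    \int[mu]_(t in circle) nsq (v t - tpoly a M t).
  apply: Rintegral_ae => //.
    have [cr ci] := ccontinuous_tpoly a M.
    apply: measurable_funD; apply: measurable_funX.
      under eq_fun do rewrite cReD cReN; apply: measurable_funB => //.
      by apply: measurable_funTS; exact: continuous_measurable_fun.
    under eq_fun do rewrite cImD cImN; apply: measurable_funB => //.
    by apply: measurable_funTS; exact: continuous_measurable_fun.
  by move: uv; apply: filterS => t uv It; rewrite uv// -nsqE.
rewrite -lee_fin fineK// ge0_fin_numE; first exact: le_lt_trans h (ltry _).
by apply: integral_ge0 => t _; rewrite lee_fin nsq_ge0.
Qed.

End Fixed.
End L2Limit.

Section L2Approximation.
Context {R : realType}.
Local Notation mu := (@lebesgue_measure R).
Implicit Types (a b : nat -> R[i]) (u v w : R -> R[i]).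

Lemma L2circleB u v : L2circle u -> L2circle v -> L2circle (fun t => u t - v t).
Proof.
move=> Lu Lv; have := L2circle_linear (-1) Lv Lu.
by congr L2circle; apply/funext => t; rewrite mulN1r addrC.
Qed.

(* [u] is the boundary function whose Fourier series is [sum_(k >= 0) a_k e_k]. *)
Definition L2approx a u := L2circle u /\
  forall M (B : R), (forall N, \sum_(k < N) nsq (tail_seq M a k) <= B) ->
  complex.Re (sdot (fun t => u t - tpoly a M t) (fun t => u t - tpoly a M t)) <= B.

Lemma sdot_cauchy_schwarz u v : L2circle u -> L2circle v ->
  nsq (sdot u v) <= complex.Re (sdot u u) * complex.Re (sdot v v).
Proof. by move=> Lu Lv; exact: (sip_cauchy_schwarz sdot_sip). Qed.

Lemma sdot_self_ge0 u : L2circle u -> 0 <= complex.Re (sdot u u).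
Proof. by move=> Lu; exact: (sip_ge0 sdot_sip). Qed.

Lemma sdotBl u v w : L2circle u -> L2circle v -> L2circle w ->
  sdot (fun t => u t - v t) w = sdot u w - sdot v w.
Proof. by move=> Lu Lv Lw; exact: (sipBl sdot_sip). Qed.

Lemma sdotBr u v w : L2circle u -> L2circle v -> L2circle w ->
  sdot w (fun t => u t - v t) = sdot w u - sdot w v.
Proof. by move=> Lu Lv Lw; exact: (sipBr sdot_sip). Qed.

Lemma sdot_conj u v : L2circle u -> L2circle v -> sdot v u = Num.conj (sdot u v).
Proof. by move=> Lu Lv; exact: (sipC sdot_sip). Qed.

Lemma tmon_L2 k : L2circle (tmon k : R -> R[i]).
Proof. exact/ccontinuous_L2circle/ccontinuous_tmon. Qed.

Lemma tpoly_L2 a n : L2circle (tpoly a n).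
Proof. exact/ccontinuous_L2circle/ccontinuous_tpoly. Qed.

Lemma tpoly_sumE a n :
  tpoly a n = \sum_(k < n) a k *: (tmon k : R -> R[i]^o) :> (R -> R[i]^o).
Proof. by apply/funext => t; rewrite fct_sumE. Qed.

Lemma sdot_tpolyl a n u : L2circle u ->
  sdot (tpoly a n) u = \sum_(k < n) a k * sdot (tmon k) u.
Proof.
move=> Lu; rewrite tpoly_sumE.
by apply: (sip_suml sdot_sip (fun k : 'I_n => a k) _ Lu) => k; exact: tmon_L2.
Qed.

Lemma sdot_tpolyr a n u : L2circle u ->
  sdot u (tpoly a n) = \sum_(k < n) Num.conj (a k) * sdot u (tmon k).
Proof.
move=> Lu; rewrite tpoly_sumE.
by apply: (sip_sumr sdot_sip (fun k : 'I_n => a k) _ Lu) => k; exact: tmon_L2.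
Qed.

Lemma sdot_tpoly_tmon a n k :
  sdot (tpoly a n) (tmon k) = if (k < n)%N then a k else 0.
Proof.
rewrite sdot_tpolyl; last exact: tmon_L2.
case: ifPn => kn.
  rewrite (bigD1 (Ordinal kn))//= sdot_tmon eqxx mulr1 big1 ?addr0// => j jk.
  rewrite sdot_tmon (_ : (_ == _) = false) ?mulr0//; apply/negbTE.
  by apply: contra jk => /eqP jk; apply/eqP/val_inj.
rewrite big1// => j _; rewrite sdot_tmon (_ : (_ == _) = false) ?mulr0//.
by apply/negbTE; apply: contra kn => /eqP <-.
Qed.

(** Once [M > k], [<u - S_M, e_k> = <u, e_k> - a_k], and Cauchy-Schwarz bounds this by an
    arbitrarily small tail. *)
Lemma L2approx_coef a u k : ell2 a -> L2approx a u -> sdot u (tmon k) = a k.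
Proof.
move=> la [Lu ua]; apply/eqP; rewrite -subr_eq0; apply/eqP/nsq_eq0.
apply/eqP; rewrite eq_le nsq_ge0 andbT; apply/ler_addgt0Pl => e e0; rewrite addr0.
have [K KP] := ell2_tail la e0.
pose M := maxn K k.+1.
have h := ua M e (fun N => KP M N (leq_maxl _ _)).
have Lw := L2circleB Lu (tpoly_L2 a M).
have := sdot_cauchy_schwarz Lw (tmon_L2 k).
rewrite sdotBl//; [|exact: tpoly_L2|exact: tmon_L2].
rewrite sdot_tpoly_tmon leq_maxr sdot_tmon eqxx /= mulr1 => hh.
exact: le_trans hh h.
Qed.

Lemma L2approx_norm a u (B : R) : L2approx a u ->
  (forall N, \sum_(k < N) nsq (a k) <= B) -> complex.Re (sdot u u) <= B.
Proof.
move=> [Lu ua] aB; have := ua 0%N B aB.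
suff -> : (fun t => u t - tpoly a 0 t) = u by [].
by apply/funext => t; rewrite /tpoly big_ord0 subr0.
Qed.

(** The function [w] is orthogonal to every partial sum of [v], so [<w, v> = <w, v - S_K>], which is
    small by Cauchy-Schwarz. *)
Lemma sdot_L2approx0 b v w : ell2 b -> L2approx b v -> L2circle w ->
  (forall k, sdot w (tmon k) = 0) -> sdot w v = 0.
Proof.
move=> lb [Lv vb] Lw w0; apply: nsq_eq0.
apply/eqP; rewrite eq_le nsq_ge0 andbT.
(* Adding 1 keeps the divisor positive when [w] has norm 0. *)
pose W := complex.Re (sdot w w) + 1.
have W0 : 0 < W by rewrite ltr_wpDl// sdot_self_ge0.
apply/ler_addgt0Pl => e e0; rewrite addr0.
have [K KP] := ell2_tail lb (divr_gt0 e0 W0).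
have h := vb K _ (fun N => KP K N (leqnn _)).
have Ld := L2circleB Lv (tpoly_L2 b K).
have := sdot_cauchy_schwarz Lw Ld.
rewrite sdotBr//; last exact: tpoly_L2.
rewrite sdot_tpolyr// [X in _ - X]big1 ?subr0 => [|k _]; last by rewrite w0 mulr0.
move=> hh; apply: (le_trans hh).
rewrite -[leRHS](@divfK _ W) ?gt_eqF// mulrC; apply: ler_pM => //.
- exact: sdot_self_ge0.
- exact: sdot_self_ge0.
- by rewrite lerDl.
Qed.

Lemma bessel u N : L2circle u ->
  \sum_(k < N) nsq (sdot u (tmon k)) <= complex.Re (sdot u u).
Proof.
move=> Lu; pose p := tpoly (fun k => sdot u (tmon k)) N.
have Lp : L2circle p := tpoly_L2 _ _.
have Lup := L2circleB Lu Lp.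
have pk (k : 'I_N) : sdot (fun t => u t - p t) (tmon k) = 0.
  rewrite sdotBl//; last exact: tmon_L2.
  by rewrite sdot_tpoly_tmon ltn_ord subrr.
have up0 : sdot (fun t => u t - p t) p = 0.
  by rewrite sdot_tpolyr// big1// => k _; rewrite pk mulr0.
have := sdot_self_ge0 Lup; rewrite sdotBr// up0 subr0 sdotBl//.
rewrite [sdot p u]sdot_tpolyl// cReD cReN subr_ge0; congr (_ <= _).
rewrite cRe_sum; apply: eq_bigr => k _.
by rewrite (sdot_conj Lu (tmon_L2 k)) -nsqE.
Qed.

Lemma Re_sdot_self u : complex.Re (sdot u u) =
  (2 * pi)^-1 * \int[mu]_(t in circle) nsq (u t).
Proof. by rewrite /sdot /circle_int /= -/circle; congr (_ * _); apply: eq_Rintegral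
  => t _; rewrite -nsqE. Qed.

Lemma L2circle_integral_fin u : L2circle u ->
  (\int[mu]_(t in circle) (nsq (u t))%:E)%E \is a fin_num.
Proof.
move=> [v [[mr r2] [mi i2]] uv]; have mC := @measurable_circle R.
have -> : (\int[mu]_(t in circle) (nsq (u t))%:E =
    \int[mu]_(t in circle) (nsq (v t))%:E)%E.
  apply: ge0_integral_ae => //.
  - by apply/measurable_EFinP; apply: measurable_funD; exact: measurable_funX.
  - by move=> t _; rewrite lee_fin nsq_ge0.
  - by move=> t _; rewrite lee_fin nsq_ge0.
  - by move: uv; apply: filterS => t h It; rewrite h.
apply: integrable_fin_num => //.
by have := integrableD mC r2 i2; apply: eq_integrable.
Qed.

(** The integrals are compared as extended reals first: [fine] respects the order only between
    finite values, and finiteness comes from [v]. *)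
Lemma Re_sdot_mono u v (M : R) : L2circle v -> 0 <= M ->
  (forall t, nsq (u t) <= M * nsq (v t)) ->
  complex.Re (sdot u u) <= M * complex.Re (sdot v v).
Proof.
move=> Lv M0 uv; rewrite !Re_sdot_self mulrCA.
apply: ler_wpM2l; first by rewrite invr_ge0 ltW// two_pi_gt0.
have mC := @measurable_circle R.
have vfin := L2circle_integral_fin Lv; have [v' [[mr r2] [mi i2]] vv'] := Lv.
have vE : (\int[mu]_(t in circle) (nsq (v t))%:E =
    \int[mu]_(t in circle) (nsq (v' t))%:E)%E.
  apply: ge0_integral_ae => //.
  - by apply/measurable_EFinP; apply: measurable_funD; exact: measurable_funX.
  - by move=> t _; rewrite lee_fin nsq_ge0.
  - by move=> t _; rewrite lee_fin nsq_ge0.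
  - by move: vv'; apply: filterS => t h It; rewrite h.
have le1 : (\int[mu]_(t in circle) (nsq (u t))%:E <=
    M%:E * \int[mu]_(t in circle) (nsq (v t))%:E)%E.
  have mv' : measurable_fun (circle : set (measurableTypeR R))
      (fun t => (nsq (v' t))%:E).
    by apply/measurable_EFinP; apply: measurable_funD; exact: measurable_funX.
  rewrite vE -ge0_integralZl//; [|by move=> t _; rewrite lee_fin nsq_ge0].
  rewrite -(ge0_integral_ae mC (f := fun t => (M * nsq (v t))%:E)).
  - apply: ge0_integral_mono => t _; first by rewrite lee_fin nsq_ge0.
    by rewrite lee_fin.
  - exact: measurable_funeM.
  - by move=> t _; rewrite lee_fin mulr_ge0// nsq_ge0.
  - by move=> t _; rewrite -EFinM lee_fin mulr_ge0// nsq_ge0.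
  - by move: vv'; apply: filterS => t h It; rewrite h.
rewrite /Rintegral -[leRHS]/(fine M%:E * _) -fineM//.
apply: fine_le => //; last by rewrite fin_numM.
rewrite ge0_fin_numE; last by apply: integral_ge0 => t _; rewrite lee_fin nsq_ge0.
apply: le_lt_trans le1 _; rewrite -(fineK vfin) -EFinM; exact: ltry.
Qed.

End L2Approximation.

(** * Hardy spaces *)

Section CauchyProduct.
Context {R : realType}.
Implicit Types (a b : nat -> R[i]) (z w : R[i]).

Definition cabs z : R := Num.sqrt (nsq z).

Lemma cabs_ge0 z : 0 <= cabs z.
Proof. exact: sqrtr_ge0. Qed.

Lemma normc_cabs z : `|z| = (cabs z)%:C.
Proof. exact: normc_nsq. Qed.

Lemma cabsM z w : cabs (z * w) = cabs z * cabs w.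
Proof. by rewrite /cabs nsqM sqrtrM// nsq_ge0. Qed.

Lemma cabsX z n : cabs (z ^+ n) = cabs z ^+ n.
Proof.
elim: n => [|n IH]; first by rewrite !expr0 /cabs nsq1 sqrtr1.
by rewrite !exprS cabsM IH.
Qed.

Lemma sqr_cabs z : cabs z ^+ 2 = nsq z.
Proof. by rewrite sqr_sqrtr// nsq_ge0. Qed.

Lemma cabs_sum (I : Type) (r : seq I) (P : pred I) (F : I -> R[i]) :
  cabs (\sum_(i <- r | P i) F i) <= \sum_(i <- r | P i) cabs (F i).
Proof.
rewrite -lecR rmorph_sum -normc_cabs (le_trans (ler_norm_sum _ _ _))//.
by apply: ler_sum => i _; rewrite normc_cabs.
Qed.

Lemma abs_Re_le z : `|complex.Re z| <= cabs z.
Proof. by rewrite -sqrtr_sqr ler_sqrt ?nsq_ge0// sqr_Re_le. Qed.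

Lemma abs_Im_le z : `|complex.Im z| <= cabs z.
Proof. by rewrite -sqrtr_sqr ler_sqrt ?nsq_ge0// sqr_Im_le. Qed.

Definition ccvg (T : Type) (F : set_system T) (u : T -> R[i]) (l : R[i]) :=
  (fun x => (u x : R[i]^o)) @ F --> (l : R[i]^o).

Lemma ccvgM (T : Type) (F : set_system T) {FF : Filter F} (u v : T -> R[i]) l m :
  ccvg F u l -> ccvg F v m -> ccvg F (fun x => u x * v x) (l * m).
Proof.
move=> /cvg_complexP[ur ui] /cvg_complexP[vr vi]; apply/cvg_complexP; split.
- under eq_fun do rewrite cReM; rewrite cReM.
  by apply: cvgB; exact: cvgM.
- under eq_fun do rewrite cImM; rewrite cImM.
  by apply: cvgD; exact: cvgM.
Qed.

Lemma ccvgD (T : Type) (F : set_system T) {FF : Filter F} (u v : T -> R[i]) l m :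
  ccvg F u l -> ccvg F v m -> ccvg F (fun x => u x + v x) (l + m).
Proof.
move=> /cvg_complexP[ur ui] /cvg_complexP[vr vi]; apply/cvg_complexP; split.
- by under eq_fun do rewrite cReD; rewrite cReD; exact: cvgD.
- by under eq_fun do rewrite cImD; rewrite cImD; exact: cvgD.
Qed.

Lemma ccvg_cst (T : Type) (F : set_system T) {FF : Filter F} (l : R[i]) :
  ccvg F (fun=> l) l.
Proof. by apply/cvg_complexP; split; exact: cvg_cst. Qed.

Lemma ccvg_unique (T : Type) (F : set_system T) {FF : ProperFilter F}
    (u : T -> R[i]) l m : ccvg F u l -> ccvg F u m -> l = m.
Proof.
move=> /cvg_complexP[ur ui] /cvg_complexP[vr vi].
by apply: complex_eq; [apply: cvg_unique ur vr|apply: cvg_unique ui vi].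
Qed.

Lemma ccvg_lim (T : Type) (F : set_system T) {FF : ProperFilter F}
    (u : T -> R[i]) (l : R[i]) :
  ccvg F u l -> lim ((fun x => (u x : R[i]^o)) @ F) = (l : R[i]^o).
Proof. by move=> ul; apply: cvg_lim => //; exact: norm_hausdorff. Qed.

Lemma ccvg0_cabs (u : nat -> R[i]) (v : nat -> R) :
  (forall n, cabs (u n) <= v n) -> v @ \oo --> (0 : R) -> ccvg \oo u 0.
Proof.
move=> uv v0; apply/cvg_complexP; split => /=.
- apply/cvgr0Pnorm_le => e e0; have /cvgr0Pnorm_le/(_ _ e0) := v0.
  apply: filterS => n; apply: le_trans; apply: (le_trans (abs_Re_le _)).
  by rewrite (le_trans (uv n))// ler_norm.
- apply/cvgr0Pnorm_le => e e0; have /cvgr0Pnorm_le/(_ _ e0) := v0.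
  apply: filterS => n; apply: le_trans; apply: (le_trans (abs_Im_le _)).
  by rewrite (le_trans (uv n))// ler_norm.
Qed.

Definition conv_seq a b n : R[i] := \sum_(i < n.+1) a i * b (n - i)%N.

(** Both sides run over the pairs with [i + j < N]. The inner range on the right stays [N], cut by a
    condition, so that the rest of the square can be split off. *)
Lemma triangle_sum (F : nat -> nat -> R[i]) N :
  \sum_(n < N) \sum_(i < n.+1) F i (n - i)%N =
  \sum_(i < N) \sum_(j < N | (j < N - i)%N) F i j.
Proof.
have E M (i : 'I_M) :
    \sum_(j < M | (j < M - i)%N) F i j = \sum_(j < M - i) F i j.
  by rewrite (big_ord_widen M (fun j => F i j) (leq_subr _ _)).
under [RHS]eq_bigr do rewrite E.
elim: N {E} => [|N IH]; first by rewrite !big_ord0.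
rewrite big_ord_recr /= IH [in RHS]big_ord_recr /= subSnn big_ord1.
rewrite [\sum_(i < N.+1) _]big_ord_recr /= subnn addrA; congr (_ + _).
rewrite -big_split /=; apply: eq_bigr => i _.
by rewrite subSn ?big_ord_recr// ltnW.
Qed.

(** The product of the partial sums differs from the Cauchy sum by the pairs [i, j < N] with
    [i + j >= N]: at most [N^2] terms, each of modulus at most [C^2 q^N]. *)
Lemma cauchy_product a b (la lb : R[i]) (C q : R) : 0 <= q < 1 ->
  (forall k, cabs (a k) <= C * q ^+ k) -> (forall k, cabs (b k) <= C * q ^+ k) ->
  ccvg \oo (fun N : nat => \sum_(k < N) a k) la ->
  ccvg \oo (fun N : nat => \sum_(k < N) b k) lb ->
  ccvg \oo (fun N : nat => \sum_(k < N) conv_seq a b k) (la * lb).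
Proof.
move=> /andP[q0 q1] aC bC ca cb.
have C0 : 0 <= C.
  by have := le_trans (cabs_ge0 _) (aC 0%N); rewrite expr0 mulr1.
pose D (N : nat) : R[i] :=
  \sum_(k < N) conv_seq a b k - (\sum_(k < N) a k) * (\sum_(k < N) b k).
suff D0 : ccvg \oo D 0.
  have E : (fun N : nat => \sum_(k < N) conv_seq a b k) =
      fun N => D N + (\sum_(k < N) a k) * (\sum_(k < N) b k).
    by apply/funext => N; rewrite /D subrK.
  rewrite E -[la * lb]add0r.
  exact: (ccvgD D0 (ccvgM ca cb)).
(* With [s^2 = q], [N^2 q^N] is the square of [N s^N], which tends to 0. *)
pose s := Num.sqrt q.
have s01 : 0 <= s < 1.
  by rewrite sqrtr_ge0 -sqrtr1 ltr_sqrt.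
apply: (@ccvg0_cabs _ (fun N : nat => C ^+ 2 * (N%:R * s ^+ N) ^+ 2)); last first.
  rewrite -[X in _ --> X](mulr0 (C ^+ 2)); apply: cvgM; first exact: cvg_cst.
  have -> : 0 = 0 ^+ 2 :> R by rewrite expr0n.
  by apply: cvg_sqr; exact: cvg_natr_expr.
move=> N.
have -> : D N = - \sum_(i < N) \sum_(j < N | ~~ (j < N - i)%N) a i * b j.
  rewrite /D /conv_seq (triangle_sum (fun i j => a i * b j)) mulr_suml -sumrB -sumrN.
  apply: eq_bigr => i _; rewrite mulr_sumr.
  by rewrite [X in _ - X](bigID (fun j : 'I_N => (j < N - i)%N)) /= opprD addrA subrr add0r.
rewrite /cabs nsqN -/(cabs _).
apply: (le_trans (cabs_sum _ _ _)).
apply: (@le_trans _ _ (\sum_(i < N) \sum_(j < N) C ^+ 2 * q ^+ N)).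
  apply: ler_sum => i _; apply: (le_trans (cabs_sum _ _ _)).
  rewrite big_mkcond /=; apply: ler_sum => j _; case: ifPn => [|_]; last first.
    by rewrite mulr_ge0 ?sqr_ge0// exprn_ge0.
  rewrite -leqNgt leq_subLR => Nij.
  rewrite cabsM; apply: (@le_trans _ _ ((C * q ^+ i) * (C * q ^+ j))).
    by apply: ler_pM; rewrite ?cabs_ge0.
  rewrite mulrACA -expr2 -exprD ler_wpM2l ?sqr_ge0//.
  by apply: ler_wiXn2l => //; exact: ltW.
have -> : (N%:R * s ^+ N) ^+ 2 = N%:R ^+ 2 * q ^+ N.
  by rewrite exprMn -exprM [(N * 2)%N]mulnC exprM /s sqr_sqrtr.
rewrite !sumr_const !card_ord le_eqVlt; apply/orP; left; apply/eqP.
rewrite -(mulr_natr (C ^+ 2 * q ^+ N)) -(mulr_natr (C ^+ 2 * q ^+ N * _)); ring.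
Qed.

End CauchyProduct.

(** * Power series on the disc and their radial limits *)

Section DiscFunctions.
Context {R : realType}.
Local Notation mu := (@lebesgue_measure R).
Implicit Types (a b : nat -> R[i]) (f g : disc R -> R[i]).

Definition sps a f := forall z : disc R,
  ccvg \oo (fun N : nat => \sum_(k < N) val z ^+ k * a k) (f z).

Lemma to_discK (z : R[i]) : `|z| < 1 -> val (to_disc z) = z.
Proof. by move=> z1; rewrite /to_disc insubdK. Qed.

Lemma disc_radius (r t : R) : 0 < r < 1 -> `|r%:C * expi t| < 1.
Proof.
move=> /andP[r0 r1]; rewrite normc_cabs cabsM /cabs nsq_expi sqrtr1 mulr1.
by rewrite nsq_real sqrtr_sqr gtr0_norm// ltcR.
Qed.

Definition on_circle f (r t : R) : R[i] := f (to_disc (r%:C * expi t)).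

Definition sbv f (t : R) : R[i] :=
  lim ((fun r : R => (on_circle f r t : R[i]^o)) @ 1^'-).

Lemma bvE (m p : nat) (F : disc R -> 'M[R[i]]_(m, p)) t i j :
  bv F t i j = sbv (fun z => F z i j) t.
Proof. by rewrite mxE. Qed.

Definition radial_limit f t (l : R[i]) := ccvg 1^'- (fun r => on_circle f r t) l.

Lemma sbv_radial f t l : radial_limit f t l -> sbv f t = l.
Proof. by move=> h; rewrite /sbv (ccvg_lim h). Qed.

Definition scaled_seq a (r : R) (k : nat) : R[i] := (r ^+ k)%:C * a k.

Lemma on_circle_sum a (r t : R) N : 0 < r < 1 ->
  \sum_(k < N) val (to_disc (r%:C * expi t)) ^+ k * a k =
  tpoly (scaled_seq a r) N t.
Proof.
move=> r01; rewrite to_discK ?disc_radius//; apply: eq_bigr => k _.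
by rewrite exprMn /scaled_seq /tmon rmorphXn /=; ring.
Qed.

Lemma sps_on_circle a f (r t : R) : 0 < r < 1 -> sps a f ->
  ccvg \oo (fun N : nat => tpoly (scaled_seq a r) N t) (on_circle f r t).
Proof.
move=> r01 /(_ (to_disc (r%:C * expi t))).
by under eq_fun do rewrite on_circle_sum//.
Qed.

Lemma fatou_radial a f t l : sps a f -> cesaro_cvg a t l -> radial_limit f t l.
Proof.
move=> af [cr ci].
(* Stated for an additive, real-homogeneous, continuous [g], to be used for the real and for the
   imaginary part. *)
have key (g : R[i] -> R) (x : nat -> R) :
    (forall N (b : nat -> R[i]), g (\sum_(k < N) b k) = \sum_(k < N) g (b k)) ->
    (forall (y : R) z, g (y%:C * z) = y * g z) ->
    (forall (T : Type) (F : set_system T) (FF : Filter F) (u : T -> R[i]) m,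
      ccvg F u m -> (fun s => g (u s)) @ F --> g m) ->
    (fun n => g (cesaro_mean a n t)) @ \oo --> g l ->
    (fun r => g (on_circle f r t)) @ 1^'- --> g l.
  move=> gS gZ gc cg.
  apply: (@abel_of_cesaro _ (fun k => g (a k * tmon k t)) (g l)
    (fun r => g (on_circle f r t))).
  - have E : (fun n => g (cesaro_mean a n t)) =
        fun n : nat => n.+1%:R^-1 * \sum_(j < n.+1) \sum_(k < j.+1) g (a k * tmon k t).
      apply/funext => n; rewrite /cesaro_mean gZ; congr (_ * _).
      rewrite /cesaro_sum (gS n.+1 (fun j => tpoly a j.+1 t)).
      by apply: eq_bigr => j _; rewrite /tpoly (gS j.+1 (fun k => a k * tmon k t)).
    by rewrite -E.
  - move=> r r01.
    have E : (fun N : nat => \sum_(k < N) g (a k * tmon k t) * r ^+ k) =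
        fun N => g (tpoly (scaled_seq a r) N t).
      apply/funext => N; rewrite /tpoly (gS N (fun k => scaled_seq a r k * tmon k t)).
      by apply: eq_bigr => k _; rewrite /scaled_seq -mulrA gZ mulrC.
    rewrite E; apply: (gc nat \oo _ (fun N : nat => tpoly (scaled_seq a r) N t)).
    exact: sps_on_circle.
apply/cvg_complexP; split; apply: key => //.
- by move=> N b; rewrite cRe_sum.
- by move=> y z; rewrite cReM /= mul0r subr0.
- by move=> T F FF u m /cvg_complexP[].
- by move=> N b; rewrite cIm_sum.
- by move=> y z; rewrite cImM /= mul0r addr0.
- by move=> T F FF u m /cvg_complexP[].
Qed.

Lemma cabs_le_ReIm (z : R[i]) : cabs z <= `|complex.Re z| + `|complex.Im z|.
Proof.
rewrite -[leRHS]ger0_norm ?addr_ge0// -sqrtr_sqr ler_sqrt ?sqr_ge0//.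
rewrite /nsq -(real_normK (num_real (complex.Re z))).
rewrite -(real_normK (num_real (complex.Im z))).
have := mulr_ge0 (normr_ge0 (complex.Re z)) (normr_ge0 (complex.Im z)).
rewrite !expr2; lra.
Qed.

Lemma real_cvg_terms_bounded (x : nat -> R) (l : R) :
  (fun N : nat => \sum_(k < N) x k) @ \oo --> l -> exists C, forall k, `|x k| <= C.
Proof.
move=> xl; have /cvg_seq_bounded[C [_ /(_ (C + 1))]] := cvgP _ xl.
rewrite ltrDl ltr01 => /(_ isT) sC.
exists (2 * (C + 1)) => k.
have -> : x k = \sum_(k < k.+1) x k - \sum_(k < k) x k.
  by rewrite big_ord_recr /= addrAC subrr add0r.
rewrite (le_trans (ler_normB _ _))//.
by have := sC k I; have := sC k.+1 I; rewrite /=; lra.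
Qed.

(** Convergence at a point of modulus [s] halfway between [p] and 1 bounds the terms [s^k |a_k|];
    the ratio is [q = p / s]. *)
Lemma sps_geometric a f (p : R) : sps a f -> 0 < p < 1 ->
  exists C q, 0 <= q < 1 /\ forall k, p ^+ k * cabs (a k) <= C * q ^+ k.
Proof.
move=> af /andP[p0 p1]; pose s := (1 + p) / 2.
have s0 : 0 < s by rewrite /s; lra.
have s1 : s < 1 by rewrite /s; lra.
have ps : p < s by rewrite /s; lra.
have sn : `|s%:C * expi 0| < 1 by apply: disc_radius; rewrite s0.
have := af (to_disc (s%:C * expi 0)).
move=> /cvg_complexP[]; under eq_fun do rewrite cRe_sum.
move=> /(real_cvg_terms_bounded (x := fun k => complex.Re
  (val (to_disc (s%:C * expi 0)) ^+ k * a k)))[C1 hC1].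
under eq_fun do rewrite cIm_sum.
move=> /(real_cvg_terms_bounded (x := fun k => complex.Im
  (val (to_disc (s%:C * expi 0)) ^+ k * a k)))[C2 hC2].
exists (C1 + C2), (p / s); split.
  by rewrite divr_ge0 ?(ltW p0) ?(ltW s0)//= ltr_pdivrMr// mul1r.
move=> k.
have h : s ^+ k * cabs (a k) <= C1 + C2.
  have -> : s ^+ k * cabs (a k) = cabs (val (to_disc (s%:C * expi 0)) ^+ k * a k).
    rewrite to_discK// cabsM cabsX cabsM /cabs nsq_expi sqrtr1 mulr1 nsq_real.
    by rewrite sqrtr_sqr gtr0_norm.
  by apply: (le_trans (cabs_le_ReIm _)); rewrite lerD ?hC1 ?hC2.
rewrite expr_div_n mulrA ler_pdivlMr ?exprn_gt0//.
by rewrite -mulrA [leRHS]mulrC ler_wpM2l ?exprn_ge0 ?(ltW p0)// mulrC.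
Qed.

Lemma ell2_scaled a f (r : R) : sps a f -> 0 < r < 1 -> ell2 (scaled_seq a r).
Proof.
move=> af r01; have [C [q [/andP[q0 q1] aq]]] := sps_geometric af r01.
have /andP[r0 _] := r01.
exists (C ^+ 2 * (1 - q ^+ 2)^-1) => N.
have q2 : q ^+ 2 < 1 by rewrite expr_lt1.
apply: (@le_trans _ _ (\sum_(k < N) C ^+ 2 * (q ^+ 2) ^+ k)).
  apply: ler_sum => k _; rewrite -exprM mulnC exprM -exprMn.
  rewrite /scaled_seq nsqM nsq_real -sqr_cabs -exprMn.
  rewrite ler_sqr ?nnegrE ?aq//; first by rewrite mulr_ge0 ?cabs_ge0 ?exprn_ge0 ?(ltW r0).
  by apply: le_trans (aq k); rewrite mulr_ge0 ?cabs_ge0 ?exprn_ge0 ?(ltW r0).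
rewrite -mulr_sumr ler_wpM2l ?sqr_ge0//.
rewrite -[leRHS]mul1r ler_pdivlMr ?subr_gt0//.
elim: N => [|N IH]; first by rewrite big_ord0 mul0r.
have E M : (\sum_(k < M) (q ^+ 2) ^+ k) * (1 - q ^+ 2) = 1 - (q ^+ 2) ^+ M.
  elim: M => [|M IHM]; first by rewrite big_ord0 mul0r expr0 subrr.
  by rewrite big_ord_recr /= mulrDl IHM [in RHS]exprS; ring.
by rewrite E lerBlDr lerDl exprn_ge0// sqr_ge0.
Qed.

(** The geometric decay required by [cauchy_product] comes from [sps_geometric] at a radius [p]
    between [|z|] and 1, with the larger of the two constants and of the two ratios. *)
Lemma spsM a b f g : sps a f -> sps b g ->
  sps (conv_seq a b) (fun z => f z * g z).
Proof.
move=> af bg z.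
have z1 : cabs (val z) < 1 by have := valP z; rewrite normc_cabs ltcR.
pose p := (1 + cabs (val z)) / 2.
have zp : cabs (val z) <= p by rewrite /p; lra.
have p01 : 0 < p < 1 by have := cabs_ge0 (val z); rewrite /p => ?; apply/andP; split; lra.
have [C [q [/andP[q0 q1] aq]]] := sps_geometric af p01.
have [C' [q' [/andP[q'0 q'1] bq]]] := sps_geometric bg p01.
have E : (fun N : nat => \sum_(k < N) val z ^+ k * conv_seq a b k) =
   fun N => \sum_(k < N) conv_seq (fun k => val z ^+ k * a k)
     (fun k => val z ^+ k * b k) k.
  apply/funext => N; apply: eq_bigr => k _; rewrite /conv_seq mulr_sumr.
  apply: eq_bigr => i _; rewrite mulrACA -exprD subnKC// -ltnS; exact: ltn_ord.
rewrite E.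
have bnd (x : nat -> R[i]) (D e : R) : 0 <= e -> e <= Num.max q q' ->
    D <= Num.max C C' ->
    (forall k, p ^+ k * cabs (x k) <= D * e ^+ k) ->
    forall k, cabs (val z ^+ k * x k) <= Num.max C C' * (Num.max q q') ^+ k.
  move=> e0 em DC xe k; rewrite cabsM cabsX.
  apply: (@le_trans _ _ (p ^+ k * cabs (x k))).
    by apply: ler_wpM2r; rewrite ?cabs_ge0// lerXn2r// ?nnegrE ?cabs_ge0//;
      case/andP: p01 => /ltW.
  have D0 : 0 <= D.
    by have := xe 0%N; rewrite !expr0 mulr1 mul1r; apply: le_trans; exact: cabs_ge0.
  apply: (le_trans (xe k)); apply: ler_pM; rewrite ?exprn_ge0//.
  by rewrite lerXn2r// ?nnegrE// (le_trans e0).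
apply: (@cauchy_product _ _ _ _ _ (Num.max C C') (Num.max q q')) => //.
- by rewrite le_max q0 gt_max q1 q'1.
- by apply: (bnd a C q) => //; rewrite le_max lexx.
- by apply: (bnd b C' q') => //; rewrite le_max lexx orbT.
Qed.

Lemma L2approx_on_circle a f (r : R) : sps a f -> 0 < r < 1 ->
  L2approx (scaled_seq a r) (on_circle f r).
Proof.
move=> af r01; have la := ell2_scaled af r01.
pose c (n k : nat) : R := 1.
have c01 n k : (k <= n)%N -> 0 <= c n k <= 1 by rewrite /c ler01 lexx.
have c1 k : (fun n => c n k) @ \oo --> (1 : R) by exact: cvg_cst.
have Tu : {ae mu, forall t, circle t ->
  (fun n => complex.Re (tpoly (weighted c (scaled_seq a r) n) n.+1 t)) @ \oo -->
    complex.Re (on_circle f r t) /\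
  (fun n => complex.Im (tpoly (weighted c (scaled_seq a r) n) n.+1 t)) @ \oo -->
    complex.Im (on_circle f r t)}.
  apply: aeW => t _.
  have W n : weighted c (scaled_seq a r) n = scaled_seq a r.
    by apply/funext => k; rewrite /weighted mul1r.
  under eq_fun do rewrite W; under [X in _ /\ (X @ _ --> _)]eq_fun do rewrite W.
  have /cvg_complexP[hr hi] := @sps_on_circle a f r t r01 af.
  by split; [move: hr|move: hi]; rewrite -cvg_shiftS.
split; first exact: L2_limit c01 c1 la Tu.
by move=> M B; exact: sdot_L2_limit c01 c1 Tu _ _.
Qed.

Lemma sum_partial_sums (x : nat -> R[i]) n :
  \sum_(j < n) \sum_(k < j.+1) x k = \sum_(k < n) (n - k)%N%:R * x k.
Proof.
elim: n => [|n IH]; first by rewrite !big_ord0.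
rewrite big_ord_recr /= IH [in RHS]big_ord_recr [\sum_(k < n.+1) _]big_ord_recr /=.
rewrite subSnn mul1r addrA -big_split /=; congr (_ + _); apply: eq_bigr => k _.
by rewrite subSn ?(ltnW (ltn_ord _))// -natr1 mulrDl mul1r.
Qed.

(** The almost everywhere Cesaro limit is the radial limit by [fatou_radial], hence equals [sbv f].
    It is also the mean-square limit by the weighted argument, as a Cesaro mean gives [a_k] the
    weight [(n + 1 - k) / (n + 1)]. *)
Lemma L2approx_sbv a f : ell2 a -> sps a f ->
  L2approx a (sbv f) /\
  {ae mu, forall t, circle t -> radial_limit f t (sbv f t)}.
Proof.
move=> la af.
have aeP : {ae mu, forall t, circle t -> cesaro_cvg a t (sbv f t) /\
    radial_limit f t (sbv f t)}.
  have := cesaro_cvg_ae la; apply: filterS => t h It; have [l al] := h It.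
  by have fl := fatou_radial af al; rewrite (sbv_radial fl).
split; last by move: aeP; apply: filterS => t h It; have [] := h It.
pose c (n k : nat) : R := (n.+1 - k)%N%:R / n.+1%:R.
have c01 n k : (k <= n)%N -> 0 <= c n k <= 1.
  by move=> _; rewrite divr_ge0//= ler_pdivrMr// mul1r ler_nat leq_subr.
have c1 k : (fun n => c n k) @ \oo --> (1 : R).
  apply/cvgrPdist_le => e e0.
  have h : (fun n => k%:R * @harmonic R n) @ \oo --> (0 : R).
    rewrite -[X in _ --> X](mulr0 k%:R); apply: cvgM; first exact: cvg_cst.
    exact: cvg_harmonic.
  have /cvgr0Pnorm_le/(_ _ e0)[n0 _ hn] := h.
  exists (maxn n0 k) => // n /=; rewrite geq_max => /andP[n0n kn].
  have -> : 1 - c n k = k%:R * harmonic n.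
    rewrite /c /harmonic /= natrB ?(leqW kn)// mulrBl divff ?pnatr_eq0//.
    by rewrite opprB addrC subrK.
  exact: hn.
have Tu : {ae mu, forall t, circle t ->
  (fun n => complex.Re (tpoly (weighted c a n) n.+1 t)) @ \oo -->
    complex.Re (sbv f t) /\
  (fun n => complex.Im (tpoly (weighted c a n) n.+1 t)) @ \oo -->
    complex.Im (sbv f t)}.
  move: aeP; apply: filterS => t h It; have [[hr hi] _] := h It.
  have W n : tpoly (weighted c a n) n.+1 t = cesaro_mean a n t.
    rewrite /cesaro_mean /cesaro_sum /tpoly (sum_partial_sums (fun k => a k * tmon k t)) mulr_sumr.
    apply: eq_bigr => k _; rewrite /weighted /c rmorphM /= rmorph_nat; ring.
  by under eq_fun do rewrite W; under [X in _ /\ (X @ _ --> _)]eq_fun do rewrite W.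
split; first exact: L2_limit c01 c1 la Tu.
by move=> M B; exact: sdot_L2_limit c01 c1 Tu _ _.
Qed.

(** Bessel on the circle of radius [r] bounds the sum of [r^(2k) |a_k|^2] over [k < N] by [B]; for
    fixed [N], let [r] tend to 1. *)
Lemma ell2_of_circle_bound a f (B : R) : sps a f ->
  (forall r, 0 < r < 1 -> complex.Re (sdot (on_circle f r) (on_circle f r)) <= B) ->
  ell2 a.
Proof.
move=> af fB; exists B => N.
have h r : 0 < r < 1 -> \sum_(k < N) (r ^+ k) ^+ 2 * nsq (a k) <= B.
  move=> r01; apply: le_trans (fB r r01).
  have fr := L2approx_on_circle af r01.
  apply: le_trans (bessel N fr.1); apply: ler_sum => k _.
  rewrite (L2approx_coef _ (ell2_scaled af r01) fr).
  by rewrite /scaled_seq nsqM nsq_real.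
(* The radii are [1 - 1 / (n + 2)]; the shifted index keeps them positive. *)
have c : (fun n : nat => \sum_(k < N) ((1 - @harmonic R n.+1) ^+ k) ^+ 2 * nsq (a k))
    @ \oo --> \sum_(k < N) ((1 - 0) ^+ k) ^+ 2 * nsq (a k).
  apply: (@cvg_sum_ord _ _ _ _ _
    (fun (k : 'I_N) n => ((1 - @harmonic R n.+1) ^+ k) ^+ 2 * nsq (a k))) => k.
  apply: cvgM; last exact: cvg_cst.
  apply: cvg_sqr.
  apply: (@cvg_comp _ _ _ (fun n : nat => 1 - @harmonic R n.+1) (fun x : R => x ^+ k)
    _ (nbhs (1 - 0 : R))); last exact: exprn_continuous.
  apply: cvgB; first exact: cvg_cst.
  by have := @cvg_harmonic R; rewrite -cvg_shiftS.
have E : \sum_(k < N) nsq (a k) = \sum_(k < N) ((1 - 0) ^+ k) ^+ 2 * nsq (a k).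
  by apply: eq_bigr => k _; rewrite subr0 !expr1n mul1r.
rewrite E.
apply: (ler_cvg_to c (cvg_cst B)); apply: nearW => n; apply: h.
rewrite /harmonic /= subr_gt0 invf_lt1 ?ltr0n// ltr1n /=.
by rewrite ltrBlDr ltrDl invr_gt0 ltr0n.
Qed.

Lemma bounded_ell2 a f (M : R) : sps a f -> (forall z, nsq (f z) <= M) -> ell2 a.
Proof.
move=> af fM; apply: (ell2_of_circle_bound (B := M) af) => r r01.
have M0 : 0 <= M := le_trans (nsq_ge0 _) (fM (disc0 R)).
have := @Re_sdot_mono _ (on_circle f r) (tmon 0) M (tmon_L2 0) M0.
rewrite sdot_tmon eqxx mulr1; apply => t.
by rewrite /tmon expr0 nsq1 mulr1; exact: fM.
Qed.

(** On each circle of radius [r < 1] the pointwise bound on [f] gives a mean-square bound on the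
    product that does not depend on [r], and [ell2_of_circle_bound] carries it to the
    coefficients. *)
Lemma bounded_mul_ell2 a b f g (M : R) : sps a f -> sps b g -> ell2 b ->
  (forall z, nsq (f z) <= M) -> ell2 (conv_seq a b).
Proof.
move=> af bg [B bB] fM.
have M0 : 0 <= M := le_trans (nsq_ge0 _) (fM (disc0 R)).
apply: (ell2_of_circle_bound (B := M * B) (spsM af bg)) => r r01.
have gr := L2approx_on_circle bg r01.
apply: (@le_trans _ _ (M * complex.Re (sdot (on_circle g r) (on_circle g r)))).
  apply: Re_sdot_mono => //; first exact: gr.1.
  by move=> t; rewrite nsqM ler_wpM2r ?nsq_ge0.
apply: ler_wpM2l => //; apply: (L2approx_norm gr) => N.
apply: le_trans (bB N); apply: ler_sum => k _.
rewrite /scaled_seq nsqM nsq_real ler_piMl ?nsq_ge0//.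
by case/andP: r01 => r0 r1; rewrite -exprM exprn_ile1// ltW.
Qed.

End DiscFunctions.

(** * The scalar Hardy space and bounded analytic functions *)

Section ScalarHardy.
Context {R : realType}.
Local Notation mu := (@lebesgue_measure R).
Implicit Types (f g : disc R -> R[i]) (u v : R -> R[i]).

Definition sH2 f := exists2 a, ell2 a & sps a f.

Definition sHinf f := exists2 a, sps a f & exists M : R, forall z, nsq (f z) <= M.

Definition has_bv f := {ae mu, forall t, circle t -> radial_limit f t (sbv f t)}.

Lemma sps_linear a b (c : R[i]) f g : sps a f -> sps b g ->
  sps (fun k => c * a k + b k) (fun z => c * f z + g z).
Proof.
move=> af bg z.
have E : (fun N : nat => \sum_(k < N) val z ^+ k * (c * a k + b k)) =
    fun N => c * (\sum_(k < N) val z ^+ k * a k) + \sum_(k < N) val z ^+ k * b k.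
  apply/funext => N; rewrite mulr_sumr -big_split /=; apply: eq_bigr => k _.
  by rewrite mulrDr; congr (_ + _); rewrite mulrCA.
by rewrite E; apply: ccvgD; [apply: ccvgM; [exact: ccvg_cst|exact: af]|exact: bg].
Qed.

Lemma sH2_linear (c : R[i]) f g : sH2 f -> sH2 g -> sH2 (fun z => c * f z + g z).
Proof.
move=> [a la af] [b lb bg]; exists (fun k => c * a k + b k).
  exact: ell2D (ell2Z c la) lb.
exact: sps_linear.
Qed.

Lemma sps_disc0 a f : sps a f -> f (disc0 R) = a 0%N.
Proof.
move=> af; apply: (@ccvg_unique _ _ _ _ _ _ _ (af (disc0 R))).
have -> : (fun N : nat => \sum_(k < N) val (disc0 R) ^+ k * a k) =
    fun N => if N is 0%N then 0 else a 0%N.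
  apply/funext => -[|N]; first by rewrite big_ord0.
  rewrite big_ord_recl expr0 mul1r big1 ?addr0// => k _.
  by rewrite exprS /= !mul0r.
apply/cvg_complexP; split; apply: cvg_near_cst; exists 1%N => // -[|N]//.
Qed.

Lemma sps_cst (c : R[i]) : sps (fun k => if k == 0%N then c else 0) (fun=> c).
Proof.
move=> z; apply/cvg_complexP; split; apply: cvg_near_cst; exists 1%N => // -[|N]// _.
  by rewrite big_ord_recl expr0 mul1r /= big1 ?addr0// => k _; rewrite mulr0.
by rewrite big_ord_recl expr0 mul1r /= big1 ?addr0// => k _; rewrite mulr0.
Qed.

Lemma sps_val : sps (fun k => if k == 1%N then 1 else 0) (fun z : disc R => val z).
Proof.
move=> z; apply/cvg_complexP; split; apply: cvg_near_cst; exists 2%N => // -[|[|N]]// _.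
  rewrite !big_ord_recl /= expr0 expr1 mulr0 mulr1 add0r big1 ?addr0// => k _.
  by rewrite mulr0.
rewrite !big_ord_recl /= expr0 expr1 mulr0 mulr1 add0r big1 ?addr0// => k _.
by rewrite mulr0.
Qed.

Lemma sHinf_cst (c : R[i]) : sHinf (fun=> c).
Proof. by exists (fun k => if k == 0%N then c else 0); [exact: sps_cst|exists (nsq c)]. Qed.

Lemma sHinf_val : sHinf (fun z : disc R => val z).
Proof.
exists (fun k => if k == 1%N then 1 else 0); first exact: sps_val.
exists 1 => z; have := valP z; rewrite normc_cabs ltcR => z1.
by rewrite -sqr_cabs expr_le1 ?cabs_ge0// ltW.
Qed.

Lemma sHinf_sH2 f : sHinf f -> sH2 f.
Proof. by move=> [a af [M fM]]; exists a => //; exact: bounded_ell2 fM. Qed.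

Lemma sHinf_mul f g : sHinf f -> sH2 g -> sH2 (fun z => f z * g z).
Proof.
move=> [a af [M fM]] [b lb bg]; exists (conv_seq a b); last exact: (spsM af bg).
exact: (bounded_mul_ell2 af bg lb fM).
Qed.

Lemma sH2_has_bv f : sH2 f -> has_bv f.
Proof. by move=> [a la af]; have [] := L2approx_sbv la af. Qed.

Lemma sH2_L2 f : sH2 f -> L2circle (sbv f).
Proof. by move=> [a la af]; have [[]] := L2approx_sbv la af. Qed.

(** Only almost everywhere: where a radial limit is missing, [sbv] is a default value and obeys no
    algebra. *)
Lemma has_bv_linear (c : R[i]) f g : has_bv f -> has_bv g ->
  ae_circle (sbv (fun z => c * f z + g z)) (fun t => c * sbv f t + sbv g t).
Proof.
move=> hf hg; move: hf hg; apply: filterS2 => t hf hg It.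
apply: sbv_radial; apply: ccvgD; last exact: hg.
by apply: ccvgM; [exact: ccvg_cst|exact: hf].
Qed.

Lemma has_bvM f g : has_bv f -> has_bv g ->
  ae_circle (sbv (fun z => f z * g z)) (fun t => sbv f t * sbv g t).
Proof.
move=> hf hg; move: hf hg; apply: filterS2 => t hf hg It.
by apply: sbv_radial; apply: ccvgM; [exact: hf|exact: hg].
Qed.

Lemma sbv_near f t (l : R -> R[i]) (m : R[i]) :
  (forall r, 0 < r < 1 -> on_circle f r t = l r) -> ccvg 1^'- l m -> sbv f t = m.
Proof.
move=> fl lm; apply: sbv_radial.
have near01 : \forall r \near (1 : R)^'-, 0 < r < 1.
  near=> r; apply/andP; split; near: r; [exact: nbhs_left_gt|exact: nbhs_left_lt].
move: lm => /cvg_complexP[lr li]; apply/cvg_complexP; split.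
- by apply: cvg_trans lr; apply: near_eq_cvg; apply: filterS near01 => r r01; rewrite fl.
- by apply: cvg_trans li; apply: near_eq_cvg; apply: filterS near01 => r r01; rewrite fl.
Unshelve. all: by end_near. Qed.

Lemma sbv_cst (c : R[i]) t : sbv (fun=> c) t = c.
Proof. by apply: (@sbv_near _ _ (fun=> c)) => //; exact: ccvg_cst. Qed.

Lemma sbv_val t : sbv (fun z : disc R => val z) t = expi t.
Proof.
apply: (@sbv_near _ _ (fun r => r%:C * expi t)).
  by move=> r r01; rewrite /on_circle to_discK// disc_radius.
rewrite -[X in ccvg _ _ X]mul1r; apply: ccvgM; last exact: ccvg_cst.
by apply/cvg_complexP; split => /=; [apply: cvg_at_left_filter; exact: cvg_id|exact: cvg_cst].
Qed.

Lemma sH2_coef a f k : ell2 a -> sps a f -> sdot (sbv f) (tmon k) = a k.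
Proof. by move=> la af; have [fa _] := L2approx_sbv la af; exact: L2approx_coef fa. Qed.

(** Cauchy-Schwarz against each [tmon k] makes every Taylor coefficient vanish. *)
Lemma sH2_definite f : sH2 f -> complex.Re (sdot (sbv f) (sbv f)) = 0 -> f = fun=> 0.
Proof.
move=> [a la af] f0; have Lf : L2circle (sbv f) by apply: sH2_L2; exists a.
have a0 k : a k = 0.
  apply: nsq_eq0; apply/eqP; rewrite eq_le nsq_ge0 andbT.
  have := sdot_cauchy_schwarz Lf (tmon_L2 k).
  by rewrite (sH2_coef k la af) f0 mul0r.
apply/funext => z; apply: (@ccvg_unique _ _ _ _ _ _ _ (af z)).
have -> : (fun N : nat => \sum_(k < N) val z ^+ k * a k) = fun=> 0.
  by apply/funext => N; rewrite big1// => k _; rewrite a0 mulr0.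
exact: ccvg_cst.
Qed.

Lemma sdot_sH2_eq0 f u : sH2 f -> L2circle u ->
  (forall k, sdot u (tmon k) = 0) -> sdot u (sbv f) = 0.
Proof.
move=> [a la af] Lu u0; have [fa _] := L2approx_sbv la af.
exact: sdot_L2approx0 fa Lu u0.
Qed.

(** The coefficients are bounded by the square root of [M], so at each point of the disc the series
    is dominated by a geometric one. *)
Lemma sH2_of_ell2 a : ell2 a -> exists2 f, sH2 f & forall k, sdot (sbv f) (tmon k) = a k.
Proof.
move=> la; have [M aM] := la.
have M0 : 0 <= M by have := aM 0%N; rewrite big_ord0.
have ak k : cabs (a k) <= Num.sqrt M.
  rewrite ler_sqrt//; apply: le_trans (aM k.+1); rewrite big_ord_recr /= lerDr.
  by apply: sumr_ge0 => i _; exact: nsq_ge0.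
have cv (z : disc R) : exists l, ccvg \oo (fun N : nat => \sum_(k < N) val z ^+ k * a k) l.
  have z1 : cabs (val z) < 1 by have := valP z; rewrite normc_cabs ltcR.
  have key (x : nat -> R) : (forall k, `|x k| <= Num.sqrt M * cabs (val z) ^+ k) ->
      cvgn (fun N : nat => \sum_(k < N) x k).
    move=> xM; have -> : (fun N : nat => \sum_(k < N) x k) = series x.
      by apply/funext => N; rewrite /series /= big_mkord.
    apply: normed_cvg; apply: (@series_le_cvg _ _ (geometric (Num.sqrt M) (cabs (val z)))).
    - by move=> k /=.
    - by move=> k; rewrite mulr_ge0 ?sqrtr_ge0// exprn_ge0// cabs_ge0.
    - exact: xM.
    - by apply: is_cvg_geometric_series; rewrite ger0_norm// cabs_ge0.
  have zk k : cabs (val z ^+ k * a k) <= Num.sqrt M * cabs (val z) ^+ k.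
    by rewrite cabsM cabsX mulrC ler_wpM2r ?exprn_ge0 ?cabs_ge0.
  have cr := key _ (fun k => le_trans (abs_Re_le _) (zk k)).
  have ci := key _ (fun k => le_trans (abs_Im_le _) (zk k)).
  exists (limn (fun N : nat => \sum_(k < N) complex.Re (val z ^+ k * a k)) +i*
    limn (fun N : nat => \sum_(k < N) complex.Im (val z ^+ k * a k))).
  apply/cvg_complexP; split => /=.
  - by under eq_fun do rewrite cRe_sum; exact: cr.
  - by under eq_fun do rewrite cIm_sum; exact: ci.
have [f fP] := choice cv.
exists f; first by exists a.
by move=> k; exact: sH2_coef.
Qed.

(** The projection keeps the coefficients of [u] at [k >= 0]: Bessel makes them square-summable, and
    the remainder has none of them, so it is orthogonal to H^2. *)
Lemma sH2_projection u : L2circle u ->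
  exists2 f, sH2 f & forall g, sH2 g -> sdot (fun t => u t - sbv f t) (sbv g) = 0.
Proof.
move=> Lu; have lu : ell2 (fun k => sdot u (tmon k)).
  by exists (complex.Re (sdot u u)) => N; exact: bessel.
have [f Hf fk] := sH2_of_ell2 lu; exists f => // g Hg.
have Lf := sH2_L2 Hf.
apply: sdot_sH2_eq0 => //; first exact: L2circleB.
by move=> k; rewrite sdotBl ?fk ?subrr//; exact: tmon_L2.
Qed.

Lemma sH2_shift f : sH2 f -> exists2 g, sH2 g &
  forall z, val z * g z = f z - f (disc0 R).
Proof.
move=> [a la af].
pose b k := a k.+1.
have lb : ell2 b.
  have [M aM] := la; exists M => N; apply: le_trans (aM N.+1).
  by rewrite big_ord_recl lerDr nsq_ge0.
(* The removed singularity at 0 is filled with the coefficient of degree 1. *)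
pose g (z : disc R) := if val z == 0 then a 1%N else (val z)^-1 * (f z - a 0%N).
exists g.
  exists b; first exact: lb.
  move=> z; rewrite /g; case: ifPn => [/eqP z0|z0].
    apply/cvg_complexP; split; apply: cvg_near_cst;
      exists 1%N => // -[|N]// _.
      rewrite big_ord_recl expr0 mul1r big1 ?addr0// => k _.
      by rewrite z0 exprS !mul0r.
    rewrite big_ord_recl expr0 mul1r big1 ?addr0// => k _.
    by rewrite z0 exprS !mul0r.
  have E : (fun N : nat => \sum_(k < N) val z ^+ k * b k) =
      fun N : nat => (val z)^-1 * (\sum_(k < N.+1) val z ^+ k * a k + - a 0%N).
    apply/funext => N; rewrite big_ord_recl expr0 mul1r addrAC subrr add0r.
    rewrite mulr_sumr; apply: eq_bigr => k _.
    by rewrite /= exprS -mulrA mulKf.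
  rewrite E; apply: ccvgM; first exact: ccvg_cst.
  apply: ccvgD; last exact: ccvg_cst.
  have /cvg_complexP[hr hi] := af z.
  by apply/cvg_complexP; split;
    [move: hr|move: hi]; rewrite -cvg_shiftS.
move=> z; rewrite (sps_disc0 af) /g; case: ifPn => [/eqP z0|z0].
  have -> : z = disc0 R by apply: val_inj; rewrite z0.
  by rewrite (sps_disc0 af) mul0r subrr.
by rewrite mulVKf.
Qed.

(** The values agree off 0 by cancellation. Circles of positive radius avoid 0, so the difference
    has zero boundary values, and definiteness yields equality at 0 as well. *)
Lemma sH2_disc0_eq f g : sH2 f -> sH2 g ->
  (forall z, val z * f z = val z * g z) -> f = g.
Proof.
move=> Hf Hg fg.
have Hd : sH2 (fun z => (-1) * f z + g z) by exact: sH2_linear.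
have d0 : (fun z => (-1) * f z + g z) = fun=> 0.
  apply: sH2_definite => //.
  have E t : sbv (fun z => (-1) * f z + g z) t = 0.
    apply: (@sbv_near _ _ (fun=> 0)); last exact: ccvg_cst.
    move=> r r01; rewrite /on_circle; set z := to_disc _.
    have zN0 : val z != 0.
      rewrite /z to_discK ?disc_radius//; apply/eqP => z0.
      have : nsq (r%:C * expi t) = 0 by rewrite z0 nsq0.
      rewrite nsqM nsq_expi mulr1 nsq_real => /eqP.
      by rewrite sqrf_eq0 gt_eqF//; case/andP: r01.
    by rewrite (mulfI zN0 (fg z)) mulN1r addrC subrr.
  rewrite Re_sdot_self; under eq_Rintegral do rewrite E nsq0.
  by rewrite Rintegral_cst ?mul0r ?mulr0//; exact: measurable_circle.
apply/funext => z; have := congr1 (fun h => h z) d0 => /= /eqP.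
by rewrite mulN1r addrC subr_eq0 => /eqP.
Qed.

(** On the circle [f - c = exp(i t) f'], with [c] the value of [f] at 0, and the unimodular factor
    cancels against that of [z g]. The constant [c] is orthogonal to [z g] because [z g] vanishes at
    0. *)
Lemma sdot_shift f f' g : sH2 f -> sH2 f' -> sH2 g ->
  (forall z, val z * f' z = f z - f (disc0 R)) ->
  sdot (sbv f') (sbv g) = sdot (sbv f) (sbv (fun z => val z * g z)).
Proof.
move=> Hf Hf' Hg ff'.
have Hv := sHinf_val; have Hzg := sHinf_mul Hv Hg.
have Lf := sH2_L2 Hf; have Lf' := sH2_L2 Hf'; have Lg := sH2_L2 Hg.
have Lzg := sH2_L2 Hzg.
set c := f (disc0 R).
have Lc : L2circle (fun=> c) by apply: ccontinuous_L2circle; exact: ccontinuous_cst.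
have zg : ae_circle (sbv (fun z => val z * g z)) (fun t => expi t * sbv g t).
  apply: ae_circle_trans (has_bvM (sH2_has_bv (sHinf_sH2 Hv)) (sH2_has_bv Hg)) _.
  by apply: aeW => t _; rewrite sbv_val.
have fE : ae_circle (fun t => sbv f t - c) (fun t => expi t * sbv f' t).
  have h1 := has_bvM (sH2_has_bv (sHinf_sH2 Hv)) (sH2_has_bv Hf').
  have h2 := has_bv_linear (-1) (sH2_has_bv (sHinf_sH2 (sHinf_cst c))) (sH2_has_bv Hf).
  move: h1 h2; apply: filterS2 => t h1 h2 It.
  rewrite -{1}[expi t]sbv_val -h1//.
  have -> : (fun z => val z * f' z) = fun z => -1 * c + f z.
    by apply/funext => z; rewrite ff' mulN1r addrC.
  by rewrite h2// sbv_cst mulN1r addrC.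
have czg : sdot (fun=> c) (sbv (fun z => val z * g z)) = 0.
  have -> : (fun=> c) = (fun t : R => tpoly (fun=> c) 1 t).
    by apply/funext => t; rewrite /tpoly big_ord1 /tmon expr0 mulr1.
  rewrite sdot_tpolyl// big_ord1 (sdot_conj Lzg (tmon_L2 0)).
  have [b lb bzg] := Hzg.
  rewrite (sH2_coef 0 lb bzg) -(sps_disc0 bzg) /= mul0r.
  by rewrite conjC0 mulr0.
have -> : sdot (sbv f) (sbv (fun z => val z * g z)) =
    sdot (fun t => sbv f t - c) (sbv (fun z => val z * g z)).
  by rewrite sdotBl// czg subr0.
have Lzg' : L2circle (fun t => expi t * sbv g t).
  exact: L2circle_ae (ae_circle_sym zg) Lzg.
have Lzf' : L2circle (fun t => expi t * sbv f' t).
  exact: L2circle_ae (ae_circle_sym fE) (L2circleB Lf Lc).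
rewrite (sdot_ae Lzf' Lzg' fE zg) /sdot; congr circle_int; apply/funext => t.
have e1 : expi t * Num.conj (expi t) = 1 :> R[i] by rewrite -nsqE nsq_expi.
rewrite rmorphM /=.
transitivity ((expi t * Num.conj (expi t)) * (sbv f' t * Num.conj (sbv g t))).
  by rewrite e1 mul1r.
by ring.
Qed.

Lemma L2circle_conj u : L2circle u -> L2circle (fun t => Num.conj (u t)).
Proof.
move=> [v Lv uv]; exists (fun t => Num.conj (v t)); first exact: L2rep_conj.
by move: uv; apply: filterS => t h It; rewrite h.
Qed.

(** A bound on the disc passes to every existing radial limit, so the boundary function is
    essentially bounded. *)
Lemma sHinf_bv_mul f u : sHinf f -> L2circle u -> L2circle (fun t => sbv f t * u t).
Proof.
move=> Hf Lu; have hf := sH2_has_bv (sHinf_sH2 Hf).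
have [w [[mwr _] [mwi _]] fw] := sH2_L2 (sHinf_sH2 Hf).
have [a af [M fM]] := Hf.
have M0 : 0 <= M := le_trans (nsq_ge0 _) (fM (disc0 R)).
have [v Lv uv] := Lu; have [[mvr vr2] [mvi vi2]] := Lv.
have mC := @measurable_circle R.
have wM : {ae mu, forall t, circle t -> nsq (w t) <= M}.
  move: hf fw; apply: filterS2 => t hf fw It; rewrite -fw//.
  have /cvg_complexP[hr hi] := hf It.
  have h : (fun r => nsq (on_circle f r t)) @ 1^'- --> nsq (sbv f t).
    by apply: cvgD; exact: cvg_sqr.
  apply: (ler_cvg_to h (cvg_cst M)); apply: nearW => r; exact: fM.
have mnv : measurable_fun (circle : set (measurableTypeR R)) (fun t => nsq (v t)).
  by apply: measurable_funD; exact: measurable_funX.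
have fin : (\int[mu]_(t in circle) (M * nsq (v t))%:E < +oo)%E.
  have := integrableZl mC M (integrableD mC vr2 vi2).
  move=> /integrableP[_]; apply: le_lt_trans.
  apply: ge0_integral_mono => t _; first by rewrite lee_fin mulr_ge0 ?nsq_ge0.
  by rewrite /= lee_fin ger0_norm ?mulr_ge0 ?nsq_ge0// addr_ge0 ?sqr_ge0.
have key (x : R -> R) : measurable_fun (circle : set (measurableTypeR R)) x ->
    (forall t, x t ^+ 2 <= nsq (w t * v t)) -> square_integrable x.
  move=> mx xwv; split => //; apply/integrableP; split.
    by apply/measurable_EFinP; exact: measurable_funX.
  apply: le_lt_trans fin; apply: ae_ge0_le_integral => //.
  - by apply: measurableT_comp => //; apply/measurable_EFinP; exact: measurable_funX.
  - by move=> t _; rewrite lee_fin mulr_ge0 ?nsq_ge0.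
  - by apply/measurable_EFinP; exact: measurable_funM.
  - move: wM; apply: filterS => t wM It /=.
    rewrite lee_fin ger0_norm ?sqr_ge0// (le_trans (xwv t))// nsqM.
    by rewrite ler_wpM2r ?nsq_ge0// wM.
exists (fun t => w t * v t); last first.
  by move: fw uv; apply: filterS2 => t h1 h2 It; rewrite h1// h2.
split; apply: key.
- under eq_fun do rewrite cReM.
  by apply: measurable_funB; exact: measurable_funM.
- by move=> t; exact: sqr_Re_le.
- under eq_fun do rewrite cImM.
  by apply: measurable_funD; exact: measurable_funM.
- by move=> t; exact: sqr_Im_le.
Qed.

Lemma sHinf_bv_conj_mul f u : sHinf f -> L2circle u ->
  L2circle (fun t => Num.conj (sbv f t) * u t).
Proof.
move=> Hf Lu; have := L2circle_conj (sHinf_bv_mul Hf (L2circle_conj Lu)).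
by congr L2circle; apply/funext => t; rewrite rmorphM /= conjCK.
Qed.

End ScalarHardy.

(** * The vector-valued Hardy space, its projection, shifts and multipliers *)

Section VectorHardy.
Context {R : realType} {m : nat}.
Implicit Types (F G H K : disc R -> 'cV[R[i]]_m) (f g : R -> 'cV[R[i]]_m).

Lemma cnorm_sqr (u : 'cV[R[i]]_m) : cnorm u ^+ 2 = \sum_(i < m) nsq (u i 0).
Proof.
have E : complex.Re (cdot u u) = \sum_(i < m) nsq (u i 0).
  by rewrite /cdot cRe_sum; apply: eq_bigr => i _; rewrite -nsqE.
rewrite /cnorm sqr_sqrtr E// sumr_ge0// => i _; exact: nsq_ge0.
Qed.

Lemma nsq_le_cnorm (u : 'cV[R[i]]_m) i : nsq (u i 0) <= cnorm u ^+ 2.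
Proof.
rewrite cnorm_sqr (bigD1 i)//= lerDl sumr_ge0// => j _; exact: nsq_ge0.
Qed.

(** The squared norm of a coefficient vector is the sum of the squared moduli of its coordinates.
    This reduces the vector-valued theory to the scalar one. *)
Lemma H2P F : H2 R m F <-> forall i, sH2 (fun z => F z i 0).
Proof.
split.
- move=> [A AF cA] i; exists (fun k => A k i 0); last by move=> z; exact: AF.
  have /cvg_seq_bounded[C [_ /(_ (C + 1))]] := cA.
  rewrite ltrDl ltr01 => /(_ isT) sC; exists (C + 1) => N.
  apply: le_trans (sC N I); apply: le_trans (ler_norm _).
  rewrite /series /= big_mkord; apply: ler_sum => k _; exact: nsq_le_cnorm.
- move=> HF.
  have /choice[a aP] : forall i, exists a, ell2 a /\ sps a (fun z => F z i 0).
    by move=> i; have [a la af] := HF i; exists a.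
  have /choice[M aM] : forall i, exists M : R, forall N, \sum_(k < N) nsq (a i k) <= M.
    by move=> i; have [la _] := aP i.
  exists (fun k => \col_i a i k).
    move=> z i j; rewrite (ord1 j); have [_ /(_ z)] := aP i.
    by under [X in _ -> X @ _ --> _]eq_fun do under eq_bigr do rewrite mxE.
  apply: nondecreasing_is_cvgn.
    by apply: nondecreasing_series => k _ _; exact: sqr_ge0.
  exists (\sum_(i < m) M i) => _ [N _ <-].
  rewrite /series /= big_mkord.
  rewrite (eq_bigr (fun k : 'I_N => \sum_(i < m) nsq (a i k))); last first.
    by move=> k _; rewrite cnorm_sqr; apply: eq_bigr => i _; rewrite mxE.
  by rewrite exchange_big /=; apply: ler_sum => i _; exact: aM.
Qed.

Definition vL2 f := forall i, L2circle (fun t => f t i 0).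

Definition ae_veq f g := forall i, ae_circle (fun t => f t i 0) (fun t => g t i 0).

Lemma H2_bv_L2 F : H2 R m F -> vL2 (bv F).
Proof.
move=> /H2P HF i; have -> : (fun t => bv F t i 0) = sbv (fun z => F z i 0).
  by apply/funext => t; rewrite bvE.
exact: sH2_L2.
Qed.

Lemma L1circle0 : L1circle (fun=> 0 : R[i]).
Proof.
exists (fun=> 0); last exact: ae_circle_refl.
by split => /=; exact: integrable0.
Qed.

Lemma circle_int_sum n (u : 'I_n -> R -> R[i]) : (forall i, L1circle (u i)) ->
  L1circle (fun t => \sum_(i < n) u i t) /\
  circle_int (fun t => \sum_(i < n) u i t) = \sum_(i < n) circle_int (u i).
Proof.
elim: n u => [|n IH] u Lu.
  under eq_fun do rewrite big_ord0; rewrite big_ord0; split.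
    exact: L1circle0.
  apply: complex_eq; rewrite /circle_int /=;
    by rewrite Rintegral_cst ?mul0r ?mulr0//; exact: measurable_circle.
have [L1 E] := IH (fun i => u (lift ord0 i)) (fun i => Lu _).
have Eq : (fun t => \sum_(i < n.+1) u i t) =
    fun t => 1 * u ord0 t + \sum_(i < n) u (lift ord0 i) t.
  by apply/funext => t; rewrite big_ord_recl mul1r.
rewrite Eq; split; first exact: L1circle_linear.
by rewrite circle_int_linear// E mul1r big_ord_recl.
Qed.

Lemma L2dotE f g : vL2 f -> vL2 g ->
  L2dot f g = \sum_(i < m) sdot (fun t => f t i 0) (fun t => g t i 0).
Proof.
move=> Lf Lg; have [_ E] := circle_int_sum (fun i => L2circleMJ (Lf i) (Lg i)).
exact: E.
Qed.

Lemma L2dot_ae f f' g g' : vL2 f' -> vL2 g' -> ae_veq f f' -> ae_veq g g' ->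
  L2dot f g = L2dot f' g'.
Proof.
move=> Lf Lg ff gg.
rewrite !L2dotE//; [|by move=> i; exact: L2circle_ae (ff i) (Lf i)
  |by move=> i; exact: L2circle_ae (gg i) (Lg i)].
by apply: eq_bigr => i _; exact: sdot_ae.
Qed.

Lemma L2dot_conj f g : vL2 f -> vL2 g -> L2dot g f = Num.conj (L2dot f g).
Proof.
move=> Lf Lg; rewrite !L2dotE// rmorph_sum; apply: eq_bigr => i _.
exact: sdot_conj.
Qed.

Lemma L2dotBl f g h : vL2 f -> vL2 g -> vL2 h ->
  L2dot (fun t => f t - g t) h = L2dot f h - L2dot g h.
Proof.
move=> Lf Lg Lh; rewrite !L2dotE//; last first.
  move=> i; under eq_fun do rewrite !mxE; exact: L2circleB.
rewrite -sumrB; apply: eq_bigr => i _; rewrite -(sdotBl (Lf i) (Lg i) (Lh i)).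
have -> : (fun t => (f t - g t) i 0) = (fun t => f t i 0 - g t i 0) by
  apply/funext => t; rewrite !mxE.
by [].
Qed.

Lemma H2dotE F G : H2 R m F -> H2 R m G ->
  H2dot F G = \sum_(i < m) sdot (sbv (fun z => F z i 0)) (sbv (fun z => G z i 0)).
Proof.
move=> HF HG; have bvi K i : (fun t => bv K t i 0) = sbv (fun z => K z i 0).
  by apply/funext => t; rewrite bvE.
rewrite /H2dot (L2dotE (H2_bv_L2 HF) (H2_bv_L2 HG)).
by apply: eq_bigr => i _; rewrite !bvi.
Qed.

Lemma H2_linear (a : R[i]) F G : H2 R m F -> H2 R m G -> H2 R m (a *: F + G).
Proof.
move=> /H2P HF /H2P HG; apply/H2P => i.
have := sH2_linear a (HF i) (HG i).
by congr sH2; apply/funext => z; rewrite !mxE.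
Qed.

Lemma sH2_0 : sH2 (fun=> 0 : R[i]).
Proof. exact: sHinf_sH2 (sHinf_cst 0). Qed.

Lemma H2_0 : H2 R m 0.
Proof.
apply/H2P => i; have -> : (fun z => (0 : disc R -> 'cV[R[i]]_m) z i 0) = fun=> 0.
  by apply/funext => z; rewrite mxE.
exact: sH2_0.
Qed.

Lemma H2dot_sip : semi_inner_product (H2 R m) (@H2dot R m).
Proof.
split.
- exact: H2_0.
- by move=> a F G HF HG; exact: H2_linear.
- move=> a F G K HF HG HK; have HaFG := H2_linear a HF HG.
  rewrite !H2dotE// mulr_sumr -big_split /=; apply: eq_bigr => i _.
  move: HF HG HK => /H2P HF /H2P HG /H2P HK.
  have LF := sH2_L2 (HF i); have LG := sH2_L2 (HG i); have LK := sH2_L2 (HK i).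
  have := has_bv_linear a (sH2_has_bv (HF i)) (sH2_has_bv (HG i)).
  have -> : (fun z => a * F z i 0 + G z i 0) = fun z => (a *: F + G) z i 0.
    by apply/funext => z; rewrite !mxE.
  move=> h; rewrite (sdot_ae (L2circle_linear a LF LG) LK h (ae_circle_refl _)).
  exact: (sip_linear sdot_sip).
- by move=> F G HF HG; apply: L2dot_conj; exact: H2_bv_L2.
- move=> F HF; rewrite H2dotE// cRe_sum sumr_ge0// => i _.
  by move/H2P : HF => HF; apply: sdot_self_ge0; exact: sH2_L2.
Qed.

Lemma H2dot_definite F : H2 R m F -> H2dot F F = 0 -> F = 0.
Proof.
move=> HF; rewrite H2dotE// => F0; have /H2P HF' := HF.
have := congr1 (@complex.Re R) F0; rewrite cRe_sum => /eqP.
rewrite psumr_eq0; last by move=> i _; apply: sdot_self_ge0; exact: sH2_L2.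
move=> /allP F00; apply/funext => z; apply/matrixP => i j; rewrite (ord1 j) mxE.
have /eqP Fi0 := F00 i (mem_index_enum i).
by have /(congr1 (fun h => h z)) := sH2_definite (HF' i) Fi0.
Qed.

Lemma H2_eq_test F G : H2 R m F -> H2 R m G ->
  (forall K, H2 R m K -> H2dot F K = H2dot G K) -> F = G.
Proof.
move=> HF HG FG; have HD := sipP_sub H2dot_sip HF HG.
apply/eqP; rewrite -subr_eq0; apply/eqP/H2dot_definite => //.
by rewrite (sipBl H2dot_sip)// FG// subrr.
Qed.

Lemma H2_projection f : vL2 f -> exists F, H2 R m F /\
  forall K, H2 R m K -> L2dot (fun t => f t - bv F t) (bv K) = 0.
Proof.
move=> Lf.
have /choice[F0 F0P] : forall i, exists h : disc R -> R[i], sH2 h /\ forall g : disc R -> R[i], sH2 g ->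
    sdot (fun t => f t i 0 - sbv h t) (sbv g) = 0.
  by move=> i; have [h Hh hP] := sH2_projection (Lf i); exists h.
pose F z := \col_i F0 i z.
have FE i : (fun z => F z i 0) = F0 i by apply/funext => z; rewrite mxE.
have HF : H2 R m F by apply/H2P => i; rewrite FE; have [] := F0P i.
exists F; split => // K HK.
rewrite L2dotBl//; [|exact: H2_bv_L2|exact: H2_bv_L2].
rewrite -L2dotBl//; [|exact: H2_bv_L2|exact: H2_bv_L2].
rewrite L2dotE; [|move=> i|exact: H2_bv_L2]; last first.
  have := L2circleB (Lf i) (H2_bv_L2 HF i).
  by congr L2circle; apply/funext => t; rewrite !mxE.
rewrite big1// => i _; have [_ h] := F0P i; move/H2P : HK => HK.
have -> : (fun t => (f t - bv F t) i 0) = (fun t => f t i 0 - sbv (F0 i) t).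
  by apply/funext => t; rewrite [LHS]mxE [X in _ + X = _]mxE bvE FE.
have -> : (fun t => bv K t i 0) = sbv (fun z => K z i 0).
  by apply/funext => t; rewrite bvE.
exact: (h _ (HK i)).
Qed.

(** Replaces the choice made in [H2proj] by the identity that characterizes the projection; the
    Toeplitz operators are handled through it. *)
Lemma H2projP f : vL2 f -> H2 R m (H2proj f) /\
  forall K, H2 R m K -> H2dot (H2proj f) K = L2dot f (bv K).
Proof.
move=> Lf; have [HF FP] := xgetPex 0 (H2_projection Lf).
split => // K HK; have := FP K HK.
rewrite L2dotBl//; [|exact: H2_bv_L2|exact: H2_bv_L2].
by move/eqP; rewrite subr_eq0 => /eqP.
Qed.

Definition zmul F : disc R -> 'cV[R[i]]_m := fun z => val z *: F z.

Lemma H2_zmul F : H2 R m F -> H2 R m (zmul F).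
Proof.
move=> /H2P HF; apply/H2P => i; have := sHinf_mul sHinf_val (HF i).
by congr sH2; apply/funext => z; rewrite mxE.
Qed.

Lemma bshift_unique F K : H2 R m K ->
  (forall z, val z *: K z = F z - F (disc0 R)) -> bshift F = K.
Proof.
move=> HK KF; apply: xget_unique => // K' [HK' K'F].
move/H2P : HK => HK; move/H2P : HK' => HK'.
apply/funext => z; apply/matrixP => i j; rewrite (ord1 j).
have e y : val y * K' y i 0 = val y * K y i 0.
  have : val y *: K' y = val y *: K y by rewrite K'F KF.
  by move=> /matrixP/(_ i 0); rewrite !mxE.
exact: (congr1 (fun k : disc R -> R[i] => k z) (sH2_disc0_eq (HK' i) (HK i) e)).
Qed.

Lemma bshiftP F : H2 R m F -> H2 R m (bshift F) /\
  forall z, val z *: bshift F z = F z - F (disc0 R).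
Proof.
move=> /H2P HF.
suff : exists K, [set K | H2 R m K /\ forall z, val z *: K z = F z - F (disc0 R)] K.
  by move=> /(xgetPex 0).
have /choice[K KP] : forall i, exists h : disc R -> R[i], sH2 h /\
    forall z, val z * h z = F z i 0 - F (disc0 R) i 0.
  by move=> i; have [h Hh hP] := sH2_shift (HF i); exists h.
exists (fun z => \col_i K i z); split.
  apply/H2P => i; have [h _] := KP i; move: h; congr sH2.
  by apply/funext => z; rewrite mxE.
move=> z; apply/matrixP => i j; rewrite (ord1 j) !mxE.
by have [_] := KP i; exact.
Qed.

(** The adjoint of the backward shift is multiplication by [z], obtained coordinatewise from
    [sdot_shift]. *)
Lemma H2dot_bshift F K : H2 R m F -> H2 R m K ->
  H2dot (bshift F) K = H2dot F (zmul K).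
Proof.
move=> HF HK; have [HB BF] := bshiftP HF; have HzK := H2_zmul HK.
rewrite (H2dotE HB HK) (H2dotE HF HzK); apply: eq_bigr => i _.
have -> : (fun z => zmul K z i 0) = fun z => val z * K z i 0.
  by apply/funext => z; rewrite mxE.
move/H2P : HF => HF; move/H2P : HB => HB; move/H2P : HK => HK.
apply: sdot_shift => // z; have /matrixP/(_ i 0) := BF z.
by rewrite !mxE.
Qed.

Definition mxmul (A : disc R -> 'M[R[i]]_m) F : disc R -> 'cV[R[i]]_m :=
  fun z => A z *m F z.

(** The operator bound at the basis vector [e_j] bounds column [j], hence each of its entries. *)
Lemma Hinf_entry (A : disc R -> 'M[R[i]]_m) i j :
  Hinf A -> sHinf (fun z => A z i j).
Proof.
move=> [[a aA] [M AM]]; exists (fun k => a k i j); first by move=> z; exact: aA.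
exists (M ^+ 2) => z; pose e : 'cV[R[i]]_m := delta_mx j 0.
have e1 : cnorm e = 1.
  apply/eqP; rewrite -(@eqrXn2 _ 2)// ?sqrtr_ge0// cnorm_sqr expr1n.
  rewrite (bigD1 j)//= mxE !eqxx nsq1 big1 ?addr0// => k /negPf kj.
  by rewrite mxE kj nsq0.
have := AM z e; rewrite e1 mulr1 => h.
have <- : (A z *m e) i 0 = A z i j.
  rewrite mxE (bigD1 j)//= mxE !eqxx mulr1 big1 ?addr0// => k /negPf kj.
  by rewrite mxE kj mulr0.
apply: le_trans (nsq_le_cnorm _ _) _.
by rewrite ler_sqr ?nnegrE ?sqrtr_ge0// (le_trans _ h)// sqrtr_ge0.
Qed.

Lemma ae_circle_sum n (u v : 'I_n -> R -> R[i]) :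
  (forall i, ae_circle (u i) (v i)) ->
  ae_circle (fun t => \sum_(i < n) u i t) (fun t => \sum_(i < n) v i t).
Proof.
elim: n u v => [|n IH] u v uv.
  by apply: aeW => t _; rewrite !big_ord0.
have h := IH _ _ (fun i => uv (lift ord0 i)).
move: h (uv ord0); apply: filterS2 => t h1 h2 It.
by rewrite !big_ord_recl h1// h2.
Qed.

Lemma L2circle_sum n (u : 'I_n -> R -> R[i]) : (forall i, L2circle (u i)) ->
  L2circle (fun t => \sum_(i < n) u i t).
Proof.
move=> Lu; have := sipP_sum sdot_sip (fun=> 1) (v := u) Lu.
congr L2circle; apply/funext => t; rewrite fct_sumE; apply: eq_bigr => i _.
exact: mul1r.
Qed.

Lemma sH2_sum n (u : 'I_n -> disc R -> R[i]) : (forall i, sH2 (u i)) ->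
  sH2 (fun z => \sum_(i < n) u i z) /\
  ae_circle (sbv (fun z => \sum_(i < n) u i z)) (fun t => \sum_(i < n) sbv (u i) t).
Proof.
elim: n u => [|n IH] u Hu.
  under eq_fun do rewrite big_ord0; split; first exact: sH2_0.
  by apply: aeW => t _; rewrite sbv_cst big_ord0.
have [H1 h1] := IH (fun i => u (lift ord0 i)) (fun i => Hu _).
have E : (fun z => \sum_(i < n.+1) u i z) =
    fun z => 1 * u ord0 z + \sum_(i < n) u (lift ord0 i) z.
  by apply/funext => z; rewrite big_ord_recl mul1r.
rewrite E; split; first exact: (sH2_linear 1 (Hu ord0) H1).
have h2 := has_bv_linear 1 (sH2_has_bv (Hu ord0)) (sH2_has_bv H1).
move: h1 h2; apply: filterS2 => t h1 h2 It.
by rewrite h2// h1// mul1r big_ord_recl.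
Qed.

Lemma H2_mxmul (A : disc R -> 'M[R[i]]_m) F : Hinf A -> H2 R m F ->
  H2 R m (mxmul A F) /\ ae_veq (bv (mxmul A F)) (fun t => bv A t *m bv F t).
Proof.
move=> HA /H2P HF.
have Hij i j : sH2 (fun z => A z i j * F z j 0).
  exact: sHinf_mul (Hinf_entry i j HA) (HF j).
have E i : (fun z => mxmul A F z i 0) = fun z => \sum_(j < m) A z i j * F z j 0.
  by apply/funext => z; rewrite mxE.
split; first by apply/H2P => i; rewrite E; have [] := sH2_sum (Hij i).
move=> i; have [_ h] := sH2_sum (Hij i).
have h' := @ae_circle_sum _ _ _ (fun j => has_bvM
  (sH2_has_bv (sHinf_sH2 (Hinf_entry i j HA))) (sH2_has_bv (HF j))).
have h'' := ae_circle_trans h h'.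
move: h''; apply: filterS => t h'' It.
rewrite bvE E h''// mxE; apply: eq_bigr => j _.
by rewrite !bvE.
Qed.

Lemma adjmx_vL2 (A : disc R -> 'M[R[i]]_m) f : Hinf A -> vL2 f ->
  vL2 (fun t => adjmx (bv A t) *m f t).
Proof.
move=> HA Lf i.
have -> : (fun t => (adjmx (bv A t) *m f t) i 0) =
    fun t => \sum_(j < m) Num.conj (sbv (fun z => A z j i) t) * f t j 0.
  by apply/funext => t; rewrite mxE; apply: eq_bigr => j _; rewrite !mxE -bvE mxE.
by apply: L2circle_sum => j; exact: sHinf_bv_conj_mul (Hinf_entry j i HA) (Lf j).
Qed.

Lemma cdot_adjmx (A : 'M[R[i]]_m) (u v : 'cV[R[i]]_m) :
  cdot (adjmx A *m u) v = cdot u (A *m v).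
Proof.
rewrite /cdot.
transitivity (\sum_(i < m) \sum_(j < m) Num.conj (A j i) * u j 0 * Num.conj (v i 0)).
  apply: eq_bigr => i _; rewrite mxE mulr_suml; apply: eq_bigr => j _.
  by rewrite !mxE.
rewrite exchange_big /=; apply: eq_bigr => j _.
rewrite mxE rmorph_sum mulr_sumr; apply: eq_bigr => i _.
by rewrite rmorphM /= mulrAC mulrC [Num.conj _ * _]mulrC.
Qed.

Lemma L2dot_adjmx (A : R -> 'M[R[i]]_m) f g :
  L2dot (fun t => adjmx (A t) *m f t) g = L2dot f (fun t => A t *m g t).
Proof.
by rewrite /L2dot; congr circle_int; apply/funext => t; rewrite cdot_adjmx.
Qed.

Lemma ae_veq_refl f : ae_veq f f.
Proof. by move=> i; exact: ae_circle_refl. Qed.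

Lemma ae_veq_sym f g : ae_veq f g -> ae_veq g f.
Proof. by move=> fg i; apply: ae_circle_sym; exact: fg. Qed.

Lemma vL2_ae f g : ae_veq f g -> vL2 g -> vL2 f.
Proof. by move=> fg Lg i; exact: L2circle_ae (fg i) (Lg i). Qed.

Lemma H2_mxmul_vL2 (A : disc R -> 'M[R[i]]_m) F : Hinf A -> H2 R m F ->
  vL2 (fun t => bv A t *m bv F t).
Proof.
move=> HA HF; have [HAF h] := H2_mxmul HA HF.
exact: vL2_ae (ae_veq_sym h) (H2_bv_L2 HAF).
Qed.

Lemma L2dot_bv_adjmx (A : disc R -> 'M[R[i]]_m) f K : Hinf A -> vL2 f -> H2 R m K ->
  L2dot (fun t => adjmx (bv A t) *m f t) (bv K) = L2dot f (bv (mxmul A K)).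
Proof.
move=> HA Lf HK; have [HAK h] := H2_mxmul HA HK; rewrite L2dot_adjmx.
by apply: L2dot_ae => //; [exact: H2_bv_L2|exact: ae_veq_refl|exact: ae_veq_sym].
Qed.

End VectorHardy.

(** * Toeplitz operators *)

Section Toeplitz.
Context {R : realType} {m : nat}.
Local Notation mu := (@lebesgue_measure R).
Implicit Types (F G H K : disc R -> 'cV[R[i]]_m) (A B : disc R -> 'M[R[i]]_m).

Lemma ae_circle_forall (I : finType) (P : I -> R -> Prop) :
  (forall i, {ae mu, forall t, circle t -> P i t}) ->
  {ae mu, forall t, circle t -> forall i, P i t}.
Proof.
move=> aeP.
have H : \forall t \near almost_everywhere mu, forall i, circle t -> P i t.
  exact: filter_forall.
have sub t : (forall i, circle t -> P i t) -> circle t -> forall i, P i t.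
  by move=> PP It i; exact: PP.
exact: (filterS sub H).
Qed.

(** The entries of the product are constant on the disc, and radial limits respect sums and products
    almost everywhere. *)
Lemma bv_inverse A B : Hinf A -> Hinf B -> (forall z, A z *m B z = 1%:M) ->
  {ae mu, forall t, circle t -> bv A t *m bv B t = 1%:M}.
Proof.
move=> HA HB AB.
have h i k : ae_circle (fun t => (bv A t *m bv B t) i k) (fun=> (1%:M : 'M[R[i]]_m) i k).
  have Hj j : sH2 (fun z => A z i j * B z j k).
    exact: sHinf_mul (Hinf_entry i j HA) (sHinf_sH2 (Hinf_entry j k HB)).
  have [_ h1] := sH2_sum Hj.
  have h2 := ae_circle_sum (fun j => has_bvM
    (sH2_has_bv (sHinf_sH2 (Hinf_entry i j HA)))
    (sH2_has_bv (sHinf_sH2 (Hinf_entry j k HB)))).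
  have := ae_circle_trans h1 h2; apply: filterS => t ht It.
  rewrite mxE; under eq_bigr do rewrite !bvE.
  rewrite -ht//.
  have -> : (fun z => \sum_(j < m) A z i j * B z j k) = fun=> (1%:M : 'M[R[i]]_m) i k.
    by apply/funext => z; rewrite -(AB z) mxE.
  by rewrite sbv_cst.
have H := ae_circle_forall (fun i => ae_circle_forall (h i)).
by move: H; apply: filterS => t hh It; apply/matrixP => i k; exact: hh.
Qed.

Lemma adjmxM (U V : 'M[R[i]]_m) : adjmx (U *m V) = adjmx V *m adjmx U.
Proof. by rewrite /adjmx trmx_mul map_mxM. Qed.

Lemma adjmx1 : adjmx (1%:M : 'M[R[i]]_m) = 1%:M.
Proof. by rewrite /adjmx trmx1 map_mx1. Qed.

Lemma invmx_eq (U V : 'M[R[i]]_m) : U *m V = 1%:M -> invmx U = V.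
Proof.
move=> UV; have [Uu _] := mulmx1_unit UV.
by rewrite -[invmx U]mulmx1 -UV mulmxA mulVmx// mul1mx.
Qed.

(** At angles where the matrix is singular [invmx] returns a default; such angles form a null set,
    and off it the inverse of the adjoint is the adjoint of [bv B t]. *)
Lemma invmx_adjmx_ae A B f : Hinf A -> Hinf B -> (forall z, A z *m B z = 1%:M) ->
  ae_veq (fun t => invmx (adjmx (bv A t)) *m f t) (fun t => adjmx (bv B t) *m f t).
Proof.
move=> HA HB AB i; have := bv_inverse HA HB AB; apply: filterS => t h It.
rewrite (@invmx_eq _ (adjmx (bv B t)))//.
by rewrite -adjmxM (mulmx1C (h It)) adjmx1.
Qed.

Lemma toeplitz_coanalytic_inverse A B F : Hinf A -> Hinf B ->
  (forall z, A z *m B z = 1%:M) -> H2 R m F ->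
  let T := toeplitz (fun t => invmx (adjmx (bv A t))) F in
  H2 R m T /\ forall K, H2 R m K -> H2dot T K = H2dot F (mxmul B K).
Proof.
move=> HA HB AB HF T; have ae := invmx_adjmx_ae (bv F) HA HB AB.
have Lg := adjmx_vL2 HB (H2_bv_L2 HF).
have Lg' : vL2 (fun t => invmx (adjmx (bv A t)) *m bv F t) := vL2_ae ae Lg.
have [HT TP] := H2projP Lg'.
split=> [|K HK]; first exact: HT.
transitivity (L2dot (fun t => invmx (adjmx (bv A t)) *m bv F t) (bv K)).
  exact: (TP K HK).
rewrite (L2dot_ae Lg (H2_bv_L2 HK) ae (ae_veq_refl _)).
exact: (L2dot_bv_adjmx HB (H2_bv_L2 HF) HK).
Qed.

Lemma toeplitz_factored A B F : Hinf A -> Hinf B -> H2 R m F ->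
  let T := toeplitz (fun t => adjmx (bv A t) *m bv B t) F in
  H2 R m T /\ forall K, H2 R m K -> H2dot T K = H2dot (mxmul B F) (mxmul A K).
Proof.
move=> HA HB HF T; have [HBF BF] := H2_mxmul HB HF.
have LBF := H2_mxmul_vL2 HB HF.
have E : (fun t => (adjmx (bv A t) *m bv B t) *m bv F t) =
    fun t => adjmx (bv A t) *m (bv B t *m bv F t).
  by apply/funext => t; rewrite mulmxA.
have Lg : vL2 (fun t => (adjmx (bv A t) *m bv B t) *m bv F t).
  by rewrite E; exact: adjmx_vL2.
have [HT TP] := H2projP Lg.
split=> [|K HK]; first exact: HT.
have [HAK AK] := H2_mxmul HA HK.
transitivity (L2dot (fun t => (adjmx (bv A t) *m bv B t) *m bv F t) (bv K)).
  exact: (TP K HK).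
rewrite E (L2dot_bv_adjmx HA LBF HK).
exact: (L2dot_ae (H2_bv_L2 HBF) (H2_bv_L2 HAK) (ae_veq_sym BF) (ae_veq_refl _)).
Qed.

(** The witness is the projection of [A^* F], the image of [F] under the adjoint of multiplication
    by [A]. *)
Lemma H2dot_mxmul A F : Hinf A -> H2 R m F ->
  exists2 Z, H2 R m Z & forall K, H2 R m K -> H2dot (mxmul A K) F = H2dot K Z.
Proof.
move=> HA HF; have Lg := adjmx_vL2 HA (H2_bv_L2 HF).
have [Z [HZ ZP]] : exists Z, H2 R m Z /\ forall K, H2 R m K ->
    H2dot Z K = L2dot (fun t => adjmx (bv A t) *m bv F t) (bv K).
  by exists (H2proj (fun t => adjmx (bv A t) *m bv F t)); exact: H2projP.
exists Z => [|K HK]; first exact: HZ.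
have [HAK _] := H2_mxmul HA HK.
have e1 : H2dot (mxmul A K) F = Num.conj (H2dot F (mxmul A K)).
  exact: (sipC H2dot_sip HF HAK).
have e2 : H2dot K Z = Num.conj (H2dot Z K) := sipC H2dot_sip HZ HK.
suff e3 : H2dot F (mxmul A K) = H2dot Z K.
  exact: (etrans e1 (etrans (congr1 _ e3) (esym e2))).
by rewrite (ZP K HK) (L2dot_bv_adjmx HA (H2_bv_L2 HF) HK).
Qed.

(** Cauchy-Schwarz makes each functional [H2dot F (Z i)] continuous in [F], so a limit of orthogonal
    elements stays orthogonal. *)
Lemma orthogonal_closed (I : Type) (S : set I) (Z : I -> disc R -> 'cV[R[i]]_m) :
  (forall i, S i -> H2 R m (Z i)) ->
  H2closed_subspace [set F | H2 R m F /\ forall i, S i -> H2dot F (Z i) = 0].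
Proof.
move=> HZ; split; first split.
- by move=> F [].
- split=> [|i Si]; first exact: H2_0.
  exact: (sip0l H2dot_sip (HZ i Si)).
- move=> a F G [HF FZ] [HG GZ]; split=> [|i Si]; first exact: (H2_linear a HF HG).
  have e : H2dot (a *: F + G) (Z i) = a * H2dot F (Z i) + H2dot G (Z i).
    exact: (sip_linear H2dot_sip a HF HG (HZ i Si)).
  by rewrite e (FZ i Si) (GZ i Si) mulr0 addr0.
move=> F HF nearF; split=> [|i Si]; first exact: HF.
have HZi := HZ i Si.
apply: nsq_eq0; apply/eqP; rewrite eq_le nsq_ge0 andbT.
set W := complex.Re (H2dot (Z i) (Z i)).
have W0 : 0 <= W := sip_ge0 H2dot_sip HZi.
apply/ler_addgt0Pl => e e0; rewrite addr0.
have W1 : 0 < W + 1 by rewrite ltr_wpDl.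
have d0 : 0 < Num.sqrt (e / (W + 1)) by rewrite sqrtr_gt0 divr_gt0.
have [G [HG GZ]] := nearF _ d0.
rewrite /H2norm ltr_sqrt ?divr_gt0// => FG.
have HFG : H2 R m (F - G) := sipP_sub H2dot_sip HF HG.
have cs : nsq (H2dot (F - G) (Z i)) <= complex.Re (H2dot (F - G) (F - G)) * W.
  exact: (sip_cauchy_schwarz H2dot_sip HFG HZi).
have e1 : H2dot (F - G) (Z i) = H2dot F (Z i) - H2dot G (Z i).
  exact: (sipBl H2dot_sip HF HG HZi).
rewrite e1 (GZ i Si) subr0 in cs; apply: (le_trans cs).
rewrite -[leRHS](@divfK _ (W + 1)) ?gt_eqF//.
have FG0 : 0 <= complex.Re (H2dot (F - G) (F - G)) := sip_ge0 H2dot_sip HFG.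
by apply: ler_pM; [exact: FG0|exact: W0|exact: ltW|rewrite lerDl].
Qed.

(** An orthonormal basis from [gram_schmidt] shows that a finite linear span is already closed, so
    the closure adds nothing; the same basis gives the dimension bound. *)
Lemma cspanE n (v : 'I_n -> disc R -> 'cV[R[i]]_m) : (forall i, H2 R m (v i)) ->
  cspan v = linear_span v /\
  H2subspace (linear_span v) /\
  exists2 d : nat, (d <= n)%N & has_dim d (linear_span v).
Proof.
move=> Hv.
have [d [u [dn ou uv]]] := gram_schmidt H2dot_sip H2dot_definite Hv.
have sub : H2subspace (linear_span v).
  split.
  - by move=> F [c ->]; exact: (sipP_sum H2dot_sip).
  - exact: linear_span0.
  - by move=> a F G; exact: linear_span_closed.
split; last first.
  split => //; exists d => //; exists u; last by rewrite -uv.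
  by move=> c; exact: (orthonormal_family_free H2dot_sip ou).
apply/seteqP; split.
- apply: smallest_sub.
    split => // F HF nearF; rewrite -uv.
    apply: (linear_span_complete H2dot_sip H2dot_definite ou HF) => e e0.
    by rewrite uv; exact: nearF.
  by move=> _ [i _ <-]; exact: linear_span_gen.
- move=> F [c ->] V [[[VH V0 Vlin] _] Vv].
  apply: (big_ind V) => //.
    by move=> x y Vx Vy; rewrite -[x]scale1r; exact: Vlin.
  move=> i _; rewrite -[_ *: _]addr0; apply: Vlin => //; apply: Vv; by exists i.
Qed.

Lemma mxmul_sum n (A : disc R -> 'M[R[i]]_m) (c : 'I_n -> R[i])
    (v : 'I_n -> disc R -> 'cV[R[i]]_m) :
  mxmul A (\sum_(i < n) c i *: v i) = \sum_(i < n) c i *: mxmul A (v i).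
Proof.
apply/funext => z; rewrite /mxmul !fct_sumE mulmx_sumr; apply: eq_bigr => i _.
by rewrite -scalemxAr.
Qed.

Lemma mxmul_zmul A F : mxmul A (zmul F) = zmul (mxmul A F).
Proof. by apply/funext => z; rewrite /mxmul /zmul -scalemxAr. Qed.

Lemma mxmulK A B F : (forall z, B z *m A z = 1%:M) -> mxmul B (mxmul A F) = F.
Proof. by move=> BA; apply/funext => z; rewrite /mxmul mulmxA BA mul1mx. Qed.

Lemma zmul_bshift F : H2 R m F -> F (disc0 R) = 0 -> zmul (bshift F) = F.
Proof.
move=> HF F0; have [_ h] := bshiftP HF.
by apply/funext => z; rewrite /zmul h F0 subr0.
Qed.

(** Since [bshift (zmul F) = F], this is an instance of the adjoint relation [H2dot_bshift]. *)
Lemma H2dot_zmul F K : H2 R m F -> H2 R m K ->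
  H2dot (zmul F) (zmul K) = H2dot F K.
Proof.
move=> HF HK; rewrite -(H2dot_bshift (H2_zmul HF) HK).
rewrite (bshift_unique HF)// => z.
by rewrite /zmul /= scale0r subr0.
Qed.

End Toeplitz.

(** * Near invariance of the kernel and the two forms of its defect space *)

Theorem theorem4p1 (R : realType) (m n : nat) (m_gt0 : (0 < m)%N)
    (n_gt0 : (0 < n)%N)
    (F1 F2 : disc R -> 'M[R[i]]_m) (hF1 : GHinf F1) (hF2 : GHinf F2)
    (G H : 'I_n -> disc R -> 'cV[R[i]]_m)
    (hG : orthonormal_set G) (hH : orthonormal_set H) :
  let Phi := fun t : R => adjmx (bv F1 t) *m bv F2 t in
  let Tn := perturbed_toeplitz Phi G H in
  let F1adjV := fun t : R => invmx (adjmx (bv F1 t)) in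
  let D := cspan (fun (i : 'I_n) (z : disc R) =>
    invmx (F2 z) *m toeplitz F1adjV (bshift (H i)) z) in
  nearly_invariant_defect_le n (kernel_in_H2 Tn) D /\
  D = cspan (fun (i : 'I_n) (z : disc R) =>
    invmx (F2 z) *m bshift (toeplitz F1adjV (H i)) z).
Proof.
move=> Phi Tn F1adjV D.
have [HF1 [K1 HK1 F1K1]] := hF1; have [HF2 [K2 HK2 F2K2]] := hF2.
have [HG _] := hG; have [HH _] := hH.
have T1P F (HF : H2 R m F) :=
  toeplitz_coanalytic_inverse HF1 HK1 (fun z => (F1K1 z).1) HF.
have inv2 z : invmx (F2 z) = K2 z by apply: invmx_eq; have [] := F2K2 z.
have HS i : H2 R m (bshift (H i)) by have [] := bshiftP (HH i).
have HTS i : H2 R m (toeplitz F1adjV (bshift (H i))) by have [] := T1P _ (HS i).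
pose E i := mxmul K2 (toeplitz F1adjV (bshift (H i))).
have HE i : H2 R m (E i) by have [] := H2_mxmul HK2 (HTS i).
have DE : D = cspan E.
  by congr cspan; apply/funext => i; apply/funext => z; rewrite inv2.
have [spanE [subE dimE]] := cspanE HE.
split; last first.
  congr cspan; apply/funext => i; apply/funext => z; congr (_ *m _).
  apply: (congr1 (fun k : disc R -> 'cV[R[i]]_m => k z)).
  have [HTH TH] := T1P _ (HH i); have [HBT _] := bshiftP HTH.
  apply: (H2_eq_test (HTS i) HBT) => K HK; have HzK := H2_zmul HK.
  have [_ TS] := T1P _ (HS i); have [HK1K _] := H2_mxmul HK1 HK.
  (* With [K1] the inverse of [F1], both sides become the product of [H i] with [z K1 K], as [K1]
     commutes with multiplication by [z]. *)
  rewrite (TS K HK) (H2dot_bshift (HH i) HK1K) (H2dot_bshift HTH HK) (TH _ HzK).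
  by rewrite mxmul_zmul.
(* Membership in the kernel is orthogonality to a family of elements of H2. *)
have /choice[Z0 Z0P] : forall K, exists Z, H2 R m K -> H2 R m Z /\
    forall F, H2 R m F -> H2dot (mxmul F2 F) (mxmul F1 K) = H2dot F Z.
  (* [choice] asks for a value at every [K]; outside H^2 the value is 0. *)
  move=> K; have [HK|NK] := pselect (H2 R m K); last by exists 0.
  have [HF1K _] := H2_mxmul HF1 HK.
  by have [Z HZ ZP] := H2dot_mxmul HF2 HF1K; exists Z => _; split; [exact: HZ|exact: ZP].
(* This is [T_n^* K]: the finite-rank part has the roles of [G] and [H] exchanged, and [Z0 K] is the
   adjoint Toeplitz part. *)
pose Z K := \sum_(i < n) H2dot K (H i) *: G i + Z0 K.
have HZ K : H2 R m K -> H2 R m (Z K).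
  move=> HK; have [HZ0 _] := Z0P K HK.
  exact: (sipP_add H2dot_sip (sipP_sum H2dot_sip (fun i => H2dot K (H i)) HG) HZ0).
have HTn F : H2 R m F -> H2 R m (Tn F).
  move=> HF; have [HT _] := toeplitz_factored HF1 HF2 HF.
  exact: (sipP_add H2dot_sip HT (sipP_sum H2dot_sip (fun i => H2dot F (G i)) HH)).
have TnP F K : H2 R m F -> H2 R m K -> H2dot (Tn F) K =
    H2dot (mxmul F2 F) (mxmul F1 K) + \sum_(i < n) H2dot F (G i) * H2dot (H i) K.
  move=> HF HK; have [HT TP] := toeplitz_factored HF1 HF2 HF.
  have Hs := sipP_sum H2dot_sip (fun i => H2dot F (G i)) HH.
  rewrite -(TP K HK) -(sip_suml H2dot_sip (fun i => H2dot F (G i)) HH HK).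
  exact: (sipDl H2dot_sip HT Hs HK).
have TnZ F K : H2 R m F -> H2 R m K -> H2dot (Tn F) K = H2dot F (Z K).
  move=> HF HK; have [HZ0 Z0E] := Z0P K HK; rewrite (TnP F K HF HK) (Z0E F HF).
  have Hs := sipP_sum H2dot_sip (fun i => H2dot K (H i)) HG.
  have -> : H2dot F (Z K) = H2dot F (\sum_(i < n) H2dot K (H i) *: G i) +
      H2dot F (Z0 K) := sipDr H2dot_sip HF Hs HZ0.
  rewrite (sip_sumr H2dot_sip (fun i => H2dot K (H i)) HG HF) addrC.
  have Ei i : Num.conj (H2dot K (H i)) * H2dot F (G i) =
      H2dot F (G i) * H2dot (H i) K.
    have Hi : H2dot (H i) K = Num.conj (H2dot K (H i)) := sipC H2dot_sip HK (HH i).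
    by rewrite Hi; exact: mulrC.
  apply: (congr1 (fun x => x + H2dot F (Z0 K))).
  by apply: eq_bigr => i _; exact: (esym (Ei i)).
have dot0 K : H2 R m K -> H2dot 0 K = 0 := sip0l H2dot_sip (z := K).
have kerE : kernel_in_H2 Tn =
    [set F | H2 R m F /\ forall K, H2 R m K -> H2dot F (Z K) = 0].
  apply/seteqP; split => F [HF h]; (split; first exact: HF).
    by move=> K HK; rewrite -(TnZ F K HF HK) h (dot0 K HK).
  apply: (H2_eq_test (HTn F HF) H2_0) => K HK.
  by rewrite (TnZ F K HF HK) (h K HK) (dot0 K HK).
rewrite DE spanE; split; [|exact: subE|exact: dimE|].
  by rewrite kerE; exact: (orthogonal_closed HZ).
move=> F kerF F0; have [HF TnF0] := kerF.
(* The kernel component of the decomposition is 0. *)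
exists 0, (bshift F); split; last by rewrite add0r.
  rewrite kerE; split=> [|K HK]; first exact: H2_0.
  exact: dot0 (HZ K HK).
(* Moving the finite-rank term of [T_n F = 0] to the other side produces these coefficients. *)
exists (fun i => - H2dot F (G i)).
have [HX _] := bshiftP HF; have [HQ _] := H2_mxmul HF2 HX.
set Q := mxmul F2 (bshift F) in HQ.
(* Each [E i] is [K2] applied to a Toeplitz vector, so it is enough to expand [Q = F2 S^*F] in the
   Toeplitz vectors themselves. *)
have -> : bshift F = mxmul K2 Q.
  by rewrite mxmulK// => z; have [] := F2K2 z.
rewrite /E -mxmul_sum; congr mxmul.
have Hsum := sipP_sum H2dot_sip (fun i => - H2dot F (G i)) HTS.
apply: (H2_eq_test HQ Hsum) => K HK.
have [HK1K _] := H2_mxmul HK1 HK; have HzK1K := H2_zmul HK1K.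
have := TnP F _ HF HzK1K; rewrite TnF0 (dot0 _ HzK1K).
rewrite mxmul_zmul mxmulK; last by move=> z; have [] := F1K1 z.
(* The identity [F = z S^*F] gives [F2 F = z Q], and the two factors [z] cancel because
   multiplication by [z] is isometric. *)
rewrite -{1}(zmul_bshift HF F0) mxmul_zmul -/Q (H2dot_zmul HQ HK) => /esym/eqP.
rewrite addr_eq0 => /eqP ->.
rewrite (sip_suml H2dot_sip (fun i => - H2dot F (G i)) HTS HK) -sumrN.
apply: eq_bigr => i _; rewrite mulNr.
have [_ TS] := T1P _ (HS i).
by rewrite (TS K HK) (H2dot_bshift (HH i) HK1K).
Qed.
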